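(* Let $X_1,X_2,\dots$ be classical i.i.d. random variables on a probability space with $\mathbf E[X_1]=\mu$ and $0<\sigma^2=\mathbf{Var}\,X_1<\infty$, and let $\xi_i=(X_i-\mu)/\sigma$. For an integer $n\ge1$ let $S_n=S_n(\cdot)$ be the random continuous broken line on $[0,1]$, linear on each $[\frac{k-1}n,\frac kn]$, with $S_n(0)=0$ and $S_n(\frac kn)=\frac1{\sqrt n}\sum_{i=1}^k\xi_i$, $k=1,\dots,n$, and let $B$ be a standard Wiener process on $[0,1]$. Then the classical Prokhorov distance satisfies, for every $p\in[2,3]$, $$\Pi(S_n,B)\le 4.7\,\frac{\big(\mathbf E\min\{|\xi_1|^p,\sqrt n\,\xi_1^2\}\big)^{1/(p+1)}}{n^{(p-2)/(2p+2)}}\le 4.7\,\frac{\big(\mathbf E|\xi_1|^p\big)^{1/(p+1)}}{n^{(p-2)/(2p+2)}}.$$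
   Context: $\mathbb C[0,1]$ is the space of continuous real functions on $[0,1]$ with the uniform norm $\|\cdot\|$, and for $D\subset\mathbb C[0,1]$, $D^\varepsilon=\{x\in\mathbb C[0,1]:\exists y\in D,\ \|x-y\|<\varepsilon\}$. The Prokhorov distance between the distributions of $S_n$ and $B$ in $\mathbb C[0,1]$ is $$\Pi(S_n,B)=\inf\Big\{\varepsilon>0:\ \sup_{D}\big[\mathbf P(S_n\in D)-\mathbf P(B\in D^\varepsilon)\big]\le\varepsilon\Big\},$$ the supremum being over all measurable sets $D\subset\mathbb C[0,1]$. The moment $\mathbf E|\xi_1|^p$ may be infinite. *)

(* Defs.v *)
From HB Require Import structures.
From mathcomp Require Import all_boot all_order all_algebra finmap.
From mathcomp Require Import all_classical all_reals all_analysis.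

Set Implicit Arguments.
Unset Strict Implicit.
Unset Printing Implicit Defensive.

Import Order.TTheory GRing.Theory Num.Theory.
Import numFieldNormedType.Exports.

Local Open Scope classical_set_scope.
Local Open Scope ring_scope.

Definition unit_set (R : realType) : set R := `[0, 1].
Arguments unit_set : clear implicits.

Definition unit_itv (R : realType) : Type := set_type (unit_set R).

HB.instance Definition _ (R : realType) := Topological.on (unit_itv R).

(* A point of the domain is an element [t] of the subtype of [0, 1], with
   underlying real [set_val t]; no value is attached to reals outside [0, 1]. *)
Record C01 (R : realType) := MkC01 {
  C01_fun :> unit_itv R -> R ;
  C01_continuous : continuous C01_fun
}.

HB.instance Definition _ (R : realType) := gen_eqMixin (C01 R).
HB.instance Definition _ (R : realType) := gen_choiceMixin (C01 R).

Lemma C01P (R : realType) (f g : C01 R) : f =1 g -> f = g.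
Proof.
case: f g => [f cf] [g cg] /= /funext fg; rewrite fg in cf *.
by congr MkC01; exact: Prop_irrelevance.
Qed.

Section C01_lmodule.
Context {R : realType}.
Implicit Types f g h : C01 R.

Let zero_cont : continuous (fun _ : unit_itv R => 0 : R).
Proof. exact: cst_continuous. Qed.

Let opp_cont f : continuous (fun t => - f t).
Proof. by move=> t; exact: (cvgN (@C01_continuous R f t)). Qed.

Let add_cont f g : continuous (fun t => f t + g t).
Proof. by move=> t; exact: (cvgD (@C01_continuous R f t) (@C01_continuous R g t)). Qed.

Let scale_cont (a : R) f : continuous (fun t => a * f t).
Proof. by move=> t; exact: (cvgMr (@C01_continuous R f t)). Qed.

Definition C01_zero : C01 R := MkC01 zero_cont.
Definition C01_opp f : C01 R := MkC01 (@opp_cont f).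
Definition C01_add f g : C01 R := MkC01 (@add_cont f g).
Definition C01_scale a f : C01 R := MkC01 (@scale_cont a f).

Let addA : associative C01_add.
Proof. by move=> f g h; apply/C01P => t; exact: addrA. Qed.

Let addC : commutative C01_add.
Proof. by move=> f g; apply/C01P => t; exact: addrC. Qed.

Let add0 : left_id C01_zero C01_add.
Proof. by move=> f; apply/C01P => t; exact: add0r. Qed.

Let addN : left_inverse C01_zero C01_opp C01_add.
Proof. by move=> f; apply/C01P => t; exact: addNr. Qed.

HB.instance Definition _ :=
  GRing.isZmodule.Build (C01 R) addA addC add0 addN.

Let scaleA a b f : C01_scale a (C01_scale b f) = C01_scale (a * b) f.
Proof. by apply/C01P => t; exact: mulrA. Qed.

Let scale1 : left_id 1 C01_scale.
Proof. by move=> f; apply/C01P => t; exact: mul1r. Qed.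

Let scaleDr : right_distributive C01_scale +%R.
Proof. by move=> a f g; apply/C01P => t; exact: mulrDr. Qed.

Let scaleDl f : {morph C01_scale^~ f : a b / a + b}.
Proof. by move=> a b; apply/C01P => t; exact: mulrDl. Qed.

HB.instance Definition _ :=
  GRing.Zmodule_isLmodule.Build R (C01 R) scaleA scale1 scaleDr scaleDl.

End C01_lmodule.

Section C01_normed.
Context {R : realType}.
Implicit Types f g : C01 R.

Definition unif_norm f : R := sup (range (fun t => `|f t|)).

Let unit_itv0 : unit_itv R.
Proof. by exists 0; rewrite inE /unit_set /= in_itv /= lexx ler01. Defined.

Lemma C01_bounded f : exists M, forall t, `|f t| <= M.
Proof.
have cf : {within `[0, 1], continuous (valL f)}.
  exact/subspace_valL_continuousP/C01_continuous.
have cn : {within `[0, 1], continuous (fun x => `|valL f x|)}.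
  by move=> x; apply: cvg_norm; exact: cf.
have [c _ cM] := EVT_max ler01 cn.
exists `|valL f c| => t.
have := cM (\val t) (set_valP t).
by have -> : valL f (\val t) = f t by exact: (congr1 (@^~ t) (valLK _ f)).
Qed.

Lemma le_unif_norm f t : `|f t| <= unif_norm f.
Proof.
have [M fM] := C01_bounded f.
by apply: ub_le_sup; [exists M => _ [s _ <-]|exists t].
Qed.

Lemma unif_norm_le f (M : R) : (forall t, `|f t| <= M) -> unif_norm f <= M.
Proof.
move=> fM; apply: ge_sup => [|_ [t _ <-]//].
by exists `|f unit_itv0|; exists unit_itv0.
Qed.

Let unif_normD f g : unif_norm (f + g) <= unif_norm f + unif_norm g.
Proof.
apply: unif_norm_le => t; rewrite (le_trans (ler_normD _ _))//.
by apply: lerD; exact: le_unif_norm.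
Qed.

Let unif_normZ (a : R) f : unif_norm (a *: f) = `|a| * unif_norm f.
Proof.
have le_scale b h : unif_norm (b *: h) <= `|b| * unif_norm h.
  apply: unif_norm_le => t; rewrite [leLHS]normrM.
  by rewrite ler_wpM2l// le_unif_norm.
apply/eqP; rewrite eq_le le_scale /=.
have [->|a0] := eqVneq a 0.
  rewrite normr0 mul0r; apply: le_trans (le_unif_norm _ unit_itv0).
  exact: normr_ge0.
rewrite -ler_pdivlMl ?normr_gt0// -normfV.
by rewrite -{1}(scale1r f) -(mulVf a0) -scalerA le_scale.
Qed.

Let unif_norm0_eq0 f : unif_norm f = 0 -> f = 0.
Proof.
move=> f0; apply/C01P => t; apply/eqP.
by rewrite -normr_le0 -f0 le_unif_norm.
Qed.

(* From here on, [`|f|] is the uniform norm of [f], and [open] refers to the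
   topology of this norm. *)
HB.instance Definition _ :=
  @Lmodule_isNormed.Build R (C01 R) unif_norm unif_normD unif_normZ unif_norm0_eq0.

Lemma C01_normE f : `|f| = sup (range (fun t => `|f t|)).
Proof. by []. Qed.

End C01_normed.

Definition C01_borel (R : realType) : set (set (C01 R)) := <<s open >>.

Definition enlargement (R : realType) (D : set (C01 R)) (e : R) : set (C01 R) :=
  [set x | exists2 y, D y & `|x - y| < e].

(* [X] and [Y] may live on different probability spaces. The defining set
   contains every [e >= 1], so the infimum is a genuine one. *)
Definition prokhorov (R : realType) (d d' : measure_display)
    (T : measurableType d) (T' : measurableType d')
    (P : probability T R) (Q : probability T' R)
    (X : T -> C01 R) (Y : T' -> C01 R) : R :=
  inf [set e : R | 0 < e /\
    (ereal_sup [set P (X @^-1` D) - Q (Y @^-1` enlargement D e)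
               | D in @C01_borel R] <= e%:E)%E].

Definition independent_RVs (R : realType) (d : measure_display)
    (T : measurableType d) (P : probability T R) (I : choiceType)
    (X : I -> T -> R) : Prop :=
  forall (J : {fset I}) (A : I -> set R), (forall i, measurable (A i)) ->
    P (\bigcap_(i in [set` J]) X i @^-1` A i) =
    (\prod_(i <- J) P (X i @^-1` A i))%E.

Definition identically_distributed (R : realType) (d : measure_display)
    (T : measurableType d) (P : probability T R) (I : Type)
    (X : I -> T -> R) : Prop :=
  forall (i j : I) (A : set R), measurable A ->
    P (X i @^-1` A) = P (X j @^-1` A).

(* [x i] stands for the (i+1)-st term of the sequence, so that the value at
   k/n involves its first [k] terms. *)
Definition is_broken_line (R : realType) (n : nat) (x : nat -> R)
    (f : C01 R) : Prop :=
  [/\ forall t : unit_itv R, set_val t = 0 -> f t = 0,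
      forall (k : nat) (t : unit_itv R), (1 <= k <= n)%N -> set_val t = k%:R / n%:R ->
        f t = (Num.sqrt n%:R)^-1 * \sum_(i < k) x i
    & forall k : nat, (1 <= k <= n)%N -> exists a b : R,
        forall t : unit_itv R, k.-1%:R / n%:R <= set_val t <= k%:R / n%:R ->
          f t = a * set_val t + b].

(* Measurability of the coordinates is measurability for [C01_borel], because
   C[0,1] is separable. The second argument of [normal_prob] is the standard
   deviation; [normal_prob m 0] is not a point mass, whence [set_val s < set_val t]. *)
Definition standard_wiener (R : realType) (d : measure_display)
    (T : measurableType d) (Q : probability T R) (B : T -> C01 R) : Prop :=
  [/\ forall t, measurable_fun setT (fun w => B w t),
      forall t : unit_itv R, set_val t = 0 -> {ae Q, forall w, B w t = 0},
      forall s t : unit_itv R, set_val s < set_val t -> forall A : set R, measurable A ->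
        Q ((fun w => B w t - B w s) @^-1` A) =
        normal_prob 0 (Num.sqrt (set_val t - set_val s)) A
    & forall t : nat -> unit_itv R, (forall i, set_val (t i) <= set_val (t i.+1)) ->
        independent_RVs Q (fun i w => B w (t i.+1) - B w (t i))].

(* Main.v *)
From HB Require Import structures.
From mathcomp Require Import all_boot all_order all_algebra ring lra.

(** The walk is compared, in the spirit of Skorokhod embedding, with a simple
    random walk of tiny step [h], the host.  A centred law is a mixture of
    centred two-point laws on [-u, v]; the host is run until it leaves an
    interval of radii [f u], [f v], where [f = 1 + (2/5) lag] corrects the lag
    between the time of the walk and the time of the host.  No coupling is
    constructed: an explicit potential bounds the conditional probability that
    the two processes separate or that the clocks drift apart, and a backward
    induction along the host bounds the probability of an event for the walk by
    the probability of its neighbourhood for the host.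

    With [b = xi / (sqrt n * theta)], the total error is
    [4.7 * n * E min(|b|^3, b^2)], which is below [4.7 * theta] exactly in the
    range needed for the theorem.  The same comparison, on a fine grid and with
    a much smaller [theta'], relates the Wiener process to the host; applied to
    a complementary event it yields the reverse inequality, and the two
    comparisons are glued along the common host. *)

Import Order.TTheory GRing.Theory Num.Theory.

Local Open Scope ring_scope.
Set Implicit Arguments. Unset Strict Implicit. Unset Printing Implicit Defensive.

(** * Potentials *)

(** At matched times the two processes are close, but the theorem compares them at equal clock
    times, across the lag [l]. A path moves by about [sqrt |l|] over that gap, so a fourth-moment
    bound charges about [l^2] for one check. A check at every node would be far too dear. Instead an
    anchor is kept, and checks (obligations) are opened only once the host has moved 7/10 away from
    it; by then the terms in [z^2] of the potential have saved their price.

    Failure never appears as an event. A potential of at least 1 makes the bound trivial; below 1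
    its summands give deterministic bounds: 23/25 on the lag, 16/25 on the separation, 49/20 on an
    obligation. The tolerance 9/2 is 16/25 + 2 * 7/10 + 49/20 with 1/100 to spare; rounding,
    recentring and the Wiener side lift it to 47/10.

    The constant of the error has another origin. A node costs 25/4 of the fourth moment and a large
    increment costs its probability; cutting at 33/50 keeps both together below 9/2 of E min(|b|^3,
    b^2). Most of the rest pays for the variance lost by the cut. *)

Definition cL (R : realFieldType) : R := 6 / 5.
(** Chosen so that [aZ * (49 / 100) = 5 / 36]: at [z ^+ 2 = 49 / 100] the terms of [Phi] in [z ^+ 2]
    are worth 5/36, 8/36 and 1/36 of [lh ^+ 2], [T ^+ 2] and [L2 * T], the prices met in
    [anchor_pay]. *)
Definition aZ (R : realFieldType) : R := 125 / 441.
(** The middle summand is [(5 + 8 / 5) * aZ * (49 / 100)], a bound for the growth of the [z ^+ 2]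
    terms of [Phi] per unit of [d ^+ 2]; [cL] stands for the growth of [lh ^+ 2], and 1/100 absorbs
    the discretisation by [h]. *)
Definition K0 (R : realFieldType) : R := 6 / 5 + 33 / 5 * (5 / 36) + 1 / 100.
Definition K1 (R : realFieldType) : R := 10 / 3 * (125 / 441).

(** For [T = A * B] and [L2 = (A + B) ^+ 2] this is [A * B * (A ^+ 2 + B ^+ 2) / 3], the variance of
    the time at which Brownian motion leaves an interval with exits at distances [A] and [B]. It
    compensates the future fluctuation of the lag within a piece. *)
Definition volV (R : realFieldType) (T L2 : R) : R := T * (L2 - 2 * T) / 3.

(** Here [z] is the displacement from the anchor, [T] the expected remaining duration of the piece,
    [lh] the lag predicted for its end and [la] the lag at its start. At [T = 0] only
    [(cL + aZ * z ^+ 2) * lh ^+ 2] survives, the value wanted at a node; the other terms prepay its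
    growth and the anchors that may still be moved. *)
Definition Phi (R : realFieldType) (z lh T L2 la : R) : R :=
  (cL R + aZ R * z ^+ 2 + 2 * aZ R * T) * lh ^+ 2
  + 8 / 5 * aZ R * (z ^+ 2 * T ^+ 2) + 8 / 15 * aZ R * T ^+ 3
  + aZ R / 5 * L2 * (z ^+ 2 * T + T ^+ 2 / 2)
  + (K0 R + K1 R * L2 + 4 * aZ R * `|la| + 4 * aZ R * (la - lh)) * volV T L2.

(** With [d = A - B], one host step moves [lh] by [h * d] up or down, so [lh] is a martingale while
    [volV] loses about [h ^+ 2 * d ^+ 2]. The coefficients of [Phi] are matched so that the
    contributions of [lh ^+ 2] and of the squared remaining time cancel; what remains carries a
    factor [d ^+ 2], which [K0], [K1] and the two lag terms in front of [volV] outweigh. *)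
Lemma Phi_drift (R : realFieldType) (h z lh T d L2 la : R) :
  0 < h -> h ^+ 2 <= 1 / 1000 -> z ^+ 2 <= 49 / 100 -> h ^+ 2 <= T ->
  T - (la - lh) <= 0 ->
  L2 = d ^+ 2 + 4 * T ->
  (Phi (z + h) (lh + h * d) (T - h ^+ 2 - h * d) L2 la
   + Phi (z - h) (lh - h * d) (T - h ^+ 2 + h * d) L2 la) / 2
  <= Phi z lh T L2 la.
Proof.
move=> h0 h1 z1 T1 th L2E; set k := h ^+ 2.
have k0 : 0 < k by rewrite exprn_gt0.
set d2 := d ^+ 2.
have d20 : 0 <= d2 by rewrite sqr_ge0.
have lpa : - la <= `|la| by rewrite lerNl; have := ler_norm (- la); rewrite normrN; lra.
have T0 : 0 <= T by apply: le_trans T1; exact: ltW.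
pose T' := T - k.
have T'0 : 0 <= T' by rewrite /T' /k; lra.
(* the exact increment, divided by [k], bounded term by term *)
have e1 : ((lh + h * d) ^+ 2 + (lh - h * d) ^+ 2) / 2 = lh ^+ 2 + k * d2.
  by rewrite /k /d2; field.
have e2 : ((z + h) ^+ 2 * (lh + h * d) ^+ 2 + (z - h) ^+ 2 * (lh - h * d) ^+ 2) / 2
   <= z ^+ 2 * lh ^+ 2 + k * (2 * lh ^+ 2 + 5 * (49/100) * d2 + k * d2).
  have -> : ((z + h) ^+ 2 * (lh + h * d) ^+ 2 + (z - h) ^+ 2 * (lh - h * d) ^+ 2) / 2
    = z ^+ 2 * lh ^+ 2 + k * (lh ^+ 2 + z ^+ 2 * d2 + 4 * (z * lh * d) + k * d2).
    by rewrite /k /d2; field.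
  rewrite lerD2l ler_pM2l //.
  have := sqr_ge0 (lh - 2 * (z * d)); rewrite sqrrB.
  have : z ^+ 2 * d2 <= 49/100 * d2 by rewrite ler_wpM2r.
  have -> : (2 * (z * d)) ^+ 2 = 4 * (z ^+ 2 * d2) by rewrite /d2; ring.
  have -> : lh * (2 * (z * d)) = 2 * (z * lh * d) by ring.
  lra.
have e3 : ((T - k - h * d) * (lh + h * d) ^+ 2 + (T - k + h * d) * (lh - h * d) ^+ 2) / 2
   = T * lh ^+ 2 + k * (- lh ^+ 2 + T' * d2 - 2 * (lh * d2)).
  by rewrite /T' /k /d2; field.
have e4 : ((z + h) ^+ 2 * (T - k - h * d) ^+ 2 + (z - h) ^+ 2 * (T - k + h * d) ^+ 2) / 2
   <= z ^+ 2 * T ^+ 2 + k * (49/100 * d2 + T' ^+ 2 + 2 * (T' * d2) + k * d2).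
  have -> : ((z + h) ^+ 2 * (T - k - h * d) ^+ 2 + (z - h) ^+ 2 * (T - k + h * d) ^+ 2) / 2
    = z ^+ 2 * T ^+ 2 + k * (z ^+ 2 * d2 - 2 * (z ^+ 2 * T') - k * z ^+ 2
        + T' ^+ 2 - 4 * (z * T' * d) + k * d2).
    by rewrite /T' /k /d2; field.
  rewrite lerD2l ler_pM2l //.
  have h2 : z ^+ 2 * d2 <= 49/100 * d2 by rewrite ler_wpM2r.
  have h3 : 0 <= T' * (z + d) ^+ 2 by rewrite mulr_ge0 ?sqr_ge0.
  have h4 : 0 <= k * z ^+ 2 by rewrite mulr_ge0 ?sqr_ge0 // ltW.
  have E : T' * (z + d) ^+ 2 = z ^+ 2 * T' + 2 * (z * T' * d) + T' * d2 by rewrite /d2; ring.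
  lra.
have e5 : ((T - k - h * d) ^+ 3 + (T - k + h * d) ^+ 3) / 2
   <= T ^+ 3 + k * (- 3 * T' ^+ 2 + 3 * (T' * d2)).
  have -> : ((T - k - h * d) ^+ 3 + (T - k + h * d) ^+ 3) / 2
    = T ^+ 3 + k * (- 3 * T' ^+ 2 + 3 * (T' * d2) - 3 * k * T' - k ^+ 2).
    by rewrite /T' /k /d2; field.
  rewrite lerD2l ler_pM2l //.
  have : 0 <= k * T' by rewrite mulr_ge0 // ltW.
  have := sqr_ge0 k; lra.
have e6 : (((z + h) ^+ 2 * (T - k - h * d) + (T - k - h * d) ^+ 2 / 2)
     + ((z - h) ^+ 2 * (T - k + h * d) + (T - k + h * d) ^+ 2 / 2)) / 2
   <= z ^+ 2 * T + T ^+ 2 / 2 + k * (3 / 2 * d2).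
  have -> : (((z + h) ^+ 2 * (T - k - h * d) + (T - k - h * d) ^+ 2 / 2)
     + ((z - h) ^+ 2 * (T - k + h * d) + (T - k + h * d) ^+ 2 / 2)) / 2
   = z ^+ 2 * T + T ^+ 2 / 2 + k * (- z ^+ 2 - 2 * (z * d) + d2 / 2 - k / 2).
    by rewrite /k /d2; field.
  rewrite lerD2l ler_pM2l //.
  have := sqr_ge0 (z + d); rewrite sqrrD -/d2; lra.
have e7 : (volV (T - k - h * d) L2 + volV (T - k + h * d) L2) / 2
   = volV T L2 - k * d2 - 2 / 3 * k ^+ 2.
  by rewrite /volV L2E /k /d2; field.
have e8 : ((la - (lh + h * d)) * volV (T - k - h * d) L2
     + (la - (lh - h * d)) * volV (T - k + h * d) L2) / 2
   = (la - lh) * (volV T L2 - k * d2 - 2 / 3 * k ^+ 2) + k * (d2 * (d2 + 4 * k) / 3).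
  by rewrite /volV L2E /k /d2; field.
have th0 : 0 <= la - lh by lra.
have e9 : 0 <= (la - lh) * k ^+ 2 by rewrite mulr_ge0 // sqr_ge0.
have L20 : 0 <= L2 by rewrite L2E -/d2; lra.
have A0 : 0 < aZ R by rewrite /aZ; lra.
pose X := K0 R + K1 R * L2 + 4 * aZ R * `|la|.
have X0 : 0 <= X.
  by rewrite /X /K0 /K1 /aZ; have := normr_ge0 la; lra.
have e10 : 0 <= X * k ^+ 2 by rewrite mulr_ge0 // sqr_ge0.
have -> : (Phi (z + h) (lh + h * d) (T - k - h * d) L2 la
   + Phi (z - h) (lh - h * d) (T - k + h * d) L2 la) / 2
  = cL R * (((lh + h * d) ^+ 2 + (lh - h * d) ^+ 2) / 2)
  + aZ R * (((z + h) ^+ 2 * (lh + h * d) ^+ 2 + (z - h) ^+ 2 * (lh - h * d) ^+ 2) / 2)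
  + 2 * aZ R * (((T - k - h * d) * (lh + h * d) ^+ 2 + (T - k + h * d) * (lh - h * d) ^+ 2) / 2)
  + 8 / 5 * aZ R * (((z + h) ^+ 2 * (T - k - h * d) ^+ 2 + (z - h) ^+ 2 * (T - k + h * d) ^+ 2) / 2)
  + 8 / 15 * aZ R * (((T - k - h * d) ^+ 3 + (T - k + h * d) ^+ 3) / 2)
  + aZ R / 5 * L2 * ((((z + h) ^+ 2 * (T - k - h * d) + (T - k - h * d) ^+ 2 / 2)
     + ((z - h) ^+ 2 * (T - k + h * d) + (T - k + h * d) ^+ 2 / 2)) / 2)
  + X * ((volV (T - k - h * d) L2 + volV (T - k + h * d) L2) / 2)
  + 4 * aZ R * (((la - (lh + h * d)) * volV (T - k - h * d) L2
     + (la - (lh - h * d)) * volV (T - k + h * d) L2) / 2).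
  by rewrite /Phi /X; field.
have -> : Phi z lh T L2 la = cL R * lh ^+ 2 + aZ R * (z ^+ 2 * lh ^+ 2) + 2 * aZ R * (T * lh ^+ 2)
  + 8 / 5 * aZ R * (z ^+ 2 * T ^+ 2) + 8 / 15 * aZ R * T ^+ 3
  + aZ R / 5 * L2 * (z ^+ 2 * T + T ^+ 2 / 2) + X * volV T L2
  + 4 * aZ R * ((la - lh) * volV T L2).
  by rewrite /Phi /X; ring.
rewrite e1 e3 e7 e8.
pose E2 := 2 * lh ^+ 2 + 5 * (49/100) * d2 + k * d2.
pose E4 := 49/100 * d2 + T' ^+ 2 + 2 * (T' * d2) + k * d2.
pose E5 := - 3 * T' ^+ 2 + 3 * (T' * d2).
rewrite -/E2 in e2; rewrite -/E4 in e4; rewrite -/E5 in e5.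
have f2 := ler_wpM2l (ltW A0) e2.
have A1 : 0 <= 8 / 5 * aZ R by lra.
have A2 : 0 <= 8 / 15 * aZ R by lra.
have A3 : 0 <= aZ R / 5 * L2 by rewrite mulr_ge0 //; lra.
have f4 := ler_wpM2l A1 e4.
have f5 := ler_wpM2l A2 e5.
have f6 := ler_wpM2l A3 e6.
(* net coefficient of [k] *)
pose net := cL R * d2 + aZ R * E2 + 2 * aZ R * (- lh ^+ 2 + T' * d2 - 2 * (lh * d2))
  + 8 / 5 * aZ R * E4 + 8 / 15 * aZ R * E5 + aZ R / 5 * L2 * (3 / 2 * d2)
  - X * d2 + 4 * aZ R * (- (la - lh) * d2 + d2 * (d2 + 4 * k) / 3).
have net0 : net <= 0.
  have -> : net = d2 * (cL R + aZ R * (5 * (49/100) + k) + 2 * aZ R * (T' - 2 * lh)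
     + 8 / 5 * aZ R * (49/100 + 2 * T' + k) + 8 / 15 * aZ R * (3 * T')
     + aZ R / 5 * L2 * (3 / 2) - X + 4 * aZ R * (- (la - lh) + (d2 + 4 * k) / 3)).
    by rewrite /net /E2 /E4 /E5; field.
  apply: mulr_ge0_le0 => //.
  rewrite /X /cL /K0 /K1 /aZ L2E -/d2.
  have kk : k <= 1/1000 by exact: h1.
  rewrite /T'; lra.
have nk : k * net <= 0 by apply: mulr_ge0_le0 => //; exact: ltW.
apply: le_trans (_ : _ <= cL R * lh ^+ 2 + aZ R * (z ^+ 2 * lh ^+ 2) + 2 * aZ R * (T * lh ^+ 2)
  + 8 / 5 * aZ R * (z ^+ 2 * T ^+ 2) + 8 / 15 * aZ R * T ^+ 3
  + aZ R / 5 * L2 * (z ^+ 2 * T + T ^+ 2 / 2) + X * volV T L2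
  + 4 * aZ R * ((la - lh) * volV T L2) + k * net) _; last by lra.
have Ek : k * net = cL R * (k * d2) + aZ R * (k * E2)
   + 2 * aZ R * (k * (- lh ^+ 2 + T' * d2 - 2 * (lh * d2)))
  + 8 / 5 * aZ R * (k * E4) + 8 / 15 * aZ R * (k * E5) + aZ R / 5 * L2 * (k * (3 / 2 * d2))
  - X * (k * d2) + 4 * aZ R * (- (la - lh) * (k * d2) + k * (d2 * (d2 + 4 * k) / 3)).
  by rewrite /net; field.
rewrite Ek; clear Ek nk net0 net e1 e3 e7 e8.
have e9' : 0 <= aZ R * ((la - lh) * k ^+ 2) by rewrite mulr_ge0 // ltW.
lra.
Qed.

(** * Fourth-moment potentials of the obligations *)

Definition GP (R : realFieldType) (z m : R) : R := (z ^+ 4 + 6 * z ^+ 2 * m + 3 * m ^+ 2) / 36.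
(** [GP] is the fourth moment of [z] plus a centred Gaussian of variance [m], divided by 36,
    slightly less than [(49 / 20) ^+ 4]; a value below 1 thus keeps [|z|] within 49/20. In [GN] the
    coefficients 6 and 3 are raised to 7 and 4 to absorb the third and fourth moments of increments
    that are not Gaussian. *)
Definition GN (R : realFieldType) (z M : R) : R := (z ^+ 4 + 7 * z ^+ 2 * M + 4 * M ^+ 2) / 36.
(** The average of [GN] over the two exits under the exit probabilities [B / (A + B)] and
    [A / (A + B)]. Within a piece it is affine in the host's position, hence an exact martingale. *)
Definition JN (R : realFieldType) (A B z M : R) : R :=
  (B * GN (z - A) M + A * GN (z + B) M) / (A + B).
(** The divisor is [36 * (49 / 100)], so that a coefficient [anchorCost m0 s] of [z ^+ 2] releases
    [(20 * m0 ^+ 2 + 600 * s ^+ 2) / 36] when the anchor is moved. *)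
Definition anchorCost (R : realFieldType) (m0 s : R) : R :=
  (20 * m0 ^+ 2 + 600 * s ^+ 2) / (441 / 25).

Lemma sqr4 (R : realFieldType) (z : R) : z ^+ 4 = z ^+ 2 * z ^+ 2.
Proof. by ring. Qed.

Lemma GP_drift (R : realFieldType) (z m h : R) :
  (GP (z + h) (m - h ^+ 2) + GP (z - h) (m - h ^+ 2)) / 2 <= GP z m.
Proof.
have -> : (GP (z + h) (m - h ^+ 2) + GP (z - h) (m - h ^+ 2)) / 2
  = GP z m - 2 / 36 * (h ^+ 2) ^+ 2 by rewrite /GP; field.
by have := sqr_ge0 (h ^+ 2); lra.
Qed.

Lemma GP_ge (R : realFieldType) (z m : R) : 0 <= m -> z ^+ 4 / 36 <= GP z m.
Proof.
move=> m0; rewrite /GP.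
have := mulr_ge0 (sqr_ge0 z) m0; have := sqr_ge0 m; lra.
Qed.

Lemma GN_ge (R : realFieldType) (z m : R) : 0 <= m -> z ^+ 4 / 36 <= GN z m.
Proof.
move=> m0; rewrite /GN.
have := mulr_ge0 (sqr_ge0 z) m0; have := sqr_ge0 m; lra.
Qed.

Lemma pow4_lt (R : realFieldType) (z x : R) : z ^+ 4 / 36 <= x -> x < 1 -> `|z| <= 49 / 20.
Proof.
move=> zx x1; rewrite -ler_sqr ?nnegrE ?normr_ge0 //; last by lra.
rewrite real_normK ?num_real //.
have : z ^+ 4 < 36 by lra.
rewrite sqr4 => z4; have := sqr_ge0 z; move: (z ^+ 2) z4 => y; nra.
Qed.

Lemma GP_ge0 (R : realFieldType) (z m : R) : 0 <= m -> 0 <= GP z m.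
Proof.
move=> m0; apply: le_trans (GP_ge z m0).
by rewrite sqr4 -expr2; have := sqr_ge0 (z ^+ 2); lra.
Qed.

Lemma GN_ge0 (R : realFieldType) (z m : R) : 0 <= m -> 0 <= GN z m.
Proof.
move=> m0; apply: le_trans (GN_ge z m0).
by rewrite sqr4 -expr2; have := sqr_ge0 (z ^+ 2); lra.
Qed.

Lemma JN_ge0 (R : realFieldType) (A B z M : R) : 0 <= A -> 0 <= B -> 0 <= M -> 0 <= JN A B z M.
Proof.
move=> A0 B0 M0; apply: divr_ge0; last exact: addr_ge0.
by apply: addr_ge0; apply: mulr_ge0 => //; exact: GN_ge0.
Qed.

Lemma JN_step (R : realFieldType) (A B z M h : R) : A + B != 0 ->
  (JN (A + h) (B - h) (z + h) M + JN (A - h) (B + h) (z - h) M) / 2 = JN A B z M.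
Proof.
move=> AB; rewrite /JN.
have -> : A + h + (B - h) = A + B by ring.
have -> : A - h + (B + h) = A + B by ring.
have -> : z + h - (A + h) = z - A by ring.
have -> : z + h + (B - h) = z + B by ring.
have -> : z - h - (A - h) = z - A by ring.
have -> : z - h + (B + h) = z + B by ring.
by field.
Qed.

(* a chord of the convex function [GN] lies above it *)
Lemma JN_ge (R : realFieldType) (A B z M : R) : 0 <= A -> 0 <= B -> 0 < A + B -> 0 <= M ->
  GN z M <= JN A B z M.
Proof.
move=> A0 B0 AB M0.
have -> : JN A B z M = GN z M + A * B * (6 * z ^+ 2 + 4 * z * (B - A)
   + (A ^+ 2 - A * B + B ^+ 2) + 7 * M) / 36.
  by rewrite /JN /GN; field; rewrite gt_eqF.
rewrite lerDl divr_ge0 // mulr_ge0 ?mulr_ge0 //.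
have : 0 <= A * B by rewrite mulr_ge0.
have := sqr_ge0 (3 * z + (B - A)); have := sqr_ge0 (A - B); rewrite !sqrrD !sqrrN; lra.
Qed.

Lemma JN0 (R : realFieldType) (A B M : R) : A + B != 0 ->
  JN A B 0 M = (A * B * ((A + B) ^+ 2 - 3 * (A * B)) + 7 * (A * B) * M + 4 * M ^+ 2) / 36.
Proof. by move=> AB; rewrite /JN /GN; field. Qed.

(** A new anchor sets [z] to 0 and releases every term proportional to [z ^+ 2], each worth at least
    49/100 of its coefficient. The sum covers the two obligations opened at that moment, term by
    term as in [cost]. *)
Lemma anchor_pay (R : realFieldType) (z lh A B m0 s la : R) :
  0 <= A -> 0 <= B -> 0 < A + B -> 0 <= s -> 4 * s <= m0 -> 49 / 100 <= z ^+ 2 ->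
  let T := A * B in let L2 := (A + B) ^+ 2 in
  Phi 0 lh T L2 la + anchorCost m0 s * (0 ^+ 2 + T)
  + (if 0 <= lh + T + 2 * s then GP 0 (lh + T + 2 * s) else 0)
  + (if lh + T <= s then JN A B 0 (m0 - (lh + T)) else 0)
  <= Phi z lh T L2 la + anchorCost m0 s * (z ^+ 2 + T).
Proof.
move=> A0 B0 AB s0 sm z2; cbv zeta; set T := A * B; set L2 := (A + B) ^+ 2.
have T0 : 0 <= T by rewrite mulr_ge0.
have L20 : 0 <= L2 by rewrite sqr_ge0.
have cost : (if 0 <= lh + T + 2 * s then GP 0 (lh + T + 2 * s) else 0)
  + (if lh + T <= s then JN A B 0 (m0 - (lh + T)) else 0)
  <= (5 * lh ^+ 2 + 8 * T ^+ 2 + L2 * T + 20 * m0 ^+ 2 + 600 * s ^+ 2) / 36.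
  rewrite JN0 ?gt_eqF // -/T -/L2 /GP.
  have q1 := sqr_ge0 m0; have q2 := sqr_ge0 s; have q3 := mulr_ge0 L20 T0.
  have q4 := sqr_ge0 lh; have q5 := sqr_ge0 T.
  (* [lh + T] is the present lag. Above [s] no node obligation is opened, below [- 2 * s] no host
     obligation; when both are opened, the host one costs only a multiple of [s ^+ 2]. *)
  have [c2|c2] := leP (lh + T) s.
    have p2 : T * (L2 - 3 * T) + 7 * T * (m0 - (lh + T)) + 4 * (m0 - (lh + T)) ^+ 2
       <= L2 * T + 5 * lh ^+ 2 + 20 * m0 ^+ 2.
      have w1 : 0 <= T * (m0 - (lh + T)) by rewrite mulr_ge0 //; lra.
      have := sqr_ge0 (lh + 4 * m0); nra.
    case: ifP => c1; last by lra.
    have p3 : (lh + T + 2 * s) ^+ 2 <= 9 * s ^+ 2 by nra.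
    lra.
  case: ifP => c1; last by lra.
  have := sqr_ge0 (19 * lh - 30 * T); have := sqr_ge0 (lh - 60 * s).
  have := sqr_ge0 (T - 24 * s); rewrite !sqrrB; nra.
have q1 : 49 / 100 * lh ^+ 2 <= z ^+ 2 * lh ^+ 2 by apply: ler_wpM2r => //; exact: sqr_ge0.
have q2 : 49 / 100 * T ^+ 2 <= z ^+ 2 * T ^+ 2 by apply: ler_wpM2r => //; exact: sqr_ge0.
have q3 : 49 / 100 * (L2 * T) <= z ^+ 2 * (L2 * T) by apply: ler_wpM2r => //; exact: mulr_ge0.
have a0 : 0 <= anchorCost m0 s.
  by rewrite /anchorCost; have := sqr_ge0 m0; have := sqr_ge0 s; lra.
have q4 : 49 / 100 * anchorCost m0 s <= z ^+ 2 * anchorCost m0 s by exact: ler_wpM2r.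
have -> : Phi z lh T L2 la = Phi 0 lh T L2 la + aZ R * (z ^+ 2 * lh ^+ 2)
  + 8 / 5 * aZ R * (z ^+ 2 * T ^+ 2) + aZ R / 5 * (z ^+ 2 * (L2 * T)).
  by rewrite /Phi; field.
have -> : anchorCost m0 s * (0 ^+ 2 + T) = anchorCost m0 s * T by ring.
have -> : anchorCost m0 s * (z ^+ 2 + T) = z ^+ 2 * anchorCost m0 s + anchorCost m0 s * T by ring.
have : 49 / 100 * anchorCost m0 s = (20 * m0 ^+ 2 + 600 * s ^+ 2) / 36.
  by rewrite /anchorCost; field.
rewrite /aZ; lra.
Qed.

Lemma Phi_ge (R : realFieldType) (z lh T L2 la : R) :
  0 <= T -> 2 * T <= L2 -> lh <= la -> (cL R + aZ R * z ^+ 2) * lh ^+ 2 <= Phi z lh T L2 la.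
Proof.
move=> T0 TL ll; have L20 : 0 <= L2 by lra.
have V0 : 0 <= volV T L2 by rewrite /volV divr_ge0 // mulr_ge0 //; lra.
rewrite /Phi.
have q1 := mulr_ge0 (sqr_ge0 z) (sqr_ge0 lh).
have q2 := mulr_ge0 T0 (sqr_ge0 lh).
have q3 := mulr_ge0 (sqr_ge0 z) (sqr_ge0 T).
have q4 : 0 <= T ^+ 3 by rewrite exprn_ge0.
have q5 := mulr_ge0 L20 (mulr_ge0 (sqr_ge0 z) T0).
have q6 := mulr_ge0 L20 (sqr_ge0 T).
have X0 : 0 <= K0 R + K1 R * L2 + 4 * aZ R * `|la| + 4 * aZ R * (la - lh).
  by rewrite /K0 /K1 /aZ; have := normr_ge0 la; lra.
have q7 := mulr_ge0 X0 V0.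
move: q7; set Y := (_ * volV _ _) => q7.
have -> : (cL R + aZ R * z ^+ 2 + 2 * aZ R * T) * lh ^+ 2 + 8 / 5 * aZ R * (z ^+ 2 * T ^+ 2) +
   8 / 15 * aZ R * T ^+ 3 + aZ R / 5 * L2 * (z ^+ 2 * T + T ^+ 2 / 2) + Y
  = cL R * lh ^+ 2 + aZ R * (z ^+ 2 * lh ^+ 2) + 2 * aZ R * (T * lh ^+ 2)
   + 8 / 5 * aZ R * (z ^+ 2 * T ^+ 2) + 8 / 15 * aZ R * T ^+ 3
   + aZ R / 5 * (L2 * (z ^+ 2 * T)) + aZ R / 10 * (L2 * T ^+ 2) + Y by field.
rewrite /aZ; lra.
Qed.

Ltac regenerate_hyps :=
  repeat match goal with
  | [ H : ?P |- _ ] => match type of P with Prop => generalize H; clear H end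
  end.
Tactic Notation "lra" "from" ne_hyp_list(hs) :=
  clear - hs; regenerate_hyps; repeat (let X := fresh "hyp" in intro X); lra.

(** The fourth moment of the centred two-point law on [- u] and [v], whose variance is [u * v]. *)
Definition quartic (R : realFieldType) (u v : R) : R := u * v * (u ^+ 2 - u * v + v ^+ 2).

Definition startCoef (R : realFieldType) (z2 g y : R) : R :=
  (cL R + aZ R * z2 + 8 / 5 * (aZ R * z2) + 4 / 5 * (aZ R * z2) + 2 / 3 * K0 R) * g ^+ 2
  + aZ R * (8 / 9 + 32 / 135 + 8 / 45 + 320 / 81 + 32 / 27) * g ^+ 3
  + aZ R * (20 / 3) * (y * g ^+ 2).

(** A piece for the two-point law on [- u] and [v] starts with exits at distances [f * u] and
    [f * v], hence [T = f ^+ 2 * (u * v)]. Of the mixture only the variance and the fourth moment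
    are under control, so all terms of higher order are absorbed into [quartic], through
    [(u * v) ^+ 2 <= quartic u v] and [(u + v) ^+ 2 * (u * v) <= 4 * quartic u v]. *)
Lemma Phi_start (R : realFieldType) (z u v f la : R) :
  0 < u -> u <= 2 / 3 -> 0 < v -> v <= 2 / 3 ->
  let g := f ^+ 2 in let t := u * v in
  Phi z (la - g * t) (g * t) (g * (u + v) ^+ 2) la
  <= (cL R + aZ R * z ^+ 2) * (la ^+ 2 - 2 * la * g * t) + 2 * aZ R * g * la ^+ 2 * t
     + startCoef (z ^+ 2) g `|la| * quartic u v.
Proof.
move=> u0 u1 v0 v1; cbv zeta; set g := f ^+ 2; set t := u * v.
have g0 : 0 <= g by rewrite sqr_ge0.
have t0 : 0 < t by rewrite mulr_gt0.
set Q := quartic u v.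
have tQ : t ^+ 2 <= Q.
  have := mulr_ge0 (ltW t0) (sqr_ge0 (u - v)); rewrite /Q /quartic -/t /t; lra.
have t49 : t <= 4 / 9 by rewrite /t; nra.
have Q0 : 0 <= Q by apply: le_trans tQ; exact: sqr_ge0.
have t3 : t ^+ 3 <= 4 / 9 * Q.
  have -> : t ^+ 3 = t * t ^+ 2 by ring.
  apply: ler_pM => //; [exact: ltW|exact: sqr_ge0].
set S2 := (u + v) ^+ 2.
have S20 : 0 <= S2 by rewrite sqr_ge0.
have S2t : S2 * t <= 4 * Q.
  have := mulr_ge0 (ltW t0) (sqr_ge0 (u - v)); rewrite /S2 /Q /quartic /t; lra.
have S2t2 : S2 * t ^+ 2 <= 16 / 9 * Q.
  have -> : S2 * t ^+ 2 = t * (S2 * t) by ring.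
  have := ler_pM (ltW t0) (mulr_ge0 S20 (ltW t0)) t49 S2t; lra.
set W := t * (S2 - 2 * t) / 3.
have W1 : W <= 2 / 3 * Q.
  have := mulr_ge0 (ltW t0) (sqr_ge0 (u - v)); rewrite /W /S2 /Q /quartic -/t /t; lra.
have W0 : 0 <= W.
  by rewrite /W divr_ge0 // mulr_ge0 ?(ltW t0) //; have := sqr_ge0 (u - v); rewrite /S2 /t; nra.
have S2W : S2 * W <= 32 / 27 * Q.
  have s1 : S2 <= 16 / 9 by rewrite /S2; nra.
  have := ler_pM S20 W0 s1 W1; lra.
have tW : t * W <= 8 / 27 * Q.
  have := ler_pM (ltW t0) W0 t49 W1; lra.
have g2 : 0 <= g ^+ 2 by rewrite sqr_ge0.
have g3 : 0 <= g ^+ 3 by rewrite exprn_ge0.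
have z2 : 0 <= z ^+ 2 by rewrite sqr_ge0.
have A0 : 0 < aZ R by rewrite /aZ; lra.
have C0 : 0 <= cL R + aZ R * z ^+ 2 + 8 / 5 * (aZ R * z ^+ 2).
  by rewrite /cL; have := mulr_ge0 (ltW A0) z2; lra.
have y0 := normr_ge0 la.
have X0 : 0 <= K0 R + 4 * aZ R * `|la|.
  by rewrite /K0; have := mulr_ge0 (ltW A0) y0; lra.
have cross : - (la * t ^+ 2) <= `|la| * Q.
  apply: le_trans (_ : `|la| * t ^+ 2 <= _); last by apply: ler_wpM2l.
  rewrite -mulNr ler_wpM2r ?sqr_ge0 //.
  by rewrite lerNl; have := ler_norm (- la); rewrite normrN; lra.
have -> : Phi z (la - g * t) (g * t) (g * S2) la
  = (cL R + aZ R * z ^+ 2) * (la ^+ 2 - 2 * la * g * t) + 2 * aZ R * g * la ^+ 2 * t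
  + g ^+ 2 * ((cL R + aZ R * z ^+ 2 + 8 / 5 * (aZ R * z ^+ 2)) * t ^+ 2
       + aZ R / 5 * z ^+ 2 * (S2 * t) + (K0 R + 4 * aZ R * `|la|) * W
       + 4 * aZ R * (- (la * t ^+ 2)))
  + g ^+ 3 * (2 * aZ R * t ^+ 3 + 8 / 15 * aZ R * t ^+ 3 + aZ R / 10 * (S2 * t ^+ 2)
       + K1 R * (S2 * W) + 4 * aZ R * (t * W)).
  by rewrite /Phi /volV /W /K1 /aZ; field.
have p2 : (cL R + aZ R * z ^+ 2 + 8 / 5 * (aZ R * z ^+ 2)) * t ^+ 2
       + aZ R / 5 * z ^+ 2 * (S2 * t) + (K0 R + 4 * aZ R * `|la|) * W
       + 4 * aZ R * (- (la * t ^+ 2))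
   <= (cL R + aZ R * z ^+ 2 + 8 / 5 * (aZ R * z ^+ 2) + 4 / 5 * (aZ R * z ^+ 2) + 2 / 3 * K0 R
       + 20 / 3 * aZ R * `|la|) * Q.
  have q1 := ler_wpM2l C0 tQ.
  have c1 : 0 <= aZ R / 5 * z ^+ 2 by rewrite mulr_ge0 //; lra.
  have q2 := ler_wpM2l c1 S2t.
  have q3 := ler_wpM2l X0 W1.
  have c4 : 0 <= 4 * aZ R by lra.
  have q4 := ler_wpM2l c4 cross.
  lra.
have p3 : 2 * aZ R * t ^+ 3 + 8 / 15 * aZ R * t ^+ 3 + aZ R / 10 * (S2 * t ^+ 2)
       + K1 R * (S2 * W) + 4 * aZ R * (t * W)
  <= aZ R * (8 / 9 + 32 / 135 + 8 / 45 + 320 / 81 + 32 / 27) * Q.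
  by rewrite /K1 /aZ; lra.
have r2 := ler_wpM2l g2 p2.
have r3 := ler_wpM2l g3 p3.
by rewrite /startCoef; lra.
Qed.

Lemma startCoef_le (R : realFieldType) (z2 y b s : R) :
  0 <= z2 -> z2 <= 49 / 100 -> y ^+ 2 <= 5 / 6 -> `|y| <= b -> b <= 23 / 25 -> b ^+ 2 <= 5/6 ->
  0 <= s -> s <= 1 / 10000 ->
  startCoef z2 ((1 + 2 / 5 * y) ^+ 2) `|y + s| <= 5 + 12 * `|y| + 18 * y ^+ 2.
Proof.
move=> z20 z21 y2 yb b1 b2 s0 s1.
set a := `|y|.
have a0 : 0 <= a by exact: normr_ge0.
have a2 : a ^+ 2 = y ^+ 2 by rewrite real_normK ?num_real.
have ya : y <= a by exact: ler_norm.
have ya' : - a <= y by rewrite lerNl; have := ler_norm (- y); rewrite normrN.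
have a1 : a <= 23 / 25 by exact: le_trans b1.
have la : `|y + s| <= a + s by apply: le_trans (ler_normD _ _) _; rewrite (ger0_norm s0).
set g := (1 + 2 / 5 * y) ^+ 2.
have y20 : 0 <= y ^+ 2 by rewrite sqr_ge0.
have y3 : y ^+ 3 <= 23 / 25 * y ^+ 2.
  have -> : y ^+ 3 = y * y ^+ 2 by ring.
  by apply: ler_wpM2r => //; lra from ya a1.
have y4 : y ^+ 4 <= 5 / 6 * y ^+ 2.
  have -> : y ^+ 4 = y ^+ 2 * y ^+ 2 by ring.
  by apply: ler_wpM2r.
have y40 : 0 <= y ^+ 4 by rewrite sqr4; exact: mulr_ge0.
have y5 : y ^+ 5 <= 23 / 25 * y ^+ 4.
  have -> : y ^+ 5 = y * y ^+ 4 by ring.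
  by apply: ler_wpM2r => //; lra from ya a1.
have y6 : y ^+ 6 <= 5 / 6 * y ^+ 4.
  have -> : y ^+ 6 = y ^+ 2 * y ^+ 4 by ring.
  by apply: ler_wpM2r.
have g2 : g ^+ 2 <= 1 + 8 / 5 * y + 61 / 50 * y ^+ 2.
  have -> : g ^+ 2 = 1 + 8 / 5 * y + 24 / 25 * y ^+ 2 + 32 / 125 * y ^+ 3 + 16 / 625 * y ^+ 4.
    by rewrite /g; field.
  lra from y3 y4 y20.
have g3 : g ^+ 3 <= 1 + 12 / 5 * y + 398 / 100 * y ^+ 2.
  have -> : g ^+ 3 = 1 + 12 / 5 * y + 12 / 5 * y ^+ 2 + 32 / 25 * y ^+ 3 + 48 / 125 * y ^+ 4
     + 192 / 3125 * y ^+ 5 + 64 / 15625 * y ^+ 6.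
    by rewrite /g; field.
  lra from y3 y4 y5 y6 y40 y20.
have g20 : 0 <= g ^+ 2 by rewrite sqr_ge0.
have g2a : g ^+ 2 <= 4 by lra from g2 ya a1 y2.
have lg : `|y + s| * g ^+ 2 <= a + 3 * y ^+ 2 + 1 / 1000.
  apply: le_trans (_ : (a + s) * g ^+ 2 <= _); first by apply: ler_wpM2r.
  rewrite mulrDl.
  have h1 : a * g ^+ 2 <= a * (1 + 8 / 5 * y + 61 / 50 * y ^+ 2) by apply: ler_wpM2l.
  have h2 : a * y <= y ^+ 2 by rewrite -a2 expr2 ler_wpM2l.
  have h3 : a * y ^+ 2 <= 23 / 25 * y ^+ 2 by apply: ler_wpM2r.
  have h4 : s * g ^+ 2 <= 1 / 10000 * 4 by apply: ler_pM.
  lra from h1 h2 h3 h4 y20.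
rewrite /startCoef /cL /aZ /K0.
have k1 : (6 / 5 + 125 / 441 * z2 + 8 / 5 * (125 / 441 * z2) + 4 / 5 * (125 / 441 * z2)
   + 2 / 3 * (6 / 5 + 33 / 5 * (5 / 36) + 1 / 100)) * g ^+ 2
  <= 3091 / 1000 * g ^+ 2 by apply: ler_wpM2r => //; lra from z20 z21.
lra from k1 g2 g3 lg ya y20 a0.
Qed.

(** The budget of one node, with lag [y] and variance deficit [del]. A piece lasts [g * s1] on
    average with [g] close to [1 + 4 / 5 * y], so [y ^+ 2] loses about [8 / 5 * s * y ^+ 2].
    Multiplied by [cL], this loss pays all terms of order [s * y ^+ 2]: future anchors, separation
    and the remainders of Young's inequality. What it cannot pay, fourth moment and deficit, is left
    on the right; terms in [s ^+ 2] are absorbed by [s ^+ 2 <= 11 / 10 * K4]. *)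
Lemma node_num (R : realFieldType) (z2 y s del K4 : R) :
  0 <= z2 -> z2 <= 49 / 100 -> cL R * y ^+ 2 <= 1 ->
  0 < s -> s <= 1 / 10000 -> 0 <= K4 -> K4 <= 13 / 2000 * s ->
  0 <= del -> del <= s / 100 -> s ^+ 2 <= 11 / 10 * K4 ->
  let g := (1 + 2 / 5 * y) ^+ 2 in let la := y + s in let s1 := s - del in
  (cL R + aZ R * z2) * (la ^+ 2 - 2 * la * g * s1) + 2 * aZ R * g * la ^+ 2 * s1
  + startCoef z2 g `|la| * K4 + anchorCost (5 * K4 / s + 4 * s) s * (g * s1)
  + 25 / 64 * y ^+ 2 * s1
  <= (cL R + aZ R * z2) * y ^+ 2 + 25 / 4 * K4 + 18 * (del ^+ 2 / s).
Proof.
move=> z20 z21 cy s0 ss K40 K4s d0 ds sK; cbv zeta.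
set g := (1 + 2 / 5 * y) ^+ 2; set la := y + s; set s1 := s - del.
have y2 : y ^+ 2 <= 5 / 6 by move: cy; rewrite /cL; clear; lra.
set a := `|y|.
have a0 : 0 <= a by exact: normr_ge0.
have a2 : a ^+ 2 = y ^+ 2 by rewrite real_normK ?num_real.
have ya : y <= a by exact: ler_norm.
have ya' : - a <= y by rewrite lerNl; have := ler_norm (- y); rewrite normrN.
have a1 : a <= 23 / 25.
  rewrite -ler_sqr ?nnegrE //; last by clear; lra.
  by rewrite a2; lra from y2.
have y20 : 0 <= y ^+ 2 by rewrite sqr_ge0.
have y3 : y ^+ 3 <= 23 / 25 * y ^+ 2.
  have -> : y ^+ 3 = y * y ^+ 2 by ring.
  by apply: ler_wpM2r => //; lra from ya a1.
have y3' : - (23 / 25 * y ^+ 2) <= y ^+ 3.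
  have -> : y ^+ 3 = y * y ^+ 2 by ring.
  by rewrite -mulNr ler_wpM2r //; lra from ya' a1.
have y4 : y ^+ 4 <= 5 / 6 * y ^+ 2.
  have -> : y ^+ 4 = y ^+ 2 * y ^+ 2 by ring.
  by apply: ler_wpM2r.
have g2 : g ^+ 2 <= 1 + 8 / 5 * y + 61 / 50 * y ^+ 2.
  have -> : g ^+ 2 = 1 + 8 / 5 * y + 24 / 25 * y ^+ 2 + 32 / 125 * y ^+ 3 + 16 / 625 * y ^+ 4.
    by rewrite /g; field.
  lra from y3 y4 y20.
have gE : g = 1 + 4 / 5 * y + 4 / 25 * y ^+ 2 by rewrite /g; field.
have g0 : 0 <= g by rewrite sqr_ge0.
have g1 : g <= 15 / 8 by rewrite gE; lra from ya a1 y2 y20.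
have s10 : 0 <= s1 by rewrite /s1; lra from ds s0 d0.
have s1s : s1 <= s by rewrite /s1; lra from d0.
(* contraction of the lag *)
pose ct := cL R + aZ R * z2.
have ct1 : 6 / 5 <= ct by rewrite /ct /cL /aZ; lra from z20.
have ct2 : ct <= 67 / 50 by rewrite /ct /cL /aZ; lra from z21.
have ct0 : 0 <= ct by lra from ct1.
have sy2 : 0 <= s * y ^+ 2 by rewrite mulr_ge0 // ltW.
have sy3 : s * y ^+ 3 <= 23 / 25 * (s * y ^+ 2).
  by have := ler_wpM2l (ltW s0) y3; clear; lra.
have sy3' : - (23 / 25 * (s * y ^+ 2)) <= s * y ^+ 3.
  by have := ler_wpM2l (ltW s0) y3'; clear; lra.
have sy4 : s * y ^+ 4 <= 5 / 6 * (s * y ^+ 2).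
  by have := ler_wpM2l (ltW s0) y4; clear; lra.
have s2y : s ^+ 2 * y ^+ 2 <= 1 / 10000 * (s * y ^+ 2).
  by rewrite expr2 -mulrA; apply: ler_wpM2r.
have s20 := sqr_ge0 s.
have ds0 : 0 <= del ^+ 2 / s by rewrite divr_ge0 ?sqr_ge0 // ltW.
have A1 : la ^+ 2 - 2 * la * g * s1 <= y ^+ 2 - 8 / 5 * (s * y ^+ 2) - 8 / 25 * (s * y ^+ 3)
   + 2 / 5 * (s ^+ 2 * y ^+ 2) + 2 * (g * del * (a + s)).
  have -> : la ^+ 2 - 2 * la * g * s1 = y ^+ 2 - 8 / 5 * (s * y ^+ 2) - 8 / 25 * (s * y ^+ 3)
     - s ^+ 2 * (1 + 8 / 5 * y + 8 / 25 * y ^+ 2) + 2 * (g * del * (y + s)).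
    by rewrite /la /s1 gE; field.
  have h1 : g * del * (y + s) <= g * del * (a + s).
    by apply: ler_wpM2l; [exact: mulr_ge0|lra from ya].
  have h2 : 0 <= s ^+ 2 * (1 + 8 / 5 * y + 18 / 25 * y ^+ 2).
    apply: mulr_ge0 => //; have := sqr_ge0 (1 + 4 / 5 * y); move: y20; clear; rewrite sqrrD; lra.
  lra from h1 h2.
have A2 : ct * (la ^+ 2 - 2 * la * g * s1) <= ct * y ^+ 2 - 6 / 5 * (8 / 5 * (s * y ^+ 2)
    + 8 / 25 * (s * y ^+ 3)) + 67 / 50 * (2 / 5 * (s ^+ 2 * y ^+ 2) + 2 * (g * del * (a + s))).
  apply: le_trans (ler_wpM2l ct0 A1) _.
  have h1 : 0 <= (ct - 6 / 5) * (8 / 5 * (s * y ^+ 2) + 8 / 25 * (s * y ^+ 3)).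
    by apply: mulr_ge0; [lra from ct1|lra from sy2 sy3'].
  have h2 : 0 <= (67 / 50 - ct) * (2 / 5 * (s ^+ 2 * y ^+ 2) + 2 * (g * del * (a + s))).
    apply: mulr_ge0; first by lra from ct2.
    have e1 : 0 <= s ^+ 2 * y ^+ 2 by exact: mulr_ge0.
    have e2 : 0 <= g * del * (a + s) by apply: mulr_ge0; [exact: mulr_ge0|lra from a0 s0].
    lra from e1 e2.
  lra from h1 h2.
(* Young's inequality separates the deficit of variance from the lag *)
have A3 : 67 / 25 * (g * del * a) <= 18 * (del ^+ 2 / s) + 1 / 10 * (s * (g ^+ 2 * y ^+ 2)).
  have e : 0 <= (18 * (del / s) - 67 / 50 * (g * a)) ^+ 2 * s / 18.
    by rewrite divr_ge0 // mulr_ge0 ?sqr_ge0 // ltW.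
  have E : (18 * (del / s) - 67 / 50 * (g * a)) ^+ 2 * s / 18
    = 18 * (del ^+ 2 / s) - 67 / 25 * (g * del * a) + (67 / 50) ^+ 2 / 18 * (s * (g ^+ 2 * a ^+ 2)).
    by field; rewrite gt_eqF.
  rewrite E a2 in e; clear E.
  have e2 : 0 <= s * (g ^+ 2 * y ^+ 2) by rewrite mulr_ge0 ?(ltW s0) // mulr_ge0 // sqr_ge0.
  lra from e e2.
have A3' : s * (g ^+ 2 * y ^+ 2) <= s * y ^+ 2 + 8 / 5 * (s * y ^+ 3) + 61 / 50 * (s * y ^+ 4).
  have -> : s * y ^+ 2 + 8 / 5 * (s * y ^+ 3) + 61 / 50 * (s * y ^+ 4)
     = (1 + 8 / 5 * y + 61 / 50 * y ^+ 2) * (s * y ^+ 2) by ring.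
  by rewrite mulrCA; apply: ler_wpM2r.
have A4 : g * del * s <= 2 / 100 * s ^+ 2.
  have : g * del * s <= 15 / 8 * (s / 100) * s.
    by apply: ler_wpM2r; [exact: ltW|apply: ler_pM].
  rewrite expr2; have := mulr_gt0 s0 s0; clear; lra.
(* the prepaid anchor costs *)
have la2 : la ^+ 2 <= 101 / 100 * y ^+ 2 + 101 * s ^+ 2.
  have := sqr_ge0 (y / 10 - 10 * s); rewrite /la; clear; lra.
have s3 : s * s ^+ 2 <= 1 / 10000 * s ^+ 2 by apply: ler_wpM2r.
have B1 : 2 * aZ R * g * la ^+ 2 * s1 <= 573 / 1000 * (s * y ^+ 2 + 4 / 5 * (s * y ^+ 3)
     + 4 / 25 * (s * y ^+ 4)) + 2 / 100 * s ^+ 2.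
  have h1 : g * la ^+ 2 * s1 <= g * (101 / 100 * y ^+ 2 + 101 * s ^+ 2) * s.
    apply: ler_pM => //; first by apply: mulr_ge0 => //; exact: sqr_ge0.
    exact: ler_wpM2l.
  have h2 : g * (s * s ^+ 2) <= 15 / 8 * (1 / 10000 * s ^+ 2).
    by apply: ler_pM => //; apply: mulr_ge0 => //; exact: ltW.
  have h3 : g * (s * y ^+ 2) = s * y ^+ 2 + 4 / 5 * (s * y ^+ 3) + 4 / 25 * (s * y ^+ 4).
    by rewrite gE; ring.
  have h4 : 0 <= g * (s * y ^+ 2) by exact: mulr_ge0.
  have -> : 2 * aZ R * g * la ^+ 2 * s1 = 2 * aZ R * (g * la ^+ 2 * s1) by ring.
  rewrite -h3 /aZ; lra from h1 h2 h4 s20.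
have Ka : startCoef z2 g `|la| * K4 <= (5 + 12 * a + 18 * y ^+ 2) * K4.
  apply: ler_wpM2r => //; apply: (@startCoef_le _ _ _ a) => //; [by rewrite a2|exact: ltW].
have Kb : 12 * (a * K4) <= 3 / 4 * K4 + 48 * (y ^+ 2 * K4).
  have := mulr_ge0 K40 (sqr_ge0 (1 - 8 * a)); rewrite -a2; clear; lra.
have Kc : y ^+ 2 * K4 <= 13 / 2000 * (s * y ^+ 2).
  have := ler_wpM2l y20 K4s; clear; lra.
have C1 : anchorCost (5 * K4 / s + 4 * s) s * (g * s1) <= 38 / 100 * K4.
  set m0 := 5 * K4 / s + 4 * s.
  have m1 : m0 ^+ 2 * s = 25 * (K4 / s) * K4 + 40 * (K4 * s) + 16 * (s * s ^+ 2).
    by rewrite /m0; field; rewrite gt_eqF.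
  have m2 : (K4 / s) * K4 <= 13 / 2000 * K4.
    by apply: ler_wpM2r => //; rewrite ler_pdivrMr.
  have m3 : K4 * s <= K4 * (1 / 10000) by apply: ler_wpM2l.
  have m4 : anchorCost m0 s * s <= 20 / 100 * K4.
    have -> : anchorCost m0 s * s = (20 * (m0 ^+ 2 * s) + 600 * (s * s ^+ 2)) / (441 / 25).
      by rewrite /anchorCost; field.
    by rewrite m1; lra from m2 m3 s3 sK K40.
  have aC : 0 <= anchorCost m0 s.
    by rewrite /anchorCost; have := sqr_ge0 m0; lra from s20.
  have h : g * s1 <= 15 / 8 * s by apply: ler_pM.
  have := ler_wpM2l aC h; lra from m4 K40.
have D1 : 25 / 64 * y ^+ 2 * s1 <= 25 / 64 * (s * y ^+ 2).
  have := ler_wpM2l y20 s1s; clear; lra.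
have sy4' : 0 <= s * y ^+ 4.
  have -> : s * y ^+ 4 = s * y ^+ 2 * y ^+ 2 by ring.
  exact: mulr_ge0.
rewrite -/ct.
apply: le_trans (lerD (lerD (lerD (lerD A2 B1) Ka) C1) D1) _.
clear A1 A2 B1 Ka C1 D1.
have -> : (5 + 12 * a + 18 * y ^+ 2) * K4 = 5 * K4 + 12 * (a * K4) + 18 * (y ^+ 2 * K4) by ring.
have -> : g * del * (a + s) = g * del * a + g * del * s by ring.
lra from A3 A3' A4 Kb Kc sK s2y sy2 sy3 sy3' sy4 sy4' K40 s20.
Qed.

(** * Finite laws as mixtures of centred two-point laws *)

Definition meanf (R : realFieldType) (law : seq (R * R)) (phi : R -> R) : R :=
  \sum_(a <- law) a.1 * phi a.2.

Lemma meanf_split (R : realFieldType) (law : seq (R * R)) (phi : R -> R) :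
  meanf law phi = \sum_(a <- law | a.2 < 0) a.1 * phi a.2
    + \sum_(a <- law | 0 < a.2) a.1 * phi a.2 + \sum_(a <- law | a.2 == 0) a.1 * phi a.2.
Proof.
rewrite /meanf (bigID (fun a => a.2 < 0)) /= -addrA; congr (_ + _).
rewrite (bigID (fun a => 0 < a.2)) /=; congr (_ + _); apply: eq_bigl => a.
  by case: (ltgtP a.2 0).
by case: (ltgtP a.2 0).
Qed.

(* a centred law is a mixture of centred two-point laws *)
Lemma meanf_two_point (R : realFieldType) (law : seq (R * R)) (phi : R -> R) :
  (forall a, a \in law -> 0 <= a.1) -> meanf law id = 0 ->
  (forall a c, a \in law -> c \in law -> a.2 < 0 -> 0 < c.2 ->
     c.2 * phi a.2 - a.2 * phi c.2 <= 0) ->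
  (forall a, a \in law -> a.2 = 0 -> phi 0 <= 0) ->
  meanf law phi <= 0.
Proof.
move=> p0 m0 Hpair Hzero.
have Z0 : \sum_(a <- law | a.2 == 0) a.1 * phi a.2 <= 0.
  rewrite big_seq_cond; apply: sumr_le0 => a /andP[al /eqP a0].
  by apply: mulr_ge0_le0; [exact: p0|rewrite a0; exact: (Hzero a)].
set mp := \sum_(a <- law | 0 < a.2) a.1 * a.2.
set mn := \sum_(a <- law | a.2 < 0) a.1 * - a.2.
have mm : mn = mp.
  move: m0; rewrite meanf_split /= [X in _ + X]big1 ?addr0; last first.
    by move=> a /eqP->; rewrite mulr0.
  rewrite -/mp => e; rewrite /mn.
  have -> : \sum_(a <- law | a.2 < 0) a.1 * - a.2 = - \sum_(a <- law | a.2 < 0) a.1 * a.2.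
    by rewrite -sumrN; apply: eq_bigr => a _; rewrite mulrN.
  by move/eqP: e; rewrite addr_eq0 => /eqP->; rewrite opprK.
set Sn := \sum_(a <- law | a.2 < 0) a.1 * phi a.2.
set Sp := \sum_(a <- law | 0 < a.2) a.1 * phi a.2.
(* Multiplying by [mp], the first absolute moment common to both sides, turns the two one-sided sums
   into a double sum over pairs. If [mp = 0], only the atom at 0 carries mass. *)
have key : mp * (Sn + Sp) <= 0.
  rewrite mulrDr -{2}mm.
  have -> : mp * Sn + mn * Sp = \sum_(a <- law | a.2 < 0) \sum_(c <- law | 0 < c.2)
     a.1 * c.1 * (c.2 * phi a.2 - a.2 * phi c.2).
    rewrite mulrC [X in X + _]big_distrlr [X in _ + X]big_distrlr /= -big_split /=.
    apply: eq_bigr => a _; rewrite -big_split /=; apply: eq_bigr => c _; ring.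
  rewrite big_seq_cond; apply: sumr_le0 => a /andP[al a0].
  rewrite big_seq_cond; apply: sumr_le0 => c /andP[cl c0].
  by apply: mulr_ge0_le0; [rewrite mulr_ge0 ?p0|exact: Hpair].
have mp0 : 0 <= mp.
  rewrite /mp big_seq_cond; apply: sumr_ge0 => c /andP[cl c0].
  by rewrite mulr_ge0 ?p0 // ltW.
rewrite meanf_split -/Sn -/Sp.
have [mpz|mpn] := eqVneq mp 0; last first.
  have : Sn + Sp <= 0 by rewrite -(pmulr_rle0 _ (_ : 0 < mp)) // lt_neqAle eq_sym mpn.
  by move=> w; lra from w Z0.
have Sp0 : Sp = 0.
  rewrite /Sp big_seq_cond big1 // => c /andP[cl c0].
  have /eqP := mpz; rewrite /mp big_seq_cond psumr_eq0; last first.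
    by move=> d /andP[dl d0]; rewrite mulr_ge0 ?p0 // ltW.
  move=> /allP /(_ c cl); rewrite cl c0 /= mulf_eq0 (gt_eqF c0) orbF => /eqP->.
  by rewrite mul0r.
have Sn0 : Sn = 0.
  rewrite /Sn big_seq_cond big1 // => c /andP[cl c0].
  have /eqP := mm; rewrite mpz /mn big_seq_cond psumr_eq0; last first.
    by move=> d /andP[dl d0]; rewrite mulr_ge0 ?p0 // oppr_ge0 ltW.
  move=> /allP /(_ c cl); rewrite cl c0 /= mulf_eq0 oppr_eq0 (lt_eqF c0) orbF => /eqP->.
  by rewrite mul0r.
by rewrite Sn0 Sp0 !add0r.
Qed.

Definition psum (R : realFieldType) (k : nat) (xs : seq R) : R := \sum_(x <- take k xs) x.

Lemma psum0 (R : realFieldType) (xs : seq R) : psum 0 xs = 0.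
Proof. by rewrite /psum take0 big_nil. Qed.

Lemma psum_rcons (R : realFieldType) (k : nat) (xs : seq R) (x : R) :
  (k <= size xs)%N -> psum k (rcons xs x) = psum k xs.
Proof. by move=> kx; rewrite /psum -cats1 takel_cat. Qed.

Lemma psum_rcons_last (R : realFieldType) (xs : seq R) (x : R) :
  psum (size xs).+1 (rcons xs x) = psum (size xs) xs + x.
Proof. by rewrite /psum -(size_rcons xs x) !take_size -cats1 big_cat big_seq1. Qed.

(* the fourth-moment potential of a pending node obligation *)
Lemma GN_node (R : realFieldType) (law : seq (R * R)) (z M f s : R) :
  (forall a, a \in law -> 0 <= a.1) -> meanf law (fun=> 1) = 1 -> meanf law id = 0 ->
  0 <= f -> f <= 1 -> 0 < s -> meanf law (fun b => b ^+ 2) <= s ->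
  5 * meanf law (fun b => b ^+ 4) / s + 4 * s <= M ->
  meanf law (fun b => GN (z + f * b) (M - s)) <= GN z M.
Proof.
move=> p0 p1 m1 f0 f1 s0; set s1 := meanf _ _; set K4 := meanf _ _ => s1s hM.
pose m3 := meanf law (fun b => b ^+ 3).
have -> : meanf law (fun b => GN (z + f * b) (M - s))
  = GN z (M - s) + f * (4 * z ^+ 3 + 14 * z * (M - s)) / 36 * meanf law id
   + f ^+ 2 * (6 * z ^+ 2 + 7 * (M - s)) / 36 * s1 + 4 * z * f ^+ 3 / 36 * m3
   + f ^+ 4 / 36 * K4.
  have -> : GN z (M - s) = GN z (M - s) * meanf law (fun=> 1) by rewrite p1 mulr1.
  rewrite /m3 /K4 /s1 /meanf !mulr_sumr -!big_split /=.
  by apply: eq_bigr => a _; rewrite /GN; field.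
have s10 : 0 <= s1.
  by rewrite /s1 /meanf big_seq; apply: sumr_ge0 => a al; rewrite mulr_ge0 ?p0 ?sqr_ge0.
have K40 : 0 <= K4.
  rewrite /K4 /meanf big_seq; apply: sumr_ge0 => a al; rewrite mulr_ge0 ?p0 //.
  by rewrite sqr4 mulr_ge0 ?sqr_ge0.
rewrite m1 mulr0 addr0.
(* The third moment has no sign. Young's inequality splits it between [z ^+ 2 * s1] and [K4]; the
   first share is what raises the coefficient 6 of the Gaussian formula to 7. *)
have yng : 4 * z * f ^+ 3 * m3 <= z ^+ 2 * s1 + 4 * K4.
  have w : 0 <= meanf law (fun b => (z * b - 2 * (f ^+ 3) * b ^+ 2) ^+ 2).
    rewrite /meanf big_seq; apply: sumr_ge0 => a al; rewrite mulr_ge0 ?p0 ?sqr_ge0 //.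
  have E : meanf law (fun b => (z * b - 2 * (f ^+ 3) * b ^+ 2) ^+ 2)
    = z ^+ 2 * s1 - 4 * z * f ^+ 3 * m3 + 4 * f ^+ 6 * K4.
    rewrite /m3 /K4 /s1 /meanf !mulr_sumr -sumrN -!big_split /=.
    by apply: eq_bigr => a _; ring.
  rewrite E in w.
  have : f ^+ 6 * K4 <= 1 * K4 by apply: ler_wpM2r => //; exact: exprn_ile1.
  lra from w.
have f2 : f ^+ 2 <= 1 by exact: exprn_ile1.
have f4 : f ^+ 4 * K4 <= 1 * K4 by apply: ler_wpM2r => //; exact: exprn_ile1.
have K4s : 0 <= K4 / s by rewrite divr_ge0 // ltW.
have Ms : 0 <= M - s by lra from hM K4s s0.
have f2s : f ^+ 2 * s1 <= 1 * s by apply: ler_pM => //; exact: sqr_ge0.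
have q1 : f ^+ 2 * s1 * (6 * z ^+ 2 + 7 * (M - s)) <= s * (6 * z ^+ 2 + 7 * (M - s)).
  apply: ler_wpM2r; last by lra from f2s.
  by have := sqr_ge0 z; lra from Ms.
have q2 : z ^+ 2 * s1 <= z ^+ 2 * s by apply: ler_wpM2l => //; exact: sqr_ge0.
have q3 : 5 * K4 + 4 * s ^+ 2 <= s * M.
  have := ler_wpM2l (ltW s0) hM.
  have -> : s * (5 * K4 / s + 4 * s) = 5 * K4 + 4 * s ^+ 2 by field; rewrite gt_eqF.
  by [].
have q4 := sqr_ge0 s.
have -> : GN z (M - s) = GN z M + (- 7 * (z ^+ 2 * s) + 4 * s ^+ 2 - 8 * (s * M)) / 36.
  by rewrite /GN; field.
lra from yng f4 q1 q2 q3 q4.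
Qed.

(** * The embedding bound *)

Section Embedding.
Variables (R : realFieldType) (law : seq (R * R)) (s h bmin : R) (n Mtot : nat).
(** [U] stands for the conditional probability of the walk's event given its increments so far,
    [Val] for that of the neighbouring event given the host. Both enter only through averaging
    relations, so the induction involves no probability space. *)
Variables (U Val : seq R -> R).

Definition mom4 : R := meanf law (fun b => b ^+ 4).
Definition mom2 : R := meanf law (fun b => b ^+ 2).
(** Spare time granted to every node obligation: until the obligation expires, it keeps the second
    argument of [GN] as large as [GN_node] requires. *)
Definition m0c : R := 5 * mom4 / s + 4 * s.
Definition r0c : R := anchorCost m0c s.
(** The overshoot of a piece, which ends when an exit is nearer than one host step: [20 * h] for lag
    and separation, [h / bmin] for replacing the average of [U] by its value at the near exit. *)
Definition kend : R := 20 * h + h / bmin.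
Definition kstep : R := kend + 25 / 4 * mom4 + 18 * ((s - mom2) ^+ 2 / s).
(** Bounds the number of nodes. A walk past [n] goes on only until the host's clock reaches
    [n%:R * s], and a lag below 1 leaves room for about [s^-1] further nodes. *)
Definition n1c : R := n%:R + 2 + s^-1.
Definition tm (xs : seq R) : R := (size xs)%:R * h ^+ 2.
Definition pos (xs : seq R) : R := psum (size xs) xs.

Hypothesis p0 : forall a, a \in law -> 0 <= a.1.
Hypothesis p1 : meanf law (fun=> 1) = 1.
Hypothesis m1 : meanf law id = 0.
Hypothesis lawb : forall a, a \in law -> `|a.2| <= 2 / 3.
Hypothesis bmin0 : 0 < bmin.
Hypothesis lawm : forall a, a \in law -> a.2 != 0 -> bmin <= `|a.2|.
Hypothesis s0 : 0 < s.
Hypothesis ss : s <= 1 / 10000.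
Hypothesis K4s : mom4 <= 13 / 2000 * s.
Hypothesis s1s : mom2 <= s.
Hypothesis dels : s - mom2 <= s / 100.
Hypothesis sK : s ^+ 2 <= 11 / 10 * mom4.
Hypothesis h0 : 0 < h.
Hypothesis hs : h <= 1 / 400.
Hypothesis hb : h <= bmin / 4.
Hypothesis U0 : forall ys, 0 <= U ys.
Hypothesis U1 : forall ys, U ys <= 1.
Hypothesis Urec : forall ys, U ys = meanf law (fun b => U (rcons ys b)).
Hypothesis Ufin : forall ys b, (n <= size ys)%N -> U (rcons ys b) = U ys.
Hypothesis V0 : forall xs, 0 <= Val xs.
Hypothesis Vrec : forall xs, (size xs < Mtot)%N ->
  Val xs = (Val (rcons xs h) + Val (rcons xs (- h))) / 2.
Variable nmax : nat.
Hypothesis nmax_ge : n1c <= nmax%:R.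
Hypothesis Mtot_large : n%:R * s + 2 <= Mtot%:R * h ^+ 2.

(** The tolerance is spent as 16/25 + 7/5 + 49/20 when a node is added and as 51/25 + 49/20 when a
    host step is added. Both sums are 449/100, which leaves 1/100 for multiples of [h]. *)
Definition tracks (xs ys : seq R) : Prop := forall k i, (k <= size ys)%N -> (i <= size xs)%N ->
  `|i%:R * h ^+ 2 - k%:R * s| <= 2 * s -> `|psum k ys - psum i xs| <= 9 / 2.

Hypothesis Vdone : forall xs ys, (size xs <= Mtot)%N -> (n <= size ys)%N ->
  n%:R * s <= tm xs -> tracks xs ys -> U ys <= Val xs.

Local Ltac tidy := repeat match goal with [ H : ?P |- _ ] => lazymatch type of P with Prop =>
  lazymatch H with p0 => fail | p1 => fail | m1 => fail | lawb => fail | bmin0 => fail | lawm => fail | s0 => fail | ss => fail | K4s => fail | s1s => fail | dels => fail | sK => fail | h0 => fail | hs => fail | hb => fail | U0 => fail | U1 => fail | Urec => fail | Ufin => fail | V0 => fail | Vrec => fail | Mtot_large => fail | nmax_ge => fail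
  | _ => clear H end end end.
Local Tactic Notation "lra" "with" constr(a0) := generalize a0; tidy; intros; lra.
Local Tactic Notation "lra" "with" constr(a0) constr(a1) := generalize a0, a1; tidy; intros; lra.
Local Tactic Notation "lra" "with" constr(a0) constr(a1) constr(a2) := generalize a0, a1, a2; tidy; intros; lra.
Local Tactic Notation "lra" "with" constr(a0) constr(a1) constr(a2) constr(a3) := generalize a0, a1, a2, a3; tidy; intros; lra.
Local Tactic Notation "lra" "with" constr(a0) constr(a1) constr(a2) constr(a3) constr(a4) := generalize a0, a1, a2, a3, a4; tidy; intros; lra.
Local Tactic Notation "lra" "with" constr(a0) constr(a1) constr(a2) constr(a3) constr(a4) constr(a5) := generalize a0, a1, a2, a3, a4, a5; tidy; intros; lra.
Local Tactic Notation "lra" "with" constr(a0) constr(a1) constr(a2) constr(a3) constr(a4) constr(a5) constr(a6) := generalize a0, a1, a2, a3, a4, a5, a6; tidy; intros; lra.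
Local Tactic Notation "lra" "with" constr(a0) constr(a1) constr(a2) constr(a3) constr(a4) constr(a5) constr(a6) constr(a7) := generalize a0, a1, a2, a3, a4, a5, a6, a7; tidy; intros; lra.
Local Tactic Notation "lra" "with" constr(a0) constr(a1) constr(a2) constr(a3) constr(a4) constr(a5) constr(a6) constr(a7) constr(a8) := generalize a0, a1, a2, a3, a4, a5, a6, a7, a8; tidy; intros; lra.

Lemma mom4_ge0 : 0 <= mom4.
Proof.
rewrite /mom4 /meanf big_seq; apply: sumr_ge0 => a al; rewrite mulr_ge0 ?p0 //.
by rewrite sqr4 mulr_ge0 ?sqr_ge0.
Qed.

Lemma kend_ge0 : 0 <= kend.
Proof. by have q := divr_ge0 (ltW h0) (ltW bmin0); rewrite /kend; lra with q h0. Qed.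

Lemma kstep_ge : kend <= kstep.
Proof.
have q4 := mom4_ge0; have q := divr_ge0 (sqr_ge0 (s - mom2)) (ltW s0).
by rewrite /kstep; lra with q4 q.
Qed.

Lemma kstep_ge0 : 0 <= kstep.
Proof. exact: le_trans kend_ge0 kstep_ge. Qed.

Lemma m0c_ge : 4 * s <= m0c.
Proof. by have q := divr_ge0 mom4_ge0 (ltW s0); rewrite /m0c; lra with q. Qed.

Lemma r0c_ge0 : 0 <= r0c.
Proof.
by rewrite /r0c /anchorCost; have q1 := sqr_ge0 m0c; have q2 := sqr_ge0 s; lra with q1 q2.
Qed.

Lemma tm_rcons xs x : tm (rcons xs x) = tm xs + h ^+ 2.
Proof. by rewrite /tm size_rcons -natr1 mulrDl mul1r. Qed.

Lemma pos_rcons xs x : pos (rcons xs x) = pos xs + x.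
Proof. by rewrite /pos size_rcons psum_rcons_last. Qed.

(* A host obligation [(r, d)] asks the host to stay close to [r] until time
   [d]; a node obligation [(r, a)] asks this of the nodes still to be matched
   with host times before [a]. *)
Definition hostSum (r t : R) (Pl : seq (R * R)) : R :=
  \sum_(it <- Pl) GP (r - it.1) (it.2 - t).
Definition nodeSum (r c : R) (Nl : seq (R * R)) : R :=
  \sum_(it <- Nl) GN (r - it.1) (it.2 - c + m0c).
Definition pieceSum (A B r c : R) (Nl : seq (R * R)) : R :=
  \sum_(it <- Nl) JN A B (r - it.1) (it.2 - c + m0c).

(* [xs] and [ys] are the increments of the host and of the walk so far, [ra] is
   a recent host position (the anchor) and [l] the lag of the walk's clock. *)
Definition PsiN (xs ys : seq R) (ra : R) (Pl Nl : seq (R * R)) : R :=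
  let r := pos xs in let z := r - ra in
  let l := (size ys)%:R * s - s - tm xs in
  (cL R + aZ R * z ^+ 2) * l ^+ 2 + r0c * z ^+ 2 + 625 / 256 * (pos ys - r) ^+ 2
  + hostSum r (tm xs) Pl + nodeSum r ((size ys)%:R * s - s) Nl
  + kstep * (n1c - (size ys)%:R).

(* Between two nodes the host is at distances [A] and [B] from its exits, [A * B]
   is the expected remaining time, and the separation of the two processes
   moves from [D] with slope [chi] in the host's position. *)
Definition PsiP (xs ys : seq R) (ra : R) (Pl Nl : seq (R * R)) (A B D chi la : R) : R :=
  let r := pos xs in let z := r - ra in
  let lam := (size ys)%:R * s - tm xs in
  Phi z (lam - A * B) (A * B) ((A + B) ^+ 2) la + r0c * (z ^+ 2 + A * B)
  + 625 / 256 * (D ^+ 2 + chi ^+ 2 * (A * B))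
  + hostSum r (tm xs) Pl + pieceSum A B r ((size ys)%:R * s) Nl
  + kend + kstep * (n1c - (size ys)%:R - 1).

(** [A * B] loses [h ^+ 2] on average, so [z ^+ 2 + A * B] and [D ^+ 2 + chi ^+ 2 * (A * B)] are
    martingales. The obligations are governed by [GP_drift] and [JN_step], the remaining term by
    [Phi_drift]. *)
Lemma PsiP_step xs ys ra Pl Nl A B D chi la :
  (pos xs - ra) ^+ 2 <= 49 / 100 -> h <= A -> h <= B ->
  (size ys)%:R * s - tm xs <= la ->
  (PsiP (rcons xs h) ys ra Pl Nl (A + h) (B - h) (D + chi * h) chi la
   + PsiP (rcons xs (- h)) ys ra Pl Nl (A - h) (B + h) (D - chi * h) chi la) / 2
  <= PsiP xs ys ra Pl Nl A B D chi la.
Proof.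
move=> z2 hA hB lala; rewrite /PsiP !tm_rcons !pos_rcons.
set r := pos xs; set t := tm xs; set c := _%:R * s; set T := A * B.
have A0 : 0 < A by exact: lt_le_trans hA.
have B0 : 0 < B by exact: lt_le_trans hB.
have hT : h ^+ 2 <= T by rewrite expr2 /T; apply: ler_pM => //; exact: ltW.
have hh : h ^+ 2 <= 1 / 1000.
  have := ler_pM (ltW h0) (ltW h0) hs hs; rewrite -expr2; lra.
have L2E : (A + B) ^+ 2 = (A - B) ^+ 2 + 4 * T by rewrite /T; ring.
rewrite -/c -/t in lala.
have thc : T - (la - (c - t - T)) <= 0 by lra with lala.
have key := Phi_drift h0 hh z2 hT thc L2E.
have -> : A + h + (B - h) = A + B by ring.
have -> : A - h + (B + h) = A + B by ring.
have e1 : (A + h) * (B - h) = T - h ^+ 2 - h * (A - B) by rewrite /T; ring.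
have e2 : (A - h) * (B + h) = T - h ^+ 2 + h * (A - B) by rewrite /T; ring.
rewrite !e1 !e2.
have -> : c - (t + h ^+ 2) - (T - h ^+ 2 - h * (A - B)) = (c - t - T) + h * (A - B) by ring.
have -> : c - (t + h ^+ 2) - (T - h ^+ 2 + h * (A - B)) = (c - t - T) - h * (A - B) by ring.
have -> : r + h - ra = (r - ra) + h by ring.
have -> : r - h - ra = (r - ra) - h by ring.
have kP : (hostSum (r + h) (t + h ^+ 2) Pl + hostSum (r - h) (t + h ^+ 2) Pl) / 2
   <= hostSum r t Pl.
  rewrite /hostSum -big_split /= mulr_suml; apply: ler_sum => it _.
  have := GP_drift (r - it.1) (it.2 - t) h.
  have -> : r - it.1 + h = r + h - it.1 by ring.
  have -> : r - it.1 - h = r - h - it.1 by ring.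
  by have -> : it.2 - t - h ^+ 2 = it.2 - (t + h ^+ 2) by ring.
have kN : (pieceSum (A + h) (B - h) (r + h) c Nl + pieceSum (A - h) (B + h) (r - h) c Nl) / 2
   = pieceSum A B r c Nl.
  rewrite /pieceSum -big_split /= mulr_suml; apply: eq_bigr => it _.
  rewrite -(@JN_step _ A B (r - it.1) _ h); last by rewrite gt_eqF // addr_gt0.
  have -> : r - it.1 + h = r + h - it.1 by ring.
  by have -> : r - it.1 - h = r - h - it.1 by ring.
move: key kP; rewrite -kN -/T; clear.
move: (hostSum _ _ _) (hostSum _ _ _) (hostSum _ _ _) => P1 P2 P3.
move: (pieceSum _ _ _ _ _) (pieceSum _ _ _ _ _) => N1 N2.
move: (Phi _ _ _ _ _) (Phi _ _ _ _ _) (Phi _ _ _ _ _) => F1 F2 F3.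
move: kend (kstep * _) r0c (r - ra) (A - B) => k1 k2 r0 z e key kP.
lra.
Qed.

Lemma hostSum_ge0 r t Pl : (forall it, it \in Pl -> t <= it.2) -> 0 <= hostSum r t Pl.
Proof.
move=> H; rewrite /hostSum big_seq; apply: sumr_ge0 => it /H itt.
by apply: GP_ge0; rewrite subr_ge0.
Qed.

Lemma hostSum_item r t Pl it : (forall it, it \in Pl -> t <= it.2) -> it \in Pl ->
  (r - it.1) ^+ 4 / 36 <= hostSum r t Pl.
Proof.
move=> H il; rewrite /hostSum (big_rem it) //=.
apply: le_trans (GP_ge (r - it.1) (_ : 0 <= it.2 - t)) _; first by rewrite subr_ge0 H.
rewrite lerDl big_seq; apply: sumr_ge0 => j /mem_rem /H jt.
by apply: GP_ge0; rewrite subr_ge0.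
Qed.

Lemma hostSum_filter r t t' Pl : (forall it, it \in Pl -> t <= it.2) ->
  hostSum r t [seq it <- Pl | t' <= it.2] <= hostSum r t Pl.
Proof.
move=> H; rewrite /hostSum big_filter [leRHS](bigID (fun it : R * R => t' <= it.2)) /=.
rewrite lerDl big_seq_cond; apply: sumr_ge0 => it /andP[/H itt _].
by apply: GP_ge0; rewrite subr_ge0.
Qed.

Lemma pieceSum_ge0 A B r c Nl : 0 <= A -> 0 <= B -> (forall it, it \in Nl -> c - s <= it.2) ->
  0 <= pieceSum A B r c Nl.
Proof.
move=> A0 B0 H; rewrite /pieceSum big_seq; apply: sumr_ge0 => it /H itt.
by apply: JN_ge0 => //; have := m0c_ge; lra with itt s0.
Qed.

Lemma nodeSum_ge0 r c Nl : (forall it, it \in Nl -> c <= it.2) -> 0 <= nodeSum r c Nl.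
Proof.
move=> H; rewrite /nodeSum big_seq; apply: sumr_ge0 => it /H itt.
by apply: GN_ge0; have := m0c_ge; lra with itt s0.
Qed.

(* at the end of a piece the chord dominates the potential at the new node *)
Lemma nodeSum_le_piece A B r c Nl : 0 <= A -> 0 <= B -> 0 < A + B ->
  (forall it, it \in Nl -> c - s <= it.2) ->
  nodeSum r c [seq it <- Nl | c <= it.2] <= pieceSum A B r c Nl.
Proof.
move=> A0 B0 AB H; have mc := m0c_ge.
rewrite /nodeSum /pieceSum big_filter [leRHS](bigID (fun it : R * R => c <= it.2)) /=.
rewrite -[leLHS]addr0; apply: lerD.
  rewrite big_seq_cond [leRHS]big_seq_cond; apply: ler_sum => it /andP[/H itt _].
  by apply: JN_ge => //; lra with itt s0 mc.
rewrite big_seq_cond; apply: sumr_ge0 => it /andP[/H itt _].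
by apply: JN_ge0 => //; lra with itt s0 mc.
Qed.

Lemma pieceSum_item A B r c Nl it : 0 <= A -> 0 <= B -> 0 < A + B ->
  (forall it, it \in Nl -> c - s <= it.2) -> it \in Nl ->
  (r - it.1) ^+ 4 / 36 <= pieceSum A B r c Nl.
Proof.
move=> A0 B0 AB H il; have mc := m0c_ge; rewrite /pieceSum (big_rem it) //=.
have im : 0 <= it.2 - c + m0c by have := H _ il; lra with s0 mc.
apply: le_trans (GN_ge (r - it.1) im) _.
apply: le_trans (JN_ge (r - it.1) A0 B0 AB im) _.
rewrite lerDl big_seq; apply: sumr_ge0 => j /mem_rem /H jt.
by apply: JN_ge0 => //; lra with jt s0 mc.
Qed.

(** * Invariants and backward induction along the host *)

Definition invH (xs ys : seq R) (ra : R) (Pl : seq (R * R)) : Prop :=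
  forall k, (k <= size ys)%N -> tm xs <= k%:R * s + 2 * s ->
    `|psum k ys - ra| <= 67 / 50 + 2 * h
    \/ exists2 it, it \in Pl & k%:R * s + 2 * s <= it.2 /\ `|psum k ys - it.1| <= 51 / 25 + 4 * h.

Definition invN (xs ys : seq R) (ra : R) (Nl : seq (R * R)) : Prop :=
  forall i, (i <= size xs)%N -> (size ys)%:R * s - s <= i%:R * h ^+ 2 ->
    `|psum i xs - ra| <= 7 / 10 + h
    \/ exists2 it, it \in Nl & i%:R * h ^+ 2 <= it.2 /\ `|psum i xs - it.1| <= 7 / 5 + 2 * h.

(** Whatever a later comparison can reach lies near the anchor or under an obligation that lasts
    long enough. Nodes lie within 16/25 + 7/10 = 67/50 of the anchor and host positions within 7/10,
    up to [h]; moving the anchor adds 7/10 to both, whence 51/25 and 7/5. The next node looks back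
    to host times from [(size ys)%:R * s - s] on, hence the shift by [- s] in the clock of the
    nodes. *)
Definition Inv (xs ys : seq R) (ra : R) (Pl Nl : seq (R * R)) : Prop :=
  [/\ invH xs ys ra Pl, invN xs ys ra Nl,
      (forall it, it \in Pl -> tm xs <= it.2) &
      (forall it, it \in Nl -> (size ys)%:R * s - s <= it.2 /\ it.2 <= tm xs)].

Definition NodeGood (xs : seq R) : Prop := forall ys ra Pl Nl,
  tracks xs ys -> Inv xs ys ra Pl Nl -> `|pos xs - ra| < 7 / 10 -> (size ys)%:R <= n1c ->
  U ys <= Val xs + PsiN xs ys ra Pl Nl.

(** The weights are the host's exit probabilities; at the start of a piece, with exits at [f * u]
    and [f * v], they are those of the two-point law. The walk is interpolated by
    [pos ys + A / f - u], which is [pos ys - u] at [A = 0] and [pos ys + v] at [B = 0]. *)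
Definition PieceGood (xs : seq R) : Prop := forall ys ra Pl Nl u v f A B la,
  tracks xs ys -> Inv xs ys ra Pl Nl -> `|pos xs - ra| < 7 / 10 -> (size ys)%:R + 1 <= n1c ->
  bmin <= u -> bmin <= v -> u + v <= 4 / 3 -> 3 / 5 <= f -> f <= 7 / 5 ->
  A + B = f * (u + v) -> h <= A -> h <= B -> (size ys)%:R * s - tm xs <= la ->
  (B * U (rcons ys (- u)) + A * U (rcons ys v)) / (A + B)
  <= Val xs + PsiP xs ys ra Pl Nl A B (pos ys + A / f - u - pos xs) (f^-1 - 1) la.

Lemma PsiP_bounds xs ys ra Pl Nl A B D chi la : 0 <= A -> 0 <= B -> 0 < A + B ->
  (size ys)%:R * s - tm xs <= la ->
  (forall it, it \in Pl -> tm xs <= it.2) ->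
  (forall it, it \in Nl -> (size ys)%:R * s - s <= it.2) -> (size ys)%:R + 1 <= n1c ->
  [/\ (cL R + aZ R * (pos xs - ra) ^+ 2) * ((size ys)%:R * s - tm xs - A * B) ^+ 2
      + 625 / 256 * D ^+ 2 + hostSum (pos xs) (tm xs) Pl
      + pieceSum A B (pos xs) ((size ys)%:R * s) Nl <= PsiP xs ys ra Pl Nl A B D chi la,
    0 <= hostSum (pos xs) (tm xs) Pl,
    0 <= pieceSum A B (pos xs) ((size ys)%:R * s) Nl &
    cL R * ((size ys)%:R * s - tm xs - A * B) ^+ 2
     <= (cL R + aZ R * (pos xs - ra) ^+ 2) * ((size ys)%:R * s - tm xs - A * B) ^+ 2].
Proof.
move=> A0 B0 AB lala HP HN K1; rewrite /PsiP.
set c := _%:R * s in lala HN *; set t := tm xs in lala HP *; set r := pos xs.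
have q1 := hostSum_ge0 r HP; have q2 := pieceSum_ge0 r A0 B0 HN.
split => //; last first.
  apply: ler_wpM2r; first exact: sqr_ge0.
  by rewrite lerDl mulr_ge0 ?sqr_ge0 // /aZ; lra.
have T0 : 0 <= A * B by rewrite mulr_ge0.
have TL : 2 * (A * B) <= (A + B) ^+ 2 by have := sqr_ge0 (A - B); lra with T0.
have ll : c - t - A * B <= la by lra with lala T0.
have key := Phi_ge (r - ra) T0 TL ll.
have q3 : 0 <= r0c * ((r - ra) ^+ 2 + A * B).
  by rewrite mulr_ge0 ?r0c_ge0 // addr_ge0 ?sqr_ge0.
have q4 : 0 <= chi ^+ 2 * (A * B) by rewrite mulr_ge0 ?sqr_ge0.
have q5 : 0 <= kstep * (n1c - (size ys)%:R - 1).
  by rewrite mulr_ge0 ?kstep_ge0 //; lra with K1.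
have q6 := kend_ge0; clear TL ll T0 lala AB; move: key q3 q4 q5 q6.
move: (Phi _ _ _ _ _) (_ * _ ^+ 2) (r0c * _) (chi ^+ 2 * _) (kstep * _) kend (hostSum _ _ _)
 (pieceSum _ _ _ _ _) (D ^+ 2) => x1 x2 x3 x4 x5 x6 x7 x8 x9.
lra.
Qed.

(** The host stands still, so the new node lies within 16/25 of it up to [h]; older host positions
    are reached from there through the anchor or, by the bound 49/20, through a node obligation.
    Obligations whose time has run out are dropped. *)
Lemma advance xs ys ra Pl Nl b : tracks xs ys -> Inv xs ys ra Pl Nl -> `|pos xs - ra| < 7 / 10 ->
  `|pos ys + b - pos xs| <= 16 / 25 + 5 / 3 * h ->
  (forall it, it \in Nl -> `|pos xs - it.1| <= 49 / 20) ->
  tracks xs (rcons ys b) /\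
  Inv xs (rcons ys b) ra Pl [seq it <- Nl | (size ys)%:R * s <= it.2].
Proof.
move=> cl [iH iN iP iQ] z1 D1 NN; rewrite /Inv /invH /invN /tracks !size_rcons.
have cE : (size ys).+1%:R * s - s = (size ys)%:R * s by rewrite -natr1; ring.
have pE : psum (size ys).+1 (rcons ys b) = pos ys + b by rewrite psum_rcons_last.
have tri (x y w : R) : `|x - y| <= `|x - w| + `|w - y|.
  by have := ler_normD (x - w) (w - y); rewrite subrKA.
split; last split.
- move=> k i; rewrite leq_eqVlt => /predU1P[->|kK] ix win; last first.
    by rewrite psum_rcons //; apply: cl.
  rewrite pE.
  have w1 : (size ys)%:R * s - s <= i%:R * h ^+ 2.
    move: win; rewrite ler_norml => /andP[w _]; move: w; rewrite -natr1; lra with s0.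
  have d1 := tri (pos ys + b) (psum i xs) (pos xs).
  have [l1|[it il [_ l1]]] := iN i ix w1.
    have d2 := tri (pos xs) (psum i xs) ra; rewrite (distrC ra) in d2.
    by lra with d1 d2 l1 z1 D1 hs.
  have d2 := tri (pos xs) (psum i xs) it.1; rewrite (distrC it.1) in d2.
  by have l2 := NN _ il; lra with d1 d2 l1 l2 D1 hs.
- move=> k; rewrite leq_eqVlt => /predU1P[->|kK] tk; last by rewrite psum_rcons //; apply: iH.
  left; rewrite pE; have d1 := tri (pos ys + b) ra (pos xs).
  by lra with d1 D1 z1 h0.
- move=> i ix; rewrite cE => w; have w1 : (size ys)%:R * s - s <= i%:R * h ^+ 2 by lra with w s0.
  have [l1|[it il [l0 l1]]] := iN i ix w1; [by left|right; exists it => //].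
  by rewrite mem_filter il andbT (le_trans w).
- exact: iP.
- by move=> it; rewrite mem_filter cE => /andP[-> il]; have [_] := iQ _ il.
Qed.

Lemma sqr_close (x y e c : R) : `|x| <= c -> `|y - x| <= e -> y ^+ 2 <= x ^+ 2 + 2 * c * e + e ^+ 2.
Proof.
move=> xc ye; have -> : y ^+ 2 = x ^+ 2 + 2 * (x * (y - x)) + (y - x) ^+ 2 by ring.
have : (y - x) ^+ 2 <= e ^+ 2.
  by rewrite -(real_normK (num_real (y - x))) ler_sqr ?nnegrE ?(le_trans _ ye).
have : x * (y - x) <= c * e.
  by apply: le_trans (ler_norm _) _; rewrite normrM ler_pM.
by lra.
Qed.

(** An exit within one host step leaves [A * B <= 2 * h] instead of 0. The resulting discrepancy in
    lag and separation stays below the part [20 * h] of [kend]; its other part [h / bmin] is handed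
    on to the conclusion. *)
Lemma finish xs ys ra Pl Nl A B D chi la b : NodeGood xs ->
  tracks xs ys -> Inv xs ys ra Pl Nl -> `|pos xs - ra| < 7 / 10 -> (size ys)%:R + 1 <= n1c ->
  0 <= A -> 0 <= B -> 0 < A + B -> A * B <= 2 * h -> (size ys)%:R * s - tm xs <= la ->
  `|pos ys + b - pos xs - D| <= 5 / 3 * h -> PsiP xs ys ra Pl Nl A B D chi la < 1 ->
  U (rcons ys b) + h / bmin <= Val xs + PsiP xs ys ra Pl Nl A B D chi la.
Proof.
move=> NG cl iv z1 K1 A0 B0 AB T2 lala Db P1.
have [iH iN iP iQ] := iv.
have iQ1 it : it \in Nl -> (size ys)%:R * s - s <= it.2 by move=> /iQ[].
have [bd hS0 pS0 cz] := @PsiP_bounds xs ys ra Pl Nl A B D chi la A0 B0 AB lala iP iQ1 K1.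
have D2 := sqr_ge0 D; have lh2 := sqr_ge0 ((size ys)%:R * s - tm xs - A * B).
have T0 : 0 <= A * B by rewrite mulr_ge0.
have NN it : it \in Nl -> `|pos xs - it.1| <= 49 / 20.
  move=> il; apply: (@pow4_lt _ _ (pieceSum A B (pos xs) ((size ys)%:R * s) Nl)).
    exact: pieceSum_item.
  apply: le_lt_trans P1; move: bd cz; rewrite /cL; lra with D2 lh2 hS0.
(* [625 / 256 = (25 / 16) ^+ 2], so a potential below 1 keeps the separation within 16/25. *)
have D1 : `|D| <= 16 / 25.
  rewrite -ler_sqr ?nnegrE ?normr_ge0 //; last by lra.
  rewrite real_normK ?num_real //.
  move: bd cz; rewrite /cL; lra with D2 lh2 hS0 pS0 P1.
have Sr : `|pos ys + b - pos xs| <= 16 / 25 + 5 / 3 * h.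
  have := ler_normD (pos ys + b - pos xs - D) D; rewrite subrK.
  by lra with D1 Db.
have [cl' iv'] := advance cl iv z1 Sr NN.
have K1' : (size (rcons ys b))%:R <= n1c by rewrite size_rcons -natr1.
have := NG _ _ _ _ cl' iv' z1 K1'.
suff : PsiN xs (rcons ys b) ra Pl [seq it <- Nl | (size ys)%:R * s <= it.2] + h / bmin
  <= PsiP xs ys ra Pl Nl A B D chi la by move=> ? ?; lra.
rewrite /PsiN /PsiP pos_rcons size_rcons -natr1.
have -> : ((size ys)%:R + 1) * s - s = (size ys)%:R * s by ring.
set c := _%:R * s in lala iQ iQ1 bd pS0 cz lh2 *; set t := tm xs in lala bd hS0 cz lh2 *.
set r := pos xs in z1 NN Db Sr bd hS0 pS0 cz *.
have nS := nodeSum_le_piece r A0 B0 AB iQ1.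
have TL : 2 * (A * B) <= (A + B) ^+ 2 by have := sqr_ge0 (A - B); lra with T0.
have ll : c - t - A * B <= la by lra with lala T0.
have kPhi := Phi_ge (r - ra) T0 TL ll.
have z2 : (r - ra) ^+ 2 <= 49 / 100.
  rewrite -(real_normK (num_real (r - ra))).
  have := ler_pM (normr_ge0 _) (normr_ge0 _) (ltW z1) (ltW z1); rewrite -!expr2; lra.
have lh1 : `|c - t - A * B| <= 23 / 25.
  rewrite -ler_sqr ?nnegrE ?normr_ge0 //; last by lra.
  rewrite real_normK ?num_real //.
  move: bd cz; rewrite /cL; lra with D2 hS0 pS0 P1.
have lT : `|c - t - (c - t - A * B)| <= 2 * h.
  have -> : c - t - (c - t - A * B) = A * B by ring.
  by rewrite ger0_norm.
have m1' := sqr_close lh1 lT.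
have m2 := sqr_close D1 Db.
have hh : h ^+ 2 <= h / 400 by have := ler_wpM2l (ltW h0) hs; rewrite expr2; lra.
have m3 : (cL R + aZ R * (r - ra) ^+ 2) * (c - t) ^+ 2
  <= (cL R + aZ R * (r - ra) ^+ 2) * (c - t - A * B) ^+ 2 + 14 / 10 * (4 * h).
  have q0 : 0 <= cL R + aZ R * (r - ra) ^+ 2.
    by have q := sqr_ge0 (r - ra); rewrite /cL /aZ; lra with q.
  have q1 : cL R + aZ R * (r - ra) ^+ 2 <= 14 / 10 by rewrite /cL /aZ; lra with z2.
  have := ler_wpM2l q0 m1'.
  have : (cL R + aZ R * (r - ra) ^+ 2) * (2 * (23 / 25) * (2 * h) + (2 * h) ^+ 2)
     <= 14 / 10 * (4 * h).
    apply: ler_pM => //; last by lra with hh h0.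
    by have := sqr_ge0 (2 * h); lra with h0.
  by move: (cL R + _) => q; lra.
have rT : 0 <= r0c * (A * B) by rewrite mulr_ge0 ?r0c_ge0.
have cT : 0 <= chi ^+ 2 * (A * B) by rewrite mulr_ge0 ?sqr_ge0.
have kE : kend = 20 * h + h / bmin by [].
have -> : n1c - ((size ys)%:R + 1) = n1c - (size ys)%:R - 1 by ring.
rewrite (mulrDr r0c).
move: kPhi m3 nS m2 rT cT kE.
set F1 := (cL R + _) * _; set F2 := (cL R + _) * _; set F3 := Phi _ _ _ _ _.
set F4 := r0c * (A * B); set F5 := r0c * _; set F6 := chi ^+ 2 * _; set F7 := (_ + b - _) ^+ 2.
set F8 := kstep * _; set F9 := nodeSum _ _ _; set F10 := pieceSum _ _ _ _ _.
set F11 := hostSum _ _ _; move: F1 F2 F3 F4 F5 F6 F7 F8 F9 F10 F11.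
move=> F1 F2 F3 F4 F5 F6 F7 F8 F9 F10 F11 k1 k2 k3 k4 k5 k6 k7.
lra with k1 k2 k3 k4 k5 k6 k7 hh h0.
Qed.

(** The anchor moves only at distance at least 7/10, where [anchor_pay] applies. The new host
    obligation lasts until [c + 2 * s], when the window of the latest node closes; the new node
    obligation carries the present time, the latest host time that it has to cover. Each is opened
    only if such a window is still open. *)
Lemma reanchor xs ys ra Pl Nl A B D chi la : Inv xs ys ra Pl Nl ->
  `|pos xs - ra| <= 7 / 10 + h -> 0 <= A -> 0 <= B -> 0 < A + B ->
  exists ra' Pl' Nl', [/\ Inv xs ys ra' Pl' Nl', `|pos xs - ra'| < 7 / 10 &
    PsiP xs ys ra' Pl' Nl' A B D chi la <= PsiP xs ys ra Pl Nl A B D chi la].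
Proof.
move=> iv zh A0 B0 AB; have [iH iN iP iQ] := iv.
have [z1|z1] := ltP (`|pos xs - ra|) (7 / 10); first by exists ra, Pl, Nl; split.
set r := pos xs; set c := (size ys)%:R * s; set t := tm xs.
pose Pl' := if 0 <= c - t + 2 * s then (r, c + 2 * s) :: Pl else Pl.
pose Nl' := if c - t <= s then (r, t) :: Nl else Nl.
have tri (x y w : R) : `|x - y| <= `|x - w| + `|w - y|.
  by have := ler_normD (x - w) (w - y); rewrite subrKA.
exists r, Pl', Nl'; rewrite subrr normr0; split; last first.
- have z2 : 49 / 100 <= (r - ra) ^+ 2.
    rewrite -(real_normK (num_real (r - ra))).
    have q7 : 0 <= 7 / 10 :> R by lra.
    by have := ler_pM q7 q7 z1 z1; rewrite -!expr2; lra.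
  have key := @anchor_pay _ (r - ra) (c - t - A * B) A B m0c s la A0 B0 AB (ltW s0) m0c_ge z2.
  cbv zeta in key; rewrite subrK -/r0c in key.
  have eP : hostSum r t Pl' <= hostSum r t Pl +
    (if 0 <= c - t + 2 * s then GP 0 (c - t + 2 * s) else 0).
    rewrite /Pl'; case: ifP => _; last by rewrite addr0.
    rewrite /hostSum big_cons /= subrr addrC.
    by have -> : c + 2 * s - t = c - t + 2 * s by ring.
  have eN : pieceSum A B r c Nl' <= pieceSum A B r c Nl +
    (if c - t <= s then JN A B 0 (m0c - (c - t)) else 0).
    rewrite /Nl'; case: ifP => _; last by rewrite addr0.
    rewrite /pieceSum big_cons /= subrr addrC.
    by have -> : t - c + m0c = m0c - (c - t) by ring.
  rewrite /PsiP -/r -/c -/t subrr; move: key eP eN.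
  set F1 := Phi _ _ _ _ _; set F2 := Phi _ _ _ _ _.
  set F3 := r0c * _; set F4 := r0c * _; set F5 := hostSum _ _ _; set F6 := pieceSum _ _ _ _ _.
  set F7 := (if _ then GP _ _ else _); set F8 := (if _ then JN _ _ _ _ else _).
  move=> key eP eN.
  lra with key eP eN.
- by lra.
split.
- move=> k kK tk; have tc : t <= c + 2 * s.
    apply: le_trans tk _; rewrite lerD2r; apply: ler_wpM2r; first exact: ltW.
    by rewrite ler_nat.
  have c1 : 0 <= c - t + 2 * s by lra with tc.
  rewrite /Pl' c1; have [l1|[it il l1]] := iH k kK tk; right.
    exists (r, c + 2 * s); first by rewrite mem_head.
    split => /=; last first.
      have d := tri (psum k ys) r ra; rewrite (distrC ra) in d.
      by lra with d zh l1 h0.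
    by rewrite lerD2r; apply: ler_wpM2r; [exact: ltW|rewrite ler_nat].
  by exists it => //; rewrite in_cons il orbT.
- move=> i ix ci.
  have it' : i%:R * h ^+ 2 <= t by apply: ler_wpM2r; [exact: sqr_ge0|rewrite ler_nat].
  have c1 : c - t <= s by move: ci; rewrite -/c; lra with it'.
  rewrite /Nl' c1; have [l1|[it il l1]] := iN i ix ci; right.
    exists (r, t); first by rewrite mem_head.
    split => //=; have d := tri (psum i xs) r ra; rewrite (distrC ra) in d.
    by lra with d zh l1.
  by exists it => //; rewrite in_cons il orbT.
- move=> it; rewrite /Pl'; case: ifP => c1; last exact: iP.
  by rewrite in_cons => /predU1P[-> /=|/iP//]; rewrite -/t; lra with c1.
- move=> it; rewrite /Nl'; case: ifP => c1; last exact: iQ.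
  rewrite in_cons => /predU1P[-> /=|/iQ//]; split => //.
  by rewrite -/c; lra with c1.
Qed.

(** If the potential reaches 1, the claim is trivial because [U] is at most 1. Otherwise every host
    obligation keeps the new position within 49/20 of its centre, which preserves [tracks]; the
    anchor is then moved if necessary, and the piece ends or goes on. *)
Lemma piece_next xs x ys ra Pl Nl u v f A B la : (x == h) || (x == - h) ->
  PieceGood (rcons xs x) -> NodeGood (rcons xs x) ->
  tracks xs ys -> Inv xs ys ra Pl Nl -> `|pos xs - ra| < 7 / 10 -> (size ys)%:R + 1 <= n1c ->
  bmin <= u -> bmin <= v -> u + v <= 4 / 3 -> 3 / 5 <= f -> f <= 7 / 5 ->
  A + B = f * (u + v) -> 0 <= A -> 0 <= B -> (size ys)%:R * s - tm xs <= la ->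
  (B * U (rcons ys (- u)) + A * U (rcons ys v)) / (A + B)
  <= Val (rcons xs x) + PsiP (rcons xs x) ys ra [seq it <- Pl | tm xs + h ^+ 2 <= it.2] Nl
       A B (pos ys + A / f - u - pos (rcons xs x)) (f^-1 - 1) la.
Proof.
move=> xh PG NG cl iv z1 K1 bu bv uv f1 f2 ABE A0 B0 lala.
set D := pos ys + A / f - u - _; set chi := f^-1 - 1.
set xs' := rcons xs x; set Pl1 := [seq _ <- _ | _].
have f0 : 0 < f by lra with f1.
have AB : 0 < A + B.
  by rewrite ABE mulr_gt0 //; lra with bu bv bmin0.
have ABm : bmin <= A + B.
  have : 3 / 5 * (2 * bmin) <= f * (u + v).
    by apply: ler_pM => //; lra with bmin0 bu bv.
  by rewrite -ABE; lra with bmin0.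
have avg1 (a b : R) : a <= 1 -> b <= 1 -> (B * a + A * b) / (A + B) <= 1.
  move=> a1 b1; rewrite ler_pdivrMr // mul1r.
  by have := ler_wpM2l B0 a1; have := ler_wpM2l A0 b1; lra.
have [P1|P1] := leP 1 (PsiP xs' ys ra Pl1 Nl A B D chi la).
  apply: le_trans (avg1 _ _ (U1 _) (U1 _)) _; rewrite -[leLHS]add0r; exact: lerD.
have tri (a y w : R) : `|a - y| <= `|a - w| + `|w - y|.
  by have := ler_normD (a - w) (w - y); rewrite subrKA.
have xabs : `|x| = h by case/orP: xh => /eqP->; rewrite ?normrN gtr0_norm.
have rr : `|pos xs' - pos xs| = h by rewrite /xs' pos_rcons addrC addKr.
have zh : `|pos xs' - ra| <= 7 / 10 + h.
  by have d := tri (pos xs') ra (pos xs); lra with d z1 rr.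
have tE : tm xs' = tm xs + h ^+ 2 by rewrite /xs' tm_rcons.
have hh := sqr_ge0 h.
have [iH iN iP iQ] := iv.
have iv1 : Inv xs' ys ra Pl1 Nl.
  split.
  - move=> k kK; rewrite tE => tk.
    have tk' : tm xs <= k%:R * s + 2 * s by lra with tk hh.
    have [l1|[it il [l0 l1]]] := iH k kK tk'; first by left.
    by right; exists it => //; rewrite mem_filter il andbT (le_trans tk).
  - move=> i; rewrite {1}/xs' size_rcons leq_eqVlt => /predU1P[->|ix] w.
      by left; rewrite -[psum _ _]/(psum (size xs).+1 xs') -(size_rcons xs x).
    by rewrite /xs' psum_rcons //; apply: iN.
  - by move=> it; rewrite mem_filter tE => /andP[].
  - by move=> it /iQ[q1 q2]; split => //; rewrite tE; lra with q2 hh.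
have lala1 : (size ys)%:R * s - tm xs' <= la by rewrite tE; lra with lala hh.
have [_ _ iP1 iQ1] := iv1.
have iQ2 it : it \in Nl -> (size ys)%:R * s - s <= it.2 by move=> /iQ1[].
have [bd hS0 pS0 cz] := @PsiP_bounds xs' ys ra Pl1 Nl A B D chi la A0 B0 AB lala1 iP1 iQ2 K1.
have D2 := sqr_ge0 D; have lh2 := sqr_ge0 ((size ys)%:R * s - tm xs' - A * B).
have cl1 : tracks xs' ys.
  move=> k i kK; rewrite {1}/xs' size_rcons leq_eqVlt => /predU1P[->|ix] w; last first.
    by rewrite /xs' psum_rcons //; apply: cl.
  have -> : psum (size xs).+1 xs' = pos xs' by rewrite /pos /xs' size_rcons.
  have tk : tm xs' <= k%:R * s + 2 * s.
    move: w; rewrite ler_norml => /andP[_ w].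
    have : (size xs).+1%:R * h ^+ 2 = tm xs' by rewrite /tm /xs' size_rcons.
    by move=> e; rewrite e in w; lra with w.
  have [iH1 _ _ _] := iv1.
  have [l1|[it il [_ l1]]] := iH1 k kK tk.
    have d := tri (psum k ys) (pos xs') ra; rewrite (distrC ra) in d.
    by lra with d l1 zh hs.
  have l2 : `|pos xs' - it.1| <= 49 / 20.
    apply: (@pow4_lt _ _ (hostSum (pos xs') (tm xs') Pl1)); first exact: hostSum_item.
    by apply: le_lt_trans P1; move: bd cz; rewrite /cL; lra with D2 lh2 pS0.
  have d := tri (psum k ys) (pos xs') it.1; rewrite (distrC it.1) in d.
  by lra with d l1 l2 hs.
have [ra' [Pl' [Nl' [iv2 z2 le2]]]] := reanchor D chi la iv1 zh A0 B0 AB.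
apply: le_trans (lerD (lexx _) le2).
have P2 := le_lt_trans le2 P1.
have hA2 (a b : R) : 0 <= a -> a <= h -> a + b = A + B -> a * b <= 2 * h.
  move=> a0 ah ab; have b2 : b <= 2.
    have : f * (u + v) <= 7 / 5 * (4 / 3).
      by apply: ler_pM => //; lra with f1 bu bv bmin0.
    by rewrite -ABE; lra with ab a0.
  apply: le_trans (ler_wpM2l a0 b2) _; lra with ah.
have efin a : 0 <= a -> a <= h -> a / f <= 5 / 3 * h.
  move=> a0 ah; rewrite ler_pdivrMr //.
  by have := ler_wpM2l (ltW h0) f1; lra with ah.
have q0 a : 0 <= a -> a <= h -> a / (A + B) <= h / bmin.
  move=> a0 ah; apply: ler_pM => //; first by rewrite invr_ge0 ltW.
  by rewrite lef_pV2 ?posrE.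
have [Ah|Ah] := ltP A h.
  have := @finish xs' ys ra' Pl' Nl' A B D chi la (- u) NG cl1 iv2 z2 K1 A0 B0 AB
    (hA2 _ _ A0 (ltW Ah) erefl) lala1.
  have -> : pos ys + - u - pos xs' - D = - (A / f) by rewrite /D; ring.
  rewrite normrN ger0_norm; last by rewrite divr_ge0 // ltW.
  move=> /(_ (efin _ A0 (ltW Ah)) P2); apply: le_trans.
  have -> : (B * U (rcons ys (- u)) + A * U (rcons ys v)) / (A + B) = U (rcons ys (- u))
   + A / (A + B) * (U (rcons ys v) - U (rcons ys (- u))) by field; rewrite gt_eqF.
  rewrite lerD2l; apply: le_trans (q0 _ A0 (ltW Ah)).
  rewrite -[leRHS]mulr1; apply: ler_wpM2l; first by rewrite divr_ge0 // ltW.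
  by have a1 := U1 (rcons ys v); have a2 := U0 (rcons ys (- u)); lra with a1 a2.
have [Bh|Bh] := ltP B h.
  have BA : B * A <= 2 * h by apply: hA2 => //; [exact: ltW|rewrite addrC].
  rewrite mulrC in BA.
  have := @finish xs' ys ra' Pl' Nl' A B D chi la v NG cl1 iv2 z2 K1 A0 B0 AB BA lala1.
  have -> : pos ys + v - pos xs' - D = B / f.
    have -> : B = f * (u + v) - A by rewrite -ABE; ring.
    by rewrite /D; field; rewrite gt_eqF.
  rewrite ger0_norm; last by rewrite divr_ge0 // ltW.
  move=> /(_ (efin _ B0 (ltW Bh)) P2); apply: le_trans.
  have -> : (B * U (rcons ys (- u)) + A * U (rcons ys v)) / (A + B) = U (rcons ys v)
   + B / (A + B) * (U (rcons ys (- u)) - U (rcons ys v)) by field; rewrite gt_eqF.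
  rewrite lerD2l; apply: le_trans (q0 _ B0 (ltW Bh)).
  rewrite -[leRHS]mulr1; apply: ler_wpM2l; first by rewrite divr_ge0 // ltW.
  by have a1 := U1 (rcons ys (- u)); have a2 := U0 (rcons ys v); lra with a1 a2.
by apply: (PG ys ra' Pl' Nl' u v f A B la).
Qed.

(** Once the host's time is used up, a walk with fewer than [n] increments has its clock at least 2
    behind, and [cL] times the square of that lag already exceeds 1. *)
Lemma piece_last xs : size xs = Mtot -> PieceGood xs.
Proof.
move=> xM ys ra Pl Nl u v f A B la cl iv z1 K1 bu bv uv f1 f2 ABE hA hB lala.
set D := pos ys + _ - _ - _; set chi := f^-1 - 1.
have A0 : 0 < A by exact: lt_le_trans hA.
have B0 : 0 < B by exact: lt_le_trans hB.
have AB : 0 < A + B by rewrite addr_gt0.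
have [iH iN iP iQ] := iv.
have iQ2 it : it \in Nl -> (size ys)%:R * s - s <= it.2 by move=> /iQ[].
have [bd hS0 pS0 cz] := @PsiP_bounds xs ys ra Pl Nl A B D chi la (ltW A0) (ltW B0) AB lala iP iQ2 K1.
have D2 := sqr_ge0 D; have lh2 := sqr_ge0 ((size ys)%:R * s - tm xs - A * B).
have Psi0 : cL R * ((size ys)%:R * s - tm xs - A * B) ^+ 2
    <= PsiP xs ys ra Pl Nl A B D chi la by lra with bd cz D2 hS0 pS0.
have tM : n%:R * s + 2 <= tm xs by rewrite /tm xM.
have [Kn|Kn] := leqP n (size ys).
  rewrite !Ufin // -mulrDl (addrC B) mulrAC divff ?gt_eqF // mul1r.
  rewrite -[leLHS]addr0; apply: lerD.
    by apply: Vdone => //; [rewrite xM|lra with tM].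
  by apply: le_trans Psi0; rewrite mulr_ge0 // /cL; lra.
have far : (size ys)%:R * s - tm xs - A * B <= - 2.
  have w : (size ys)%:R * s <= n%:R * s.
    by apply: ler_wpM2r; [exact: ltW|rewrite ler_nat ltnW].
  by have := mulr_gt0 A0 B0; lra with w tM.
have big1 : 1 <= PsiP xs ys ra Pl Nl A B D chi la.
  apply: le_trans Psi0; have q2 : 0 <= 2 :> R by [].
  rewrite lerNr in far; have := ler_pM q2 q2 far far; rewrite -!expr2 sqrrN /cL; lra.
apply: (@le_trans _ _ 1); last by rewrite -[leLHS]add0r; exact: lerD.
rewrite ler_pdivrMr // mul1r.
have a1 := ler_wpM2l (ltW B0) (U1 (rcons ys (- u))).
by have a2 := ler_wpM2l (ltW A0) (U1 (rcons ys v)); lra with a1 a2.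
Qed.

Lemma piece_step xs : (size xs < Mtot)%N ->
  (forall x, PieceGood (rcons xs x)) -> (forall x, NodeGood (rcons xs x)) -> PieceGood xs.
Proof.
move=> xM PG NG ys ra Pl Nl u v f A B la cl iv z1 K1 bu bv uv f1 f2 ABE hA hB lala.
have f0 : 0 < f by lra with f1.
have A0 : 0 < A by exact: lt_le_trans hA.
have B0 : 0 < B by exact: lt_le_trans hB.
have AB : 0 < A + B by rewrite addr_gt0.
set Pl1 := [seq it <- Pl | tm xs + h ^+ 2 <= it.2].
have Ap : 0 <= A + h by rewrite addr_ge0 // ltW.
have Am : 0 <= A - h by rewrite subr_ge0.
have Bp : 0 <= B + h by rewrite addr_ge0 // ltW.
have Bm : 0 <= B - h by rewrite subr_ge0.
have E1 : A + h + (B - h) = f * (u + v) by rewrite -ABE; ring.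
have E2 : A - h + (B + h) = f * (u + v) by rewrite -ABE; ring.
have e1 : (h == h) || (h == - h) by rewrite eqxx.
have e2 : (- h == h) || (- h == - h) by rewrite eqxx orbT.
have n1 := piece_next e1 (PG h) (NG h) cl iv z1 K1 bu bv uv f1 f2 E1 Ap Bm lala.
have n2 := piece_next e2 (PG (- h)) (NG (- h)) cl iv z1 K1 bu bv uv f1 f2 E2 Am Bp lala.
have z2 : (pos xs - ra) ^+ 2 <= 49 / 100.
  rewrite -(real_normK (num_real (pos xs - ra))).
  have := ler_pM (normr_ge0 _) (normr_ge0 _) (ltW z1) (ltW z1); rewrite -!expr2; lra.
set D := pos ys + A / f - u - pos xs; set chi := f^-1 - 1.
have st := @PsiP_step xs ys ra Pl1 Nl A B D chi la z2 hA hB lala.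
have [iH iN iP iQ] := iv.
have fl := hostSum_filter (pos xs) (tm xs + h ^+ 2) iP.
have flP : PsiP xs ys ra Pl1 Nl A B D chi la <= PsiP xs ys ra Pl Nl A B D chi la.
  by rewrite /PsiP !lerD2r lerD2l.
have D1 : pos ys + (A + h) / f - u - pos (rcons xs h) = D + chi * h.
  by rewrite pos_rcons /D /chi; field; rewrite gt_eqF.
have D2 : pos ys + (A - h) / f - u - pos (rcons xs (- h)) = D - chi * h.
  by rewrite pos_rcons /D /chi; field; rewrite gt_eqF.
rewrite D1 E1 -/Pl1 -/chi in n1; rewrite D2 E2 -/Pl1 -/chi in n2; rewrite ABE (Vrec xM).
have -> : (B * U (rcons ys (- u)) + A * U (rcons ys v)) / (f * (u + v))
  = (((B - h) * U (rcons ys (- u)) + (A + h) * U (rcons ys v)) / (f * (u + v))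
    + ((B + h) * U (rcons ys (- u)) + (A - h) * U (rcons ys v)) / (f * (u + v))) / 2.
  by rewrite -mulrDl -[RHS]mulrAC; congr (_ / _); lra.
move: (PsiP _ _ _ _ _ _ _ _ _ _) (PsiP _ _ _ _ _ _ _ _ _ _) (PsiP _ _ _ _ _ _ _ _ _ _)
 (PsiP _ _ _ _ _ _ _ _ _ _) (_ / (f * (u + v))) (_ / (f * (u + v))) st flP n1 n2.
by move=> w1 w2 w3 w4 w5 w6 st flP n1 n2; lra with st flP n1 n2.
Qed.

Lemma nodeSum_item r c Nl it : (forall it, it \in Nl -> c <= it.2) -> it \in Nl ->
  (r - it.1) ^+ 4 / 36 <= nodeSum r c Nl.
Proof.
move=> H il; have mc := m0c_ge; rewrite /nodeSum (big_rem it) //=.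
apply: le_trans (GN_ge (r - it.1) (_ : 0 <= it.2 - c + m0c)) _.
  by have := H _ il; lra with s0 mc.
rewrite lerDl big_seq; apply: sumr_ge0 => j /mem_rem /H jt.
by apply: GN_ge0; lra with jt s0 mc.
Qed.

(** Clearing the denominator [u + v] gives the shape that [meanf_two_point] asks for: [u * v * (u +
    v) = v * u ^+ 2 + u * v ^+ 2] turns the variance terms into [al * b ^+ 2], and in the same way
    [quartic] becomes [Q * b ^+ 4]. *)
Lemma node_pair (z l la g u v r0 D2 hs' k1 Q P W x y gx gy : R) :
  0 < u + v -> (v * x + u * y) / (u + v) <= W + (P + r0 * (z ^+ 2 + g * (u * v))
    + (D2 + 25 / 64 * l ^+ 2 * (u * v)) + hs' + (v * gx + u * gy) / (u + v) + k1) ->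
  P <= (cL R + aZ R * z ^+ 2) * (la ^+ 2 - 2 * la * g * (u * v)) + 2 * aZ R * g * la ^+ 2 * (u * v)
     + Q * quartic u v ->
  let C := (cL R + aZ R * z ^+ 2) * la ^+ 2 + r0 * z ^+ 2 + D2 + hs' + k1 in
  let al := (cL R + aZ R * z ^+ 2) * (- 2 * la * g) + 2 * aZ R * g * la ^+ 2 + r0 * g
     + 25 / 64 * l ^+ 2 in
  v * (x - (W + C) - al * (- u) ^+ 2 - Q * (- u) ^+ 4 - gx)
  + u * (y - (W + C) - al * v ^+ 2 - Q * v ^+ 4 - gy) <= 0.
Proof.
move=> uv; rewrite ler_pdivrMr // => h1 h2; cbv zeta.
set F := (cL R + _) in h2 *; have {h2} := ler_wpM2l (ltW uv) h2.
rewrite sqrrN (_ : (- u) ^+ 4 = u ^+ 4); last by ring.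
move: h1.
have -> : (W + (P + r0 * (z ^+ 2 + g * (u * v)) + (D2 + 25 / 64 * l ^+ 2 * (u * v)) + hs'
  + (v * gx + u * gy) / (u + v) + k1)) * (u + v)
  = (W + P + r0 * (z ^+ 2 + g * (u * v)) + (D2 + 25 / 64 * l ^+ 2 * (u * v)) + hs' + k1) * (u + v)
   + (v * gx + u * gy) by field; rewrite gt_eqF.
clear uv; move: (aZ R) F (z ^+ 2) (l ^+ 2) => a F z2 l2.
have -> : (u + v) * (F * (la ^+ 2 - 2 * la * g * (u * v)) + 2 * a * g * la ^+ 2 * (u * v)
   + Q * quartic u v)
  = F * la ^+ 2 * (u + v) + (F * (- 2 * la * g) + 2 * a * g * la ^+ 2) * (u * v * (u + v))
   + Q * (v * u ^+ 4 + u * v ^+ 4) by rewrite /quartic; ring.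
have -> : (u + v) * P = P * (u + v) by ring.
move=> h1 h2; rewrite -subr_ge0.
rewrite -subr_ge0 in h1; rewrite -subr_ge0 in h2.
move: (addr_ge0 h1 h2); congr (0 <= _); ring.
Qed.

(** The test function [phi] is [U] minus all that a piece may cost, as a function of the increment.
    On pairs its sign comes from [PieceGood]; at 0, where the host does not move, from the last
    hypothesis. The mean of the cost is then bounded by [node_num] and [GN_node]. *)
Lemma node_step xs ys ra Pl Nl : (size xs <= Mtot)%N -> PieceGood xs ->
  tracks xs ys -> Inv xs ys ra Pl Nl -> `|pos xs - ra| < 7 / 10 -> (size ys)%:R <= n1c ->
  let Nl' := [seq it <- Nl | (size ys)%:R * s <= it.2] in
  ((size ys)%:R + 1 <= n1c -> tracks xs (rcons ys 0) -> Inv xs (rcons ys 0) ra Pl Nl' ->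
    U (rcons ys 0) <= Val xs + PsiN xs (rcons ys 0) ra Pl Nl') ->
  U ys <= Val xs + PsiN xs ys ra Pl Nl.
Proof.
move=> xM PG cl iv z1 K1; cbv zeta => IH.
have [P1|P1] := leP 1 (PsiN xs ys ra Pl Nl).
  by apply: le_trans (U1 _) _; rewrite -[leLHS]add0r; exact: lerD.
have [iH iN iP iQ] := iv.
have iQ2 it : it \in Nl -> (size ys)%:R * s - s <= it.2 by move=> /iQ[].
set c := (size ys)%:R * s in iQ2 *; set t := tm xs; set r := pos xs.
set l := c - s - t; set z := r - ra.
have hS0 := hostSum_ge0 r iP; have nS0 := nodeSum_ge0 r iQ2.
have cz : cL R * l ^+ 2 <= (cL R + aZ R * z ^+ 2) * l ^+ 2.
  apply: ler_wpM2r; first exact: sqr_ge0.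
  by rewrite lerDl mulr_ge0 ?sqr_ge0 // /aZ; lra.
have rz : 0 <= r0c * z ^+ 2 by rewrite mulr_ge0 ?r0c_ge0 ?sqr_ge0.
have kk : 0 <= kstep * (n1c - (size ys)%:R) by rewrite mulr_ge0 ?kstep_ge0 // subr_ge0.
have PE : PsiN xs ys ra Pl Nl = (cL R + aZ R * z ^+ 2) * l ^+ 2 + r0c * z ^+ 2
  + 625 / 256 * (pos ys - r) ^+ 2 + hostSum r t Pl + nodeSum r (c - s) Nl
  + kstep * (n1c - (size ys)%:R) by [].
have D2 := sqr_ge0 (pos ys - r).
have cl2 : cL R * l ^+ 2 < 1.
  by move: P1; rewrite PE; lra with cz rz kk hS0 nS0 D2.
have l2 : 0 <= cL R * l ^+ 2 by rewrite mulr_ge0 ?sqr_ge0 // /cL; lra.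
have l1 : `|l| <= 23 / 25.
  rewrite -ler_sqr ?nnegrE ?normr_ge0 //; last by lra.
  by rewrite real_normK ?num_real //; move: cl2; rewrite /cL; lra.
have D1 : `|pos ys - r| <= 16 / 25.
  rewrite -ler_sqr ?nnegrE ?normr_ge0 //; last by lra.
  rewrite real_normK ?num_real //; rewrite PE in P1; lra with P1 cz rz kk hS0 nS0 l2.
have NN it : it \in Nl -> `|pos xs - it.1| <= 49 / 20.
  move=> il; apply: (@pow4_lt _ _ (nodeSum r (c - s) Nl)); first exact: nodeSum_item.
  by rewrite PE in P1; lra with P1 cz rz kk hS0 D2 l2.
have lN : - (23 / 25) <= l <= 23 / 25 by rewrite -ler_norml.
have /andP[la1 la2] := lN.
have Psi0 : 0 <= PsiN xs ys ra Pl Nl.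
  by rewrite PE; lra with cz rz kk hS0 nS0 l2 D2.
have [/andP[nK nt]|nd] := boolP ((n <= size ys)%N && (n%:R * s <= t)).
  by rewrite -[leLHS]addr0; apply: lerD => //; exact: Vdone.
have K2 : (size ys)%:R + 1 <= n1c.
  have is0 : 0 < s^-1 by rewrite invr_gt0.
  move: nd; rewrite negb_and -ltnNge -ltNge => /orP[nK|nt].
    have : (size ys)%:R + 1 <= n%:R :> R by rewrite natr1 ler_nat.
    by rewrite /n1c; lra with is0.
  have w : ((size ys)%:R - n%:R - 1) * s <= 1.
    by move: la2; rewrite /l /c; lra with nt.
  have := ler_wpM2r (ltW is0) w; rewrite mulfK ?gt_eqF // /n1c; lra.
pose f := 1 + 2 / 5 * l.
have f1 : 3 / 5 <= f by rewrite /f; lra with la1.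
have f2 : f <= 7 / 5 by rewrite /f; lra with la2.
have f0 : 0 < f by lra with f1.
pose la := l + s.
have laE : la = c - t by rewrite /la /l; ring.
pose g := f ^+ 2.
pose k1 := kend + kstep * (n1c - (size ys)%:R - 1).
pose Q := startCoef (z ^+ 2) g `|la|.
pose D2' := 625 / 256 * (pos ys - r) ^+ 2.
pose C := (cL R + aZ R * z ^+ 2) * la ^+ 2 + r0c * z ^+ 2 + D2' + hostSum r t Pl + k1.
pose al := (cL R + aZ R * z ^+ 2) * (- 2 * la * g) + 2 * aZ R * g * la ^+ 2 + r0c * g
     + 25 / 64 * l ^+ 2.
pose G b := \sum_(it <- Nl) GN (r - it.1 + f * b) (it.2 - c + m0c).
pose phi b := U (rcons ys b) - (Val xs + C) - al * b ^+ 2 - Q * b ^+ 4 - G b.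
have z2 : z ^+ 2 <= 49 / 100.
  rewrite -(real_normK (num_real z)).
  have := ler_pM (normr_ge0 _) (normr_ge0 _) (ltW z1) (ltW z1); rewrite -!expr2; lra.
have key : meanf law phi <= 0.
  apply: meanf_two_point => //.
  - move=> a e al0 el0 a0 e0.
    have : bmin <= `|a.2| by apply: lawm => //; rewrite lt_eqF.
    have : bmin <= `|e.2| by apply: lawm => //; rewrite gt_eqF.
    have := lawb al0; have := lawb el0; rewrite (ltr0_norm a0) (gtr0_norm e0).
    have -> : e.2 * phi a.2 - a.2 * phi e.2 = e.2 * phi (- - a.2) + - a.2 * phi e.2.
      by rewrite opprK mulNr.
    move: (- a.2) e.2 => u v v1 u1 bv bu {al0 el0 a0 e0 a e}.
    have u0 : 0 < u by exact: lt_le_trans bu.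
    have v0 : 0 < v by exact: lt_le_trans bv.
    have uv : 0 < u + v by exact: addr_gt0.
    have start := @Phi_start _ z u v f la u0 u1 v0 v1; cbv zeta in start.
    apply: (@node_pair z l la g u v _ _ _ _ _ (Phi z (la - g * (u * v)) (g * (u * v))
      (g * (u + v) ^+ 2) la)) => //.
    have bmf w : bmin <= w -> h <= f * w.
      move=> bw; have : 3 / 5 * bmin <= f * w by apply: ler_pM => //; lra with bmin0.
      by lra with hb bmin0.
    have uv43 : u + v <= 4 / 3 by lra with u1 v1.
    have := PG ys ra Pl Nl u v f (f * u) (f * v) la cl iv z1 K2 bu bv uv43 f1 f2
      (esym (mulrDr f u v)) (bmf _ bu) (bmf _ bv).
    rewrite -/c -/t laE lexx => /(_ isT).
    have -> : (f * v * U (rcons ys (- u)) + f * u * U (rcons ys v)) / (f * u + f * v)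
      = (v * U (rcons ys (- u)) + u * U (rcons ys v)) / (u + v).
      by field; rewrite gt_eqF // -mulrDr gt_eqF // mulr_gt0.
    have -> : pos ys + f * u / f - u - pos xs = pos ys - r.
      by rewrite -/r; field; rewrite gt_eqF.
    rewrite /PsiP -/c -/t -/r -/z.
    have -> : f * u * (f * v) = g * (u * v) by rewrite /g; ring.
    have -> : (f * u + f * v) ^+ 2 = g * (u + v) ^+ 2 by rewrite /g; ring.
    have -> : 625 / 256 * ((pos ys - r) ^+ 2 + (f^-1 - 1) ^+ 2 * (g * (u * v)))
      = D2' + 25 / 64 * l ^+ 2 * (u * v).
      rewrite /D2' /g.
      have -> : l ^+ 2 = 25 / 4 * (1 - f) ^+ 2 by rewrite /f; field.
      by field; rewrite gt_eqF.
    have -> : pieceSum (f * u) (f * v) r c Nl = (v * G (- u) + u * G v) / (u + v).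
      rewrite /pieceSum /G !mulr_sumr -big_split mulr_suml.
      apply: eq_bigr => it _; rewrite /JN /=.
      have -> : r - it.1 - f * u = r - it.1 + f * - u by ring.
      by field; rewrite gt_eqF // -mulrDr gt_eqF // mulr_gt0.
    move=> w; apply: le_trans w _; rewrite -laE lerD2l /k1.
    by rewrite -!addrA.
  - move=> a al0 a0.
    have Sr : `|pos ys + 0 - pos xs| <= 16 / 25 + 5 / 3 * h.
      by rewrite addr0; lra with D1 h0.
    have [cl' iv'] := advance cl iv z1 Sr NN.
    have := IH K2 cl' iv'.
    rewrite /PsiN pos_rcons size_rcons -natr1 addr0.
    have -> : ((size ys)%:R + 1) * s - s = c by rewrite /c; ring.
    rewrite -/t -/r -/z -laE /phi /G.
    have -> : n1c - ((size ys)%:R + 1) = n1c - (size ys)%:R - 1 by ring.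
    have : nodeSum r c [seq it <- Nl | c <= it.2]
      <= \sum_(it <- Nl) GN (r - it.1 + f * 0) (it.2 - c + m0c).
      rewrite /nodeSum big_filter [leRHS](bigID (fun it : R * R => c <= it.2)) /=.
      rewrite -[leLHS]addr0; apply: lerD.
        by apply: ler_sum => it _; rewrite mulr0 addr0.
      rewrite big_seq_cond; apply: sumr_ge0 => it /andP[/iQ2 itc _]; apply: GN_ge0.
      by have := m0c_ge; lra with itc s0.
    rewrite /C -/D2' expr0n /= mulr0 expr0n /= mulr0 /k1.
    move: (nodeSum _ _ _) (\sum_(it <- Nl) _) (hostSum _ _ _) (_ * la ^+ 2) (U _) (kstep * _).
    move=> w1 w2 w3 w4 w5 w6 i1 i2; have ke := kend_ge0.
    by lra with i1 i2 ke.
have E : meanf law phi = U ys - (Val xs + C) - al * mom2 - Q * mom4 - meanf law G.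
  rewrite (Urec ys) -[Val xs + C]mulr1 -p1 /mom2 /mom4 /meanf !mulr_sumr -!sumrN -!big_split /=.
  by apply: eq_bigr => a _; rewrite /phi; move: (G _) => w; ring.
have GE : meanf law G <= nodeSum r (c - s) Nl.
  have -> : meanf law G = \sum_(it <- Nl) meanf law (fun b =>
      GN (r - it.1 + f * b) (it.2 - (c - s) + m0c - s)).
    rewrite /meanf /G exchange_big; apply: eq_bigr => a _; rewrite mulr_sumr.
    by apply: eq_bigr => it _; congr (_ * GN _ _); ring.
  rewrite /nodeSum big_seq [leRHS]big_seq; apply: ler_sum => it il.
  (* A pending node obligation has its time between [c - s] and [t], so the lag [l = c - s - t] is
     not positive and [f <= 1]. *)
  apply: GN_node => //; first exact: ltW.
    by have [w1 w2] := iQ _ il; rewrite /f; move: w1 w2; rewrite -/c -/t /l; lra.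
  by have w := iQ2 _ il; rewrite -/m0c; lra with w.
have del0 : 0 <= s - mom2 by rewrite subr_ge0.
have num := @node_num _ (z ^+ 2) l s (s - mom2) mom4 (sqr_ge0 z) z2 (ltW cl2) s0 ss mom4_ge0
  K4s del0 dels sK.
cbv zeta in num; rewrite -/f -/g -/la subKr -/m0c -/r0c -/Q in num.
rewrite E in key.
have kE : kstep = kend + 25 / 4 * mom4 + 18 * ((s - mom2) ^+ 2 / s) by [].
rewrite PE -/D2'; move: key GE num; rewrite /C /al /k1.
have -> : kstep * (n1c - (size ys)%:R - 1) = kstep * (n1c - (size ys)%:R) - kstep by ring.
move: (nodeSum _ _ _) (meanf law G) (hostSum _ _ _) (kstep * _) => w1 w2 w3 w4.
rewrite kE; move: ((s - mom2) ^+ 2 / s) => w5 i1 i2 i3.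
lra with i1 i2 i3.
Qed.

(** A zero increment adds a node without moving the host, so induction along the host does not
    suffice. The inner induction on the number of nodes terminates because that number never exceeds
    [n1c]. *)
Lemma node_of_piece xs : (size xs <= Mtot)%N -> PieceGood xs -> NodeGood xs.
Proof.
move=> xM PG ys ra Pl Nl; have [j] := ubnP (nmax.+1 - size ys).
elim: j => // j IH in ys ra Pl Nl * => jK cl iv z1 K1.
apply: node_step => // K2 cl' iv'.
apply: IH => //; last by rewrite size_rcons -natr1.
rewrite size_rcons; move: jK; rewrite ltnS => jK.
have : (size ys <= nmax)%N.
  by rewrite -(ler_nat R); have := nmax_ge; lra with K2 nmax_ge.
by move=> w; rewrite subSS; apply: leq_trans jK; rewrite subSn.
Qed.

(** At the start there are no obligations, the anchor is 0 and the shifted lag is [- s]; this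
    accounts for the term [cL R * s ^+ 2]. *)
Lemma embedding_bound : U [::] <= Val [::] + cL R * s ^+ 2 + kstep * n1c.
Proof.
have main : forall j xs, (Mtot - size xs)%N = j -> (size xs <= Mtot)%N ->
  PieceGood xs /\ NodeGood xs.
  elim=> [|j IH] xs jx xM.
    have PG : PieceGood xs.
      by apply: piece_last; apply/eqP; rewrite eqn_leq xM /= -subn_eq0 jx.
    by split => //; exact: node_of_piece.
  have xM' : (size xs < Mtot)%N by rewrite -subn_gt0 jx.
  have IH' x : PieceGood (rcons xs x) /\ NodeGood (rcons xs x).
    by apply: IH; rewrite size_rcons // subnS jx.
  have PG : PieceGood xs.
    by apply: piece_step => // x; have [] := IH' x.
  by split => //; exact: node_of_piece.
have [_ NG] := main _ [::] erefl (leq0n _).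
have posn : pos [::] = 0 by rewrite /pos psum0.
have tmn : tm [::] = 0 by rewrite /tm mul0r.
have := NG [::] 0 [::] [::].
rewrite /PsiN posn tmn /= subrr normr0 mul0r /hostSum /nodeSum !big_nil.
have -> : (cL R + aZ R * 0 ^+ 2) * (0 - s - 0) ^+ 2 + r0c * 0 ^+ 2 + 625 / 256 * 0 ^+ 2 + 0 + 0
  + kstep * (n1c - 0) = cL R * s ^+ 2 + kstep * n1c by ring.
rewrite addrA; apply.
- move=> k i; rewrite leqn0 => /eqP-> /=; rewrite leqn0 => /eqP->.
  by rewrite !psum0 subrr normr0 => _; lra.
- split => //.
  + move=> k; rewrite leqn0 => /eqP-> _; left; rewrite psum0 subrr normr0; lra with h0.
  + move=> i; rewrite leqn0 => /eqP-> _; left; rewrite psum0 subrr normr0; lra with h0.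
- by lra.
- by have := invr_gt0 s; rewrite s0 /n1c => w; have := ler0n R n; lra.
Qed.

End Embedding.

(* [disc w] rounds small values towards 0 to multiples of [w]; large values,
   whose occurrence is counted as a failure, are moved to [+-9/20]. *)
Definition disc (R : archiRealFieldType) (w x : R) : R :=
  Num.sg x * (if `|x| <= 33 / 50 then w * (Num.truncn (`|x| / w))%:R else 9 / 20).

(** * The truncated third moment and the rounding estimates *)

Definition min32 (R : realFieldType) (x : R) : R := Num.min (`|x| ^+ 3) (x ^+ 2).

Lemma min32_ge (R : realFieldType) (x y : R) : y <= `|x| ^+ 3 -> y <= x ^+ 2 -> y <= min32 x.
Proof. by move=> a b; rewrite /min32 le_min a b. Qed.

Lemma min32_ge0 (R : realFieldType) (x : R) : 0 <= min32 x.
Proof. by apply: min32_ge; [exact: exprn_ge0|exact: sqr_ge0]. Qed.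

Lemma min32_le_sqr (R : realFieldType) (x : R) : min32 x <= x ^+ 2.
Proof. by rewrite /min32 ge_min lexx orbT. Qed.

(** The tangent of the cube, as a function of [x ^+ 2], at [|x| = 1 / 100]. In [constants_ok] it
    forces [s] to be small. *)
Lemma min32_tangent (R : realFieldType) (x : R) : 3 / 200 * x ^+ 2 - (1 / 100) ^+ 3 / 2 <= min32 x.
Proof.
apply: min32_ge; last by have := sqr_ge0 x; lra.
rewrite -(real_normK (num_real x)); have := normr_ge0 x; move: `|x| => a a0.
have : 0 <= (a - 1 / 100) ^+ 2 * (a + 1 / 200) by rewrite mulr_ge0 ?sqr_ge0 //; lra.
have -> : (a - 1 / 100) ^+ 2 * (a + 1 / 200) = a ^+ 3 - 3 / 200 * a ^+ 2 + (1 / 100) ^+ 3 / 2 by field.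
by clear; lra.
Qed.

Lemma disc_small (R : archiRealFieldType) (w x : R) : 0 < w -> `|x| <= 33 / 50 ->
  `|disc w x| <= `|x| /\ `|x - disc w x| <= w.
Proof.
move=> w0 xA; rewrite /disc xA.
have xw0 : 0 <= `|x| / w by rewrite divr_ge0 // ltW.
have /andP[t1 t2] := truncn_itv xw0.
move: t1 t2; rewrite -natr1; move: (Num.truncn _) => k t1 t2.
have k1 : w * k%:R <= `|x| by rewrite mulrC -ler_pdivlMr.
have k2 : `|x| <= w * k%:R + w.
  by move: (ltW t2); rewrite ler_pdivrMr // mulrDl mul1r mulrC.
have k0 : 0 <= w * k%:R by rewrite mulr_ge0 // ltW.
have [x0|x0|->] := ltgtP x 0; last by rewrite normr0 sgr0 mul0r subr0 normr0 lexx ltW.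
  rewrite ltr0_sg // mulN1r normrN ger0_norm // opprK; split => //.
  by move: k1 k2; rewrite ltr0_norm // => k1 k2; rewrite ler_norml; lra from k1 k2 w0.
rewrite gtr0_sg // mul1r ger0_norm //; split => //.
by move: k1 k2; rewrite gtr0_norm // => k1 k2; rewrite ler_norml; lra from k1 k2 w0.
Qed.

Lemma disc_big (R : archiRealFieldType) (w x : R) : 33 / 50 < `|x| ->
  `|disc w x| = 9 / 20 /\ `|x - disc w x| = `|x| - 9 / 20.
Proof.
move=> xA; rewrite /disc leNgt xA /=.
have n9 : `|9 / 20| = 9 / 20 :> R by rewrite ger0_norm //; lra.
have [x0|x0|x0] := ltgtP x 0; last by move: xA; rewrite x0 normr0 => ?; lra.
  rewrite ltr0_sg // mulN1r normrN n9; split => //.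
  by move: xA; rewrite (ltr0_norm x0) opprK => xA; rewrite ltr0_norm; lra.
rewrite gtr0_sg // mul1r n9; split => //.
by move: xA; rewrite (gtr0_norm x0) => xA; rewrite gtr0_norm //; lra.
Qed.

Lemma min32_big (R : realFieldType) (x c d : R) : 33 / 50 < `|x| ->
  (forall a : R, 33 / 50 <= a -> a <= 1 -> c + d * a + 0 <= a ^+ 3) ->
  (forall a : R, 1 <= a -> c + d * a + 0 <= a ^+ 2) -> c + d * `|x| <= min32 x.
Proof.
move=> xA H1 H2; apply: min32_ge.
  have [x1|x1] := leP (`|x|) 1; first by have := H1 _ (ltW xA) x1; rewrite addr0.
  have := H2 _ (ltW x1); rewrite addr0 => /le_trans; apply.
  have -> : `|x| ^+ 3 = `|x| * `|x| ^+ 2 by ring.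
  by rewrite -{1}[_ ^+ 2]mul1r; apply: ler_wpM2r; [exact: sqr_ge0|exact: ltW].
rewrite -(real_normK (num_real x)).
have [x1|x1] := leP (`|x|) 1; last by have := H2 _ (ltW x1); rewrite addr0.
have := H1 _ (ltW xA) x1; rewrite addr0 => /le_trans; apply.
have -> : `|x| ^+ 3 = `|x| * `|x| ^+ 2 by ring.
by rewrite -[leRHS]mul1r; apply: ler_wpM2r; [exact: sqr_ge0|].
Qed.

Lemma disc_le (R : archiRealFieldType) (w x : R) : 0 < w ->
 `|disc w x| <= 33 / 50.
Proof.
move=> w0.
have [xA|xA] := leP `|x| (33 / 50).
  by have [a _] := disc_small w0 xA; apply: le_trans xA.
by have [-> _] := disc_big w xA; lra.
Qed.

Lemma disc_le_abs (R : archiRealFieldType) (w x : R) : 0 < w ->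
 `|disc w x| <= `|x|.
Proof.
move=> w0.
have [xA|xA] := leP `|x| (33 / 50); first by have [a _] := disc_small w0 xA.
by have [-> _] := disc_big w xA; move: xA; lra.
Qed.

Lemma disc_dist (R : archiRealFieldType) (w x : R) : 0 < w ->
  `|x - disc w x| <= w + 37 / 50 * min32 x.
Proof.
move=> w0.
have m0 := min32_ge0 x; have [xA|xA] := leP `|x| (33 / 50).
  by have [_ a] := disc_small w0 xA; lra from a m0.
have [_ ->] := disc_big w xA.
have := @min32_big _ x (- (50 / 37) * (9 / 20)) (50 / 37) xA.
have q1 (a : R) : 33 / 50 <= a -> a <= 1 -> - (50 / 37) * (9 / 20) + 50 / 37 * a + 0 <= a ^+ 3.
  (* The tangent of the cube at 27/40 vanishes at 9/20, the modulus given to large values; its slope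
     exceeds 50/37. *)
  move=> a1 a2; have : 0 <= (a - 27 / 40) ^+ 2 * (a + 27 / 20) by rewrite mulr_ge0 ?sqr_ge0 //; lra.
  have -> : (a - 27 / 40) ^+ 2 * (a + 27 / 20) = a ^+ 3 - 3 * (27 / 40) ^+ 2 * a + 2 * (27 / 40) ^+ 3 by field.
  lra.
have q2 (a : R) : 1 <= a -> - (50 / 37) * (9 / 20) + 50 / 37 * a + 0 <= a ^+ 2.
  by move=> a1; have := sqr_ge0 (a - 1); rewrite sqrrB; lra.
by move=> /(_ q1 q2) q; move: q (ltW w0); clear; lra.
Qed.

Lemma disc_sqr (R : archiRealFieldType) (w x : R) : 0 < w ->
  disc w x ^+ 2 <= x ^+ 2 /\ x ^+ 2 - disc w x ^+ 2 <= 2 * w + min32 x.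
Proof.
move=> w0.
have yx := disc_le_abs x w0.
split; first by rewrite -(real_normK (num_real x)) -(real_normK (num_real (disc w x))); apply: lerXn2r; rewrite ?nnegrE.
have m0 := min32_ge0 x; move: yx; have [xA|xA] := leP `|x| (33 / 50) => yx.
  have [_ a] := disc_small w0 xA.
  have -> : x ^+ 2 - disc w x ^+ 2 = (x - disc w x) * (x + disc w x) by ring.
  suff : (x - disc w x) * (x + disc w x) <= w * 2 by lra from m0.
  apply: le_trans (ler_norm _) _; rewrite normrM; apply: ler_pM => //.
  by apply: le_trans (ler_normD _ _) _; lra from yx xA.
have [d1 _] := disc_big w xA.
rewrite -(real_normK (num_real x)) -(real_normK (num_real (disc w x))) d1.
have [x1|x1] := leP `|x| 1.
  have h : `|x| ^+ 2 - (9 / 20) ^+ 2 <= min32 x; last by lra from h w0.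
  have w3 : `|x| ^+ 2 - (9 / 20) ^+ 2 <= `|x| ^+ 3.
    have : 0 <= (`|x| - 7 / 10) ^+ 2 * (`|x| + 2 / 5).
      by rewrite mulr_ge0 ?sqr_ge0 //; lra from xA.
    have -> : (`|x| - 7 / 10) ^+ 2 * (`|x| + 2 / 5) = `|x| ^+ 3 - `|x| ^+ 2 - 7 / 100 * `|x| + 49 / 250.
      by field.
    lra from xA.
  by apply: min32_ge => //; rewrite -(real_normK (num_real x)); lra.
have : min32 x = `|x| ^+ 2.
  rewrite /min32 -(real_normK (num_real x)); apply: min_r.
  have -> : `|x| ^+ 3 = `|x| * `|x| ^+ 2 by ring.
  by rewrite -{1}[_ ^+ 2]mul1r; apply: ler_wpM2r; [exact: sqr_ge0|exact: ltW].
by move=> ->; move: (sqr_ge0 (9 / 20 : R)) (ltW w0); clear; lra.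
Qed.

Lemma min32_at_big (R : realFieldType) (x : R) : 33 / 50 < `|x| -> 287 / 1000 <= min32 x.
Proof.
move=> xA; have -> : 287 / 1000 = 287 / 1000 + 0 * `|x| :> R by ring.
apply: min32_big => // a a1; last by move=> *; nra.
have -> : a ^+ 3 = a * (a * a) by ring.
move=> a2; have a0 : 0 <= 33 / 50 :> R by lra.
have := ler_pM a0 (mulr_ge0 a0 a0) a1 (ler_pM a0 a0 a1 a1); lra.
Qed.

Lemma disc_pow3 (R : archiRealFieldType) (w x : R) : 0 < w ->
 `|disc w x| ^+ 3 <= min32 x.
Proof.
move=> w0.
have yx := disc_le_abs x w0; have yA := disc_le x w0.
apply: min32_ge; first by apply: lerXn2r; rewrite ?nnegrE.
apply: le_trans (disc_sqr x w0).1; rewrite -(real_normK (num_real (disc w x))).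
have -> : `|disc w x| ^+ 3 = `|disc w x| * `|disc w x| ^+ 2 by ring.
rewrite -[leRHS]mul1r; apply: ler_wpM2r; first exact: sqr_ge0.
lra from yA.
Qed.

Lemma disc_pow4 (R : archiRealFieldType) (w x : R) : 0 < w ->
  disc w x ^+ 4 <= 33 / 50 * min32 x.
Proof.
move=> w0.
have -> : disc w x ^+ 4 = `|disc w x| * `|disc w x| ^+ 3.
  by rewrite -(exprS) -normrX ger0_norm // exprn_even_ge0.
by apply: ler_pM => //; [exact: exprn_ge0|exact: disc_le|exact: disc_pow3].
Qed.

(** Below the cut, [327 / 50 * (33 / 50) < 9 / 2]; above it, [1 + 327 / 50 * (9 / 20) ^+ 4] is less
    than 9/2 of 287/1000, a lower bound for [min32] there. A higher cut would worsen the first case,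
    a lower cut the second. *)
Lemma disc_budget (R : archiRealFieldType) (w x : R) : 0 < w ->
  (33 / 50 < `|x|)%R%:R + 327 / 50 * disc w x ^+ 4 <= 9 / 2 * min32 x.
Proof.
move=> w0.
have p4 := disc_pow4 x w0; have m0 := min32_ge0 x.
have [xA|xA] := ltP (33 / 50) `|x|; last by rewrite /=; lra from p4 m0.
have big := min32_at_big xA.
have [d1 _] := disc_big w xA.
have -> : disc w x ^+ 4 = (9 / 20) ^+ 4 by rewrite -d1 -normrX ger0_norm // exprn_even_ge0.
by rewrite /=; lra from big.
Qed.


Lemma pow4_shift (R : realFieldType) (y m : R) :
  (y - m) ^+ 4 <= y ^+ 4 + 4 * `|m| * `|y| ^+ 3 + 8 * m ^+ 2 * y ^+ 2 + 3 * m ^+ 4.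
Proof.
have E : - (m * y ^+ 3) <= `|m| * `|y| ^+ 3.
  by rewrite -normrX -normrM; apply: le_trans (ler_norm _) _; rewrite normrN.
have q : 0 <= (m * (y + m)) ^+ 2 by exact: sqr_ge0.
have -> : (y - m) ^+ 4 = y ^+ 4 + 4 * - (m * y ^+ 3) + 6 * m ^+ 2 * y ^+ 2 - 4 * m ^+ 3 * y + m ^+ 4.
  by ring.
have -> : (4 * m ^+ 3 * y) = 2 * (m * (y + m)) ^+ 2 - 2 * m ^+ 2 * y ^+ 2 - 2 * m ^+ 4 by ring.
lra from E q.
Qed.

(** No largeness of [N] is assumed. From [s * N * th ^+ 2 = 1] and [N * lam <= th] follows
    [lam <= s * th ^+ 3], less than [s / 100]; together with the tangent bound from below this
    forces [s] under [1 / 10000] and [N] above [100 * 1000]. In the last bound 9/2 comes from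
    [disc_budget], and most of the remaining 1/5 goes to the deficit, where [del] is about [lam]. *)
Lemma constants_ok (R : realFieldType) (N th s lam w m p4 pb K4 M2 del eta : R) :
  1 <= N -> 0 < th -> th <= 10 / 47 -> 0 < s -> s * N * th ^+ 2 = 1 -> 0 <= lam -> N * lam <= th ->
  3 / 200 * s - (1 / 100) ^+ 3 / 2 <= lam -> 0 < w -> w <= s / 1000 / 1000 -> N * w <= 1 / 1000 ->
  N * w * 100 <= eta ->
  `|m| <= w + 37 / 50 * lam -> K4 <= p4 + 4 * `|m| * lam + 8 * m ^+ 2 * s + 3 * m ^+ 4 ->
  0 <= p4 -> p4 <= 33 / 50 * lam -> pb + 327 / 50 * p4 <= 9 / 2 * lam ->
  del = s - M2 -> 0 <= del -> del <= 2 * w + lam + m ^+ 2 -> M2 ^+ 2 <= K4 ->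
  [/\ s <= 1 / 10000, K4 <= 13 / 2000 * s, del <= s / 100, s ^+ 2 <= 11 / 10 * K4 &
   [/\ `|m| <= 1 / 150, N * `|m| <= 4 / 25, N + 2 + s^-1 <= 523 / 500 * N &
    N * pb + (25 / 4 * K4 + 18 * (del ^+ 2 / s)) * (523 / 500 * N) + cL R * s ^+ 2
    <= 47 / 10 * (N * lam) + eta / 2]].
Proof.
move=> N1 th0 th1 s0 sN l0 Nl ls w0 ws Nw eN ma Km p40 p4l pb4 dE d0 dm MK.
have th2 : th ^+ 2 <= 100 / 2209.
  have -> : 100 / 2209 = (10 / 47) ^+ 2 :> R by field.
  by apply: lerXn2r => //; rewrite nnegrE; lra from th0.
have th3 : th ^+ 3 <= 97 / 100 / 100.
  have := ler_pM (ltW th0) (sqr_ge0 th) th1 th2; rewrite -exprS; lra.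
have ll : lam <= 97 / 100 / 100 * s.
  have : lam = s * th ^+ 2 * (N * lam) by rewrite -[LHS]mul1r -sN; ring.
  have : s * th ^+ 2 * (N * lam) <= s * th ^+ 2 * th.
    by apply: ler_wpM2l => //; rewrite mulr_ge0 ?sqr_ge0 // ltW.
  have -> : s * th ^+ 2 * th = s * th ^+ 3 by ring.
  have := ler_wpM2l (ltW s0) th3; lra.
have s4 : s <= 1 / 100 / 100 by lra from ls ll.
have w10 : w <= 1 / 100 / 100 / 1000 / 1000 by lra from ws s4.
set a := `|m| in ma Km *; have a0 : 0 <= a by exact: normr_ge0.
have m2 : m ^+ 2 = a ^+ 2 by rewrite real_normK ?num_real.
have m4 : m ^+ 4 = a ^+ 2 * a ^+ 2 by rewrite -m2 sqr4.
rewrite m4 m2 in Km; rewrite m2 in dm.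
have as' : a <= 72 / 100 / 100 * s by lra from ma ll ws s0.
have a6 : a <= 1 / 1000 / 1000 by lra from as' s4.
have aa1 : a ^+ 2 <= 1 / 1000 / 1000 * a by rewrite expr2; exact: ler_wpM2r.
have aa2 : a ^+ 2 <= 1 / 1000 / 1000 * (w + lam) by lra from aa1 ma l0 w0.
have aa3 : a ^+ 2 <= 1 / 1000 / 100 * s by lra from aa1 as' s0.
have aa0 := sqr_ge0 a.
have k1 : a * lam <= 1 / 1000 / 1000 * lam by exact: ler_wpM2r.
have k2 : a ^+ 2 * s <= a ^+ 2 * (1 / 100 / 100) by exact: ler_wpM2l.
have k3 : a ^+ 2 * a ^+ 2 <= a ^+ 2 * 1 by apply: ler_wpM2l => //; lra from aa1 a6.
have KK : K4 <= p4 + 1 / 100 / 1000 * (lam + w) by lra from Km k1 k2 k3 aa2 l0 w0.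
have ds : del <= 972 / 1000 / 100 * s by lra from dm ll ws aa3 s0.
have dl : del <= 101 / 100 * lam + 3 * w by lra from dm aa2 l0 w0.
have d2 : del ^+ 2 / s <= 972 / 1000 / 100 * (101 / 100 * lam + 3 * w).
  rewrite ler_pdivrMr // expr2; have := ler_pM d0 d0 ds dl; clear; lra.
have sK : s ^+ 2 <= 11 / 10 * K4.
  have q : 99 / 100 * s <= M2 by lra from dE ds s0.
  have q0 : 0 <= 99 / 100 * s by lra from s0.
  have := ler_pM q0 q0 q q; rewrite -(expr2 M2); have := sqr_ge0 s; lra from MK.
have is1 : s^-1 = N * th ^+ 2.
  by apply: (mulfI (lt0r_neq0 s0)); rewrite divff ?lt0r_neq0 // mulrA sN.
have N0 : 0 < N by lra from N1.
have N5 : 100 * 1000 <= N.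
  have q : s * th ^+ 2 <= 1 / 100 / 100 * (100 / 2209).
    by apply: ler_pM => //; [exact: ltW|exact: sqr_ge0].
  have := ler_wpM2l (ltW N0) q; have -> : N * (s * th ^+ 2) = 1 by rewrite -sN; ring.
  by clear; lra.
have nc : N + 2 + s^-1 <= 523 / 500 * N.
  by rewrite is1; have := ler_wpM2l (ltW N0) th2; lra from N5.
split; [lra from s4|lra from KK p4l ll ws s0|lra from ds s0|exact: sK|split].
- by lra from a6.
- by have := ler_wpM2l (ltW N0) ma; lra from Nw Nl th1.
- exact: nc.
(* The factor 523/500 bounds [n1c] relative to [N], and [25 / 4 * (523 / 500)] is just below the
   coefficient 327/50 of [disc_budget]. *)
have e1 : (25 / 4 * K4 + 18 * (del ^+ 2 / s)) * (523 / 500 * N) <=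
   (25 / 4 * (p4 + 1 / 100 / 1000 * (lam + w)) + 18 * (972 / 1000 / 100 * (101 / 100 * lam + 3 * w)))
    * (523 / 500 * N).
  by apply: ler_wpM2r; [lra from N0|lra from KK d2].
have e2 := ler_wpM2l (ltW N0) pb4.
have e3 : lam + w <= N * (lam + w) / 1000.
  by have := ler_wpM2r (addr_ge0 l0 (ltW w0)) N5; lra from l0 w0.
have e4 : 0 <= N * p4 by rewrite mulr_ge0 // ltW.
have e5 : 0 <= N * lam by rewrite mulr_ge0 // ltW.
have e6 : 0 <= N * w by rewrite mulr_ge0 // ltW.
have e7 : cL R * s ^+ 2 <= 2 * (lam + w).
  by rewrite /cL; lra from sK KK p4l l0 w0.
lra from e1 e2 e3 e4 e5 e6 e7 eN.
Qed.

From mathcomp Require Import finmap.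
From mathcomp Require Import all_classical all_reals all_analysis measurable_realfun.
Require Import Defs.
Import Order.TTheory GRing.Theory Num.Theory.
Import numFieldNormedType.Exports.

Local Open Scope classical_set_scope.
Local Open Scope ring_scope.

(** * Finite laws and independence *)

(** The expectation over [k] further independent draws, as an iterated finite sum; it serves the
    rounded walk and the host alike and avoids product spaces. *)
Fixpoint exl (R : realFieldType) (law : seq (R * R)) (k : nat) (F : seq R -> R) (pre : seq R) : R :=
  if k is k'.+1 then meanf law (fun b => exl law k' F (rcons pre b)) else F pre.

Lemma ler_meanf (R : realFieldType) (law : seq (R * R)) (phi psi : R -> R) :
  (forall a, a \in law -> 0 <= a.1) -> (forall b, phi b <= psi b) -> meanf law phi <= meanf law psi.
Proof.
move=> p0 H; rewrite /meanf big_seq [leRHS]big_seq; apply: ler_sum => a al.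
by apply: ler_wpM2l; [exact: p0|exact: H].
Qed.

Lemma meanf_cst (R : realFieldType) (law : seq (R * R)) (c : R) :
  meanf law (fun=> c) = meanf law (fun=> 1) * c.
Proof. by rewrite /meanf mulr_suml; apply: eq_bigr => a _; rewrite mulr1. Qed.

Lemma exl_ge0 (R : realFieldType) (law : seq (R * R)) k F pre :
  (forall a, a \in law -> 0 <= a.1) -> (forall xs, 0 <= F xs) -> 0 <= exl law k F pre.
Proof.
move=> p0 F0; elim: k pre => [|k IH] pre //=.
by rewrite /meanf big_seq; apply: sumr_ge0 => a al; rewrite mulr_ge0 // p0.
Qed.

Lemma exl_le (R : realFieldType) (law : seq (R * R)) k F G pre :
  (forall a, a \in law -> 0 <= a.1) -> (forall xs, F xs <= G xs) ->
  exl law k F pre <= exl law k G pre.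
Proof. by move=> p0 FG; elim: k pre => [|k IH] pre //=; apply: ler_meanf. Qed.

Lemma exl_cst (R : realFieldType) (law : seq (R * R)) k F (c : R) pre :
  meanf law (fun=> 1) = 1 -> (forall ext, size ext = k -> F (pre ++ ext) = c) ->
  exl law k F pre = c.
Proof.
move=> p1; elim: k pre => [|k IH] pre H /=; first by have := H [::] erefl; rewrite cats0.
rewrite -[RHS]mul1r -p1 -meanf_cst; apply: eq_bigr => a _; congr (_ * _); apply: IH => ext sz.
by rewrite cat_rcons; apply: H => /=; rewrite sz.
Qed.

Lemma exl_le1 (R : realFieldType) (law : seq (R * R)) k F pre :
  (forall a, a \in law -> 0 <= a.1) -> meanf law (fun=> 1) = 1 -> (forall xs, F xs <= 1) ->
  exl law k F pre <= 1.
Proof.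
move=> p0 p1 F1; apply: le_trans (exl_le k pre p0 (F1 : forall xs, F xs <= (fun=> 1) xs)) _.
by rewrite (exl_cst (c := 1)).
Qed.

Lemma exlD (R : realFieldType) (law : seq (R * R)) k F G pre :
  exl law k (fun xs => F xs + G xs) pre = exl law k F pre + exl law k G pre.
Proof.
elim: k pre => [//|k IH] pre /=; rewrite /meanf -big_split; apply: eq_bigr => a _ /=.
by rewrite IH mulrDr.
Qed.

Section Mass.
Context (R : realType) (d : measure_display) (T : measurableType d) (P : probability T R).

Definition mass (A : set T) : R := fine (P A).

Lemma massE A : measurable A -> (mass A)%:E = P A.
Proof. by move=> mA; rewrite /mass fineK // fin_num_measure. Qed.

Lemma mass_ge0 A : 0 <= mass A.
Proof. exact: fine_ge0. Qed.

Lemma le_mass A B : measurable A -> measurable B -> A `<=` B -> mass A <= mass B.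
Proof. by move=> mA mB AB; rewrite -lee_fin !massE // le_measure ?inE. Qed.

Lemma massT : mass setT = 1.
Proof. by rewrite /mass probability_setT. Qed.

Lemma massU_le A B : measurable A -> measurable B -> mass (A `|` B) <= mass A + mass B.
Proof.
move=> mA mB; rewrite -lee_fin EFinD !massE //; last exact: measurableU.
exact: measureU2.
Qed.

Lemma mass_bigU_le (I : eqType) (s : seq I) (A : set T) (F : I -> set T) : measurable A ->
  (forall i, measurable (F i)) -> A `<=` [set w | exists2 i, i \in s & F i w] ->
  mass A <= \sum_(i <- s) mass (F i).
Proof.
move=> mA mF; elim: s A mA => [|i s IH] A mA AF.
  rewrite big_nil; have -> : A = set0 by rewrite -subset0 => w /AF [].
  by rewrite /mass measure0.
rewrite big_cons.
have : A = (A `&` F i) `|` (A `&` ~` F i) by rewrite -setIUr setUv setIT.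
move=> ->; apply: le_trans (massU_le _ _) _.
- exact: measurableI.
- by apply: measurableI => //; exact: measurableC.
apply: lerD; first by apply: le_mass => //; exact: measurableI.
apply: IH; first by apply: measurableI => //; exact: measurableC.
move=> w [/AF [j]]; rewrite in_cons => /predU1P[->//|js Fj] _; by exists j.
Qed.

Lemma mass_le (A : set T) : measurable A -> mass A <= 1.
Proof. by move=> mA; rewrite -massT; exact: le_mass. Qed.

Variables (b : nat -> T -> R) (n : nat) (rd : R -> R) (vs : seq R) (G : set T) (I : seq R -> R).
Hypothesis bm : forall i, measurable_fun setT (b i).
Hypothesis bind : independent_RVs P b.
Hypothesis bid : forall i A, (i < n)%N -> measurable A -> P (b i @^-1` A) = P (b 0%N @^-1` A).
Hypothesis rdm : measurable_fun setT rd.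
Hypothesis rdv : forall x, rd x \in vs.
Hypothesis Gm : measurable G.
Hypothesis I0 : forall ys, 0 <= I ys.
Hypothesis IG : forall w, G w -> 1 <= I (mkseq (fun i => rd (b i w)) n).

Definition cyl (ys : seq R) : set T := [set w | mkseq (fun i => rd (b i w)) (size ys) = ys].
Definition rlaw : seq (R * R) := [seq (mass [set w | rd (b 0%N w) = v], v) | v <- vs].

Lemma fibre_measurable i v : measurable [set w | rd (b i w) = v].
Proof.
have := measurableT_comp rdm (bm i); move=> /(_ measurableT [set v]).
by rewrite setTI; apply; exact: measurable_set1.
Qed.

Lemma cyl_rcons ys v : cyl (rcons ys v) = cyl ys `&` [set w | rd (b (size ys) w) = v].
Proof.
rewrite /cyl; apply/seteqP; split => w /=; rewrite size_rcons mkseqS.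
  by move=> /rcons_inj [-> ->].
by move=> [-> ->].
Qed.

Lemma cyl_measurable ys : measurable (cyl ys).
Proof.
elim/last_ind: ys => [|ys v IH]; last first.
  by rewrite cyl_rcons; apply: measurableI => //; exact: fibre_measurable.
by have -> : cyl [::] = setT by apply/seteqP; split.
Qed.

Lemma mass_cyl ys : mass (cyl ys) = \prod_(i <- iota 0 (size ys)) mass [set w | rd (b i w) = ys`_i].
Proof.
have := @bind [fset i in iota 0 (size ys)]%fset (fun i => [set x | rd x = ys`_i]).
have rm v : measurable [set x | rd x = v].
  have := rdm measurableT (measurable_set1 v); by rewrite setTI.
move=> /(_ (fun i => rm _)).
have -> : \bigcap_(i in [set` [fset i in iota 0 (size ys)]%fset]) b i @^-1` [set x | rd x = ys`_i]
  = cyl ys.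
  rewrite /cyl; apply/seteqP; split => w /= H.
    apply: (@eq_from_nth _ 0); rewrite size_mkseq // => i iy.
    by rewrite nth_mkseq //; apply: (H i); rewrite /= !inE mem_iota.
  move=> i /=; rewrite !inE mem_iota /= => iy.
  by have := congr1 (fun s : seq R => s`_i) H; rewrite nth_mkseq.
move=> e; rewrite /mass e.
rewrite (perm_big (iota 0 (size ys))); last first.
  apply: uniq_perm; rewrite ?fset_uniq ?iota_uniq // => i.
  by rewrite !inE.
elim: (iota 0 _) => [|i s IH]; first by rewrite !big_nil.
rewrite !big_cons fineM; last first.
- rewrite -(_ : (\prod_(j <- s) mass [set w | rd (b j w) = ys`_j])%:E =
     (\prod_(j <- s) P (b j @^-1` [set x | rd x = ys`_j]))%E) //.
  rewrite -prodEFin; apply: eq_bigr => j _; rewrite massE //; exact: fibre_measurable.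
- by apply: fin_num_measure; exact: fibre_measurable.
by rewrite IH.
Qed.

Lemma mass_cyl_rcons ys v : (size ys < n)%N ->
  mass (cyl (rcons ys v)) = mass (cyl ys) * mass [set w | rd (b 0%N w) = v].
Proof.
move=> yn; rewrite !mass_cyl size_rcons -addn1 iotaD add0n big_cat big_seq1.
rewrite nth_rcons ltnn eqxx; congr (_ * _).
  rewrite big_seq [RHS]big_seq; apply: eq_bigr => i; rewrite mem_iota /= => iy.
  by rewrite nth_rcons iy.
rewrite /mass; congr fine; apply: (@bid _ [set x | rd x = v] yn).
by have := rdm measurableT (measurable_set1 v); rewrite setTI.
Qed.

(** Independence replaces conditioning: a cylinder is split by the rounded value of the next
    increment, and the masses multiply. At full length, a cylinder that meets [G] has [I] at least 1
    on its list of values. *)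
Lemma cyl_bound k ys : (size ys + k)%N = n ->
  mass (cyl ys `&` G) <= mass (cyl ys) * exl rlaw k I ys.
Proof.
elim: k ys => [|k IH] ys.
  rewrite addn0 => yn /=; have [->|/set0P[w [wy wG]]] := eqVneq (cyl ys `&` G) set0.
    by rewrite /mass measure0 mulr_ge0 // mass_ge0.
  have := IG wG; rewrite -yn wy => I1.
  apply: (@le_trans _ _ (mass (cyl ys) * 1)); last by apply: ler_wpM2l => //; exact: mass_ge0.
  rewrite mulr1; apply: le_mass => //; [exact: measurableI (cyl_measurable _) Gm|].
  exact: cyl_measurable.
move=> yn; rewrite /= /meanf /rlaw big_map mulr_sumr /=.
apply: le_trans (@mass_bigU_le _ vs _ (fun v => cyl (rcons ys v) `&` G) _ _ _) _.
- exact: measurableI (cyl_measurable _) Gm.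
- by move=> v; exact: measurableI (cyl_measurable _) Gm.
- move=> w [wy wG]; exists (rd (b (size ys) w)); first exact: rdv.
  by split => //; rewrite cyl_rcons.
apply: ler_sum => v _; apply: le_trans (IH _ _) _; first by rewrite size_rcons addSnnS.
by rewrite mass_cyl_rcons ?mulrA // -yn -addSnnS leq_addr.
Qed.

Lemma law_bound : mass G <= exl rlaw n I [::].
Proof.
have := @cyl_bound n [::] (add0n n).
have -> : cyl [::] = setT by apply/seteqP; split.
by rewrite setTI massT mul1r.
Qed.

Hypothesis vsu : uniq vs.

Lemma rlaw_mean (phi : R -> R) :
  P.-integrable setT (EFin \o (fun w => phi (rd (b 0%N w)))) /\
  meanf rlaw phi = Rintegral P setT (fun w => phi (rd (b 0%N w))).
Proof.
pose S (s : seq R) w := \sum_(v <- s) phi v * \1_[set w | rd (b 0%N w) = v] w.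
have H s : P.-integrable setT (EFin \o S s) /\
  \sum_(v <- s) mass [set w | rd (b 0%N w) = v] * phi v = Rintegral P setT (S s).
  elim: s => [|v s [IH1 IH2]].
    rewrite big_nil; have -> : S [::] = cst 0 by apply/funext => w; rewrite /S big_nil.
    by rewrite Rintegral_cst // mul0r; split => //; exact: finite_measure_integrable_cst.
  have -> : S (v :: s) = (fun w => phi v * \1_[set w | rd (b 0%N w) = v] w + S s w).
    by apply/funext => w; rewrite /S big_cons.
  have i1 : P.-integrable setT (EFin \o (\1_[set w | rd (b 0%N w) = v] : T -> R)).
    by apply: integrable_indic => //; exact: fibre_measurable.
  have i2 : P.-integrable setT (EFin \o (fun w => phi v * \1_[set w | rd (b 0%N w) = v] w)).
    exact: (integrableZl measurableT (phi v) i1).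
  split; first exact: (integrableD measurableT i2 IH1).
  rewrite big_cons RintegralD // RintegralZl // IH2; congr (_ + _).
  rewrite mulrC; congr (_ * _); rewrite /mass /Rintegral; congr fine.
  by rewrite integral_indic ?setIT //; exact: fibre_measurable.
have E : (fun w => phi (rd (b 0%N w))) = S vs.
  apply/funext => w; rewrite /S (bigD1_seq (rd (b 0%N w))) //=.
  rewrite indicE mem_set // mulr1 big1 ?addr0 // => v vne.
  by rewrite indicE memNset ?mulr0 //= => e; move: vne; rewrite e eqxx.
rewrite E; have [h1 h2] := H vs; split => //.
by rewrite -h2 /meanf /rlaw big_map.
Qed.

End Mass.

Lemma Rintegral_comb (R : realType) (d : measure_display) (T : measurableType d)
  (P : probability T R) (c1 c2 c3 c4 : R) (f1 f2 f3 f4 : T -> R) :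
  P.-integrable setT (EFin \o f1) -> P.-integrable setT (EFin \o f2) ->
  P.-integrable setT (EFin \o f3) -> P.-integrable setT (EFin \o f4) ->
  P.-integrable setT (EFin \o (fun w => c1 * f1 w + c2 * f2 w + c3 * f3 w + c4 * f4 w)) /\
  Rintegral P setT (fun w => c1 * f1 w + c2 * f2 w + c3 * f3 w + c4 * f4 w)
  = c1 * Rintegral P setT f1 + c2 * Rintegral P setT f2 + c3 * Rintegral P setT f3
    + c4 * Rintegral P setT f4.
Proof.
move=> i1 i2 i3 i4.
have z (f : T -> R) (c : R) : P.-integrable setT (EFin \o f) ->
    P.-integrable setT (EFin \o (fun w => c * f w)).
  by move=> i; exact: (integrableZl measurableT c i).
have a (f g : T -> R) : P.-integrable setT (EFin \o f) -> P.-integrable setT (EFin \o g) ->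
    P.-integrable setT (EFin \o (fun w => f w + g w)).
  by move=> i j; exact: (integrableD measurableT i j).
have j1 := z _ c1 i1; have j2 := z _ c2 i2; have j3 := z _ c3 i3; have j4 := z _ c4 i4.
have k2 := a _ _ j1 j2; have k3 := a _ _ k2 j3; have k4 := a _ _ k3 j4.
split => //.
by rewrite (RintegralD _ k3 j4) // (RintegralD _ k2 j3) // (RintegralD _ j1 j2) // !RintegralZl.
Qed.

Lemma integrable_bounded (R : realType) (d : measure_display) (T : measurableType d)
  (P : probability T R) (f g : T -> R) : measurable_fun setT f ->
  (forall w, `|f w| <= g w) -> P.-integrable setT (EFin \o g) -> P.-integrable setT (EFin \o f).
Proof.
move=> mf fg ig; apply: (le_integrable measurableT _ _ ig); first exact/measurable_EFinP.
move=> w _ /=; rewrite lee_fin; apply: le_trans (fg w) _; exact: ler_norm.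
Qed.

Lemma integrable_cst1 (R : realType) (d : measure_display) (T : measurableType d)
  (P : probability T R) : P.-integrable setT (EFin \o (fun _ : T => 1 : R)).
Proof. exact: finite_measure_integrable_cst. Qed.

Lemma Rintegral_cst1 (R : realType) (d : measure_display) (T : measurableType d)
  (P : probability T R) : Rintegral P setT (fun _ : T => 1 : R) = 1.
Proof. by rewrite Rintegral_cst // mul1r; exact: massT. Qed.

Lemma disc_measurable (R : realType) (w : R) : 0 < w -> measurable_fun setT (disc w).
Proof.
move=> w0; rewrite /disc; apply: measurable_funM.
  apply: nondecreasing_measurable => // x y xy.
  have [x0|x0|x0] := ltgtP x 0.
  - by rewrite (ltr0_sg x0); case: (sgrP y) => _; lra.
  - by rewrite (gtr0_sg x0) (gtr0_sg (lt_le_trans x0 xy)).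
  - by rewrite x0 sgr0 sgr_ge0 -x0.
apply: measurable_fun_ifT.
- by apply: measurable_fun_ler => //; exact: measurableT_comp.
- apply: measurable_funM => //.
  have m1 : measurable_fun setT (fun x : R => (Num.truncn x)%:R : R).
    by apply: nondecreasing_measurable => // x y xy; rewrite ler_nat le_truncn.
  have m2 : measurable_fun setT (fun x : R => `|x| / w).
    by apply: measurable_funM => //; exact: measurableT_comp.
  exact: (measurableT_comp m1 m2).
- by [].
Qed.

Lemma min32_measurable (R : realType) : measurable_fun setT (@min32 R).
Proof.
apply: measurable_minr.
  by apply: measurable_funX; exact: normr_measurable.
exact: measurable_funX.
Qed.

Definition disc_values (R : realType) (w : R) : seq R :=
  [seq a * c | a <- [:: -1; 0; 1],
     c <- 9 / 20 :: [seq w * j%:R | j <- iota 0 (Num.truncn (33 / 50 / w)).+1]].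

Lemma disc_in_values (R : realType) (w x : R) : 0 < w -> disc w x \in disc_values w.
Proof.
move=> w0; rewrite /disc; set c := if _ then _ else _.
have cL : c \in 9 / 20 :: [seq w * j%:R | j <- iota 0 (Num.truncn (33 / 50 / w)).+1].
  rewrite /c; case: ifP => xA; last by rewrite mem_head.
  rewrite in_cons; apply/orP; right; apply: (map_f (fun j : nat => w * j%:R)).
  by rewrite mem_iota /= add0n ltnS; apply: le_truncn; rewrite ler_pM2r ?invr_gt0.
have sL : Num.sg x \in [:: -1; 0; 1 : R] by case: (sgrP x) => _; rewrite !inE eqxx ?orbT.
by apply/allpairsP; exists (Num.sg x, c).
Qed.

Lemma positive_lower_bound (R : realType) (s : seq R) :
  exists2 c : R, 0 < c & forall v, v \in s -> v != 0 -> c <= `|v|.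
Proof.
elim: s => [|a s [c c0 H]]; first by exists 1.
exists (if a == 0 then c else Num.min c `|a|).
  by case: eqVneq => // a0; rewrite lt_min c0 normr_gt0.
move=> v; rewrite in_cons => /predU1P[->|vs] v0.
  by rewrite (negbTE v0) ge_min lexx orbT.
case: ifP => _; first exact: H.
by rewrite ge_min H.
Qed.

Definition coin (R : realType) : seq (R * R) := [:: (1 / 2, 1); (1 / 2, -1)].

Lemma meanf_coin (R : realType) (phi : R -> R) : meanf (coin R) phi = (phi 1 + phi (-1)) / 2.
Proof. by rewrite /meanf !big_cons big_nil /=; field. Qed.

Lemma coin1 (R : realType) : meanf (coin R) (fun=> 1) = 1.
Proof. by rewrite meanf_coin; lra. Qed.

Lemma coin_ge0 (R : realType) a : a \in coin R -> 0 <= a.1.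
Proof. by rewrite !inE => /orP[] /eqP -> /=; lra. Qed.

(* [eps] is a path of the host, a simple random walk with steps [+-h]; some
   outcome in [E] has partial sums following it in the time scale where one
   term takes time [s] and one host step time [h^2]. *)
Definition followed (R : realType) (T : Type) (b : nat -> T -> R) (n : nat) (s h tol : R)
    (E : set T) (eps : seq R) : Prop :=
  exists2 w, E w & forall k i, (k <= n)%N -> (i <= size eps)%N -> i%:R * h ^+ 2 <= n%:R * s ->
    `|i%:R * h ^+ 2 - k%:R * s| <= 2 * s ->
    `|\sum_(j < k) b j w - h * psum i eps| < tol.

(** * Moments of the truncated, rounded and recentred law *)

Section Moments.
Context (R : realType) (d : measure_display) (T : measurableType d) (P : probability T R).
Variables (b : nat -> T -> R) (w : R) (s lam : R).
Hypothesis bm : forall i, measurable_fun setT (b i).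
Hypothesis w0 : 0 < w.
Hypothesis ib : P.-integrable setT (EFin \o b 0%N).
Hypothesis ib2 : P.-integrable setT (EFin \o (fun x => b 0%N x ^+ 2)).
Hypothesis Eb : Rintegral P setT (b 0%N) = 0.
Hypothesis Eb2 : Rintegral P setT (fun x => b 0%N x ^+ 2) = s.
Hypothesis lamE : Rintegral P setT (fun x => min32 (b 0%N x)) = lam.

Definition drift : R := Rintegral P setT (fun x => disc w (b 0%N x)).
(** Rounding spoils the centring on which the mixture of two-point laws rests; subtracting the mean
    restores it. *)
Definition rnd (x : R) : R := disc w x - drift.
Definition vals : seq R := undup [seq v - drift | v <- disc_values w].
Definition dlaw : seq (R * R) := rlaw P b rnd vals.
Definition dp4 : R := Rintegral P setT (fun x => disc w (b 0%N x) ^+ 4).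
Definition bigset (i : nat) : set T := [set x | 33 / 50 < `|b i x| ].

Lemma rnd_vals x : rnd x \in vals.
Proof. by rewrite mem_undup; apply: (map_f (fun v => v - drift)); exact: disc_in_values. Qed.

Lemma rnd_measurable : measurable_fun setT rnd.
Proof. by apply: measurable_funB => //; exact: disc_measurable. Qed.

Lemma dlaw_mean (phi : R -> R) :
  P.-integrable setT (EFin \o (fun x => phi (rnd (b 0%N x)))) /\
  meanf dlaw phi = Rintegral P setT (fun x => phi (rnd (b 0%N x))).
Proof.
by apply: rlaw_mean => //; [exact: rnd_measurable|exact: rnd_vals|exact: undup_uniq].
Qed.

Lemma disc_int (phi : R -> R) : P.-integrable setT (EFin \o (fun x => phi (disc w (b 0%N x)))).
Proof.
have [+ _] := dlaw_mean (fun v => phi (v + drift)).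
by apply: eq_integrable => // x _ /=; rewrite /rnd subrK.
Qed.

Lemma bigset_measurable i : measurable (bigset i).
Proof.
have : measurable_fun setT (fun x => 33 / 50 < `|b i x|).
  apply: measurable_fun_ltr => //; exact: measurableT_comp.
by move=> /(_ measurableT [set true]); rewrite setTI; apply.
Qed.

Lemma min32_int : P.-integrable setT (EFin \o (fun x => min32 (b 0%N x))).
Proof.
apply: integrable_bounded ib2; first exact: measurableT_comp (@min32_measurable R) (bm 0).
by move=> x; rewrite ger0_norm ?min32_ge0 // min32_le_sqr.
Qed.

Lemma dlaw1 : meanf dlaw (fun=> 1) = 1.
Proof. by have [_ ->] := dlaw_mean (fun=> 1); exact: Rintegral_cst1. Qed.

Lemma dlaw_id : meanf dlaw id = 0.
Proof.
have [_ ->] := dlaw_mean id.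
by rewrite RintegralB ?(disc_int id) ?Rintegral_cst //; [rewrite (massT P : fine (P setT) = 1) mulr1 subrr|
  exact: finite_measure_integrable_cst].
Qed.

Lemma dlaw_ge0 a : a \in dlaw -> 0 <= a.1.
Proof. by move=> /mapP[v _ ->] /=; exact: mass_ge0. Qed.

(** As the increment has mean 0, the drift is the mean of the rounding error, which [disc_dist]
    charges to [w] and [min32]. *)
Lemma drift_le : `|drift| <= w + 37 / 50 * lam.
Proof.
have i1 := integrable_cst1 P; have im := min32_int.
have [j E] := @Rintegral_comb _ _ _ P 1 w (37 / 50) 0 _ _ _ _ ib i1 im i1.
have [j' E'] := @Rintegral_comb _ _ _ P 1 (- w) (- (37 / 50)) 0 _ _ _ _ ib i1 im i1.
rewrite Eb Rintegral_cst1 lamE in E E'.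
have id := disc_int id.
have D x : - (w + 37 / 50 * min32 (b 0%N x)) <= b 0%N x - disc w (b 0%N x)
   <= w + 37 / 50 * min32 (b 0%N x) by rewrite -ler_norml; exact: disc_dist.
rewrite ler_norml; apply/andP; split.
  have := le_Rintegral measurableT j' id; rewrite E' -/drift => H.
  have : 1 * 0 + - w * 1 + - (37 / 50) * lam + 0 * 1 <= drift; last by lra.
  by apply: H => x _ /=; have /andP[a1 a2] := D x; lra.
have := le_Rintegral measurableT id j; rewrite E -/drift => H.
have : drift <= 1 * 0 + w * 1 + 37 / 50 * lam + 0 * 1; last by lra.
by apply: H => x _ /=; have /andP[a1 a2] := D x; lra.
Qed.

Lemma mom2E : mom2 dlaw = Rintegral P setT (fun x => disc w (b 0%N x) ^+ 2) - drift ^+ 2.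
Proof.
rewrite /mom2; have [_ ->] := dlaw_mean (fun v => v ^+ 2).
have i1 := integrable_cst1 P.
have [_ E] := @Rintegral_comb _ _ _ P 1 (- (2 * drift)) (drift ^+ 2) 0 _ _ _ _
  (disc_int (fun v => v ^+ 2)) (disc_int id) i1 i1.
transitivity (Rintegral P setT (fun x => 1 * disc w (b 0%N x) ^+ 2 +
  - (2 * drift) * disc w (b 0%N x) + drift ^+ 2 * 1 + 0 * 1)).
  by apply: eq_Rintegral => x _; rewrite /rnd; ring.
rewrite E Rintegral_cst1 -/drift; ring.
Qed.

Lemma mom2_le : mom2 dlaw <= s.
Proof.
rewrite mom2E; have := le_Rintegral measurableT (disc_int (fun v => v ^+ 2)) ib2.
rewrite Eb2 => H; have := H (fun x _ => (disc_sqr (b 0%N x) w0).1).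
by have := sqr_ge0 drift; lra.
Qed.

Lemma mom2_ge : s - mom2 dlaw <= 2 * w + lam + drift ^+ 2.
Proof.
rewrite mom2E; have i1 := integrable_cst1 P; have im := min32_int.
have [j E] := @Rintegral_comb _ _ _ P 1 (2 * w) 1 0 _ _ _ _ (disc_int (fun v => v ^+ 2)) i1 im i1.
rewrite Rintegral_cst1 lamE in E.
have := le_Rintegral measurableT ib2 j; rewrite E Eb2 => H.
set I2 := Rintegral P setT _ in H *.
have : s <= 1 * I2 + 2 * w * 1 + 1 * lam + 0 * 1; last by lra.
by apply: H => x _; have [_ a] := disc_sqr (b 0%N x) w0; lra.
Qed.

Lemma mom4_le : mom4 dlaw <= dp4 + 4 * `|drift| * lam + 8 * drift ^+ 2 * s + 3 * drift ^+ 4.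
Proof.
rewrite /mom4; have [i4 ->] := dlaw_mean (fun v => v ^+ 4).
have i1 := integrable_cst1 P; have im := min32_int.
have [j E] := @Rintegral_comb _ _ _ P 1 (4 * `|drift|) (8 * drift ^+ 2) (3 * drift ^+ 4) _ _ _ _
  (disc_int (fun v => v ^+ 4)) im ib2 i1.
rewrite Rintegral_cst1 lamE Eb2 -/dp4 in E.
have -> : dp4 + 4 * `|drift| * lam + 8 * drift ^+ 2 * s + 3 * drift ^+ 4
  = 1 * dp4 + 4 * `|drift| * lam + 8 * drift ^+ 2 * s + 3 * drift ^+ 4 * 1 by ring.
rewrite -E.
apply: le_Rintegral => // x _; rewrite /rnd.
apply: le_trans (pow4_shift _ _) _; rewrite mul1r mulr1.
have p3 := ler_wpM2l (mulr_ge0 (ler0n R 4) (normr_ge0 drift)) (disc_pow3 (b 0%N x) w0).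
have q2 := ler_wpM2l (mulr_ge0 (ler0n R 8) (sqr_ge0 drift)) (disc_sqr (b 0%N x) w0).1.
move: p3 q2; rewrite lerD2r -!addrA lerD2l => p3 q2; exact: lerD.
Qed.

Lemma dp4_ge0 : 0 <= dp4.
Proof. by apply: Rintegral_ge0 => x _; rewrite exprn_even_ge0. Qed.

Lemma dp4_le : dp4 <= 33 / 50 * lam.
Proof.
rewrite -lamE -RintegralZl //; last exact: min32_int.
apply: le_Rintegral => //; first exact: (disc_int (fun v => v ^+ 4)).
  exact: (integrableZl measurableT (33 / 50) min32_int).
by move=> x _; exact: disc_pow4.
Qed.

Lemma budget_le : mass P (bigset 0) + 327 / 50 * dp4 <= 9 / 2 * lam.
Proof.
have mb := bigset_measurable 0.
have i0 : P.-integrable setT (EFin \o (\1_(bigset 0) : T -> R)) by exact: integrable_indic.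
have i1 := integrable_cst1 P.
have [j E] := @Rintegral_comb _ _ _ P 1 (327 / 50) 0 0 _ _ _ _ i0 (disc_int (fun v => v ^+ 4)) i1 i1.
have Ei : Rintegral P setT (\1_(bigset 0) : T -> R) = mass P (bigset 0).
  by rewrite /Rintegral integral_indic ?setIT.
rewrite Ei -/dp4 in E.
have -> : mass P (bigset 0) + 327 / 50 * dp4 = 1 * mass P (bigset 0) + 327 / 50 * dp4
  + 0 * Rintegral P setT (fun _ : T => 1 : R) + 0 * Rintegral P setT (fun _ : T => 1 : R) by ring.
rewrite -E.
rewrite -lamE -RintegralZl //; last exact: min32_int.
apply: le_Rintegral => //; first exact: (integrableZl measurableT (9 / 2) min32_int).
move=> x _ /=; have := disc_budget (b 0%N x) w0; rewrite indicE.
have -> : (x \in bigset 0) = (33 / 50 < `|b 0%N x|).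
  by apply/idP/idP => [/set_mem//|H]; exact/mem_set.
by lra.
Qed.

Lemma lam_ge : 3 / 200 * s - (1 / 100) ^+ 3 / 2 <= lam.
Proof.
have i1 := integrable_cst1 P.
have [j E] := @Rintegral_comb _ _ _ P (3 / 200) (- ((1 / 100) ^+ 3 / 2)) 0 0 _ _ _ _ ib2 i1 i1 i1.
rewrite Eb2 Rintegral_cst1 in E.
have := le_Rintegral measurableT j min32_int; rewrite E lamE => H.
have : 3 / 200 * s + - ((1 / 100) ^+ 3 / 2) * 1 + 0 * 1 + 0 * 1 <= lam; last by lra.
by apply: H => x _; have := min32_tangent (b 0%N x); lra.
Qed.

Lemma mom_cauchy : mom2 dlaw ^+ 2 <= mom4 dlaw.
Proof.
have : 0 <= meanf dlaw (fun v => (v ^+ 2 - mom2 dlaw) ^+ 2).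
  by rewrite /meanf big_seq; apply: sumr_ge0 => a al; rewrite mulr_ge0 ?dlaw_ge0 ?sqr_ge0.
have E (c : R) : meanf dlaw (fun v => (v ^+ 2 - c) ^+ 2)
  = mom4 dlaw - 2 * c * mom2 dlaw + c ^+ 2 * meanf dlaw (fun=> 1).
  rewrite /mom4 /mom2 /meanf !mulr_sumr -!sumrN -!big_split /=.
  by apply: eq_bigr => a _; ring.
by rewrite E dlaw1; lra.
Qed.

End Moments.

Lemma psum_mkseq (R : realFieldType) (f : nat -> R) k n : (k <= n)%N ->
  psum k (mkseq f n) = \sum_(j < k) f j.
Proof.
move=> kn; rewrite /psum /mkseq -map_take take_iota (minn_idPl kn) big_map.
by rewrite -(big_mkord xpredT f) /index_iota subn0.
Qed.

Lemma disc_values_le (R : realType) (w u : R) : 0 < w -> u \in disc_values w -> `|u| <= 33 / 50.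
Proof.
move=> w0 /allpairsP[[a c] [aL cL0 ->]]; rewrite normrM -[(a, c).1]/a -[(a, c).2]/c.
have cL : c \in 9 / 20 :: [seq w * j%:R | j <- iota 0 (Num.truncn (33 / 50 / w)).+1] by [].
have c1 : `|c| <= 33 / 50.
  move: cL; rewrite in_cons => /predU1P[->|/mapP[j]].
    by rewrite ger0_norm //; lra.
  rewrite mem_iota add0n ltnS => /= jJ ->; rewrite ger0_norm ?mulr_ge0 ?(ltW w0) //.
  rewrite mulrC -ler_pdivlMr //.
  have q : 0 <= 33 / 50 / w by apply: divr_ge0; [lra|exact: ltW].
  by have /andP[t _] := truncn_itv q; apply: le_trans t; rewrite ler_nat.
apply: le_trans c1; rewrite -[leRHS]mul1r; apply: ler_wpM2r => //.
by move: aL; rewrite !inE => /or3P[] /eqP /= ->; rewrite ?normrN ?normr1 ?normr0 ?ler01.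
Qed.

Lemma triangle_two_thirds (R : realFieldType) (u m : R) : `|u| <= 33 / 50 -> `|m| <= 1 / 150 ->
  `|u - m| <= 2 / 3.
Proof. by move=> a b; apply: le_trans (ler_normB _ _) _; lra. Qed.

Lemma tolerance_sum (R : realFieldType) (x y a b : R) : x <= a + b -> y <= 9 / 2 -> b <= 4 / 25 ->
  a <= 1 / 1000 -> x + y < 469 / 100.
Proof. by lra. Qed.

Lemma error_sum (R : realFieldType) (e g u v np k c x y l eta : R) :
  e <= g + np -> g <= u -> u <= v + c + k -> k <= x + y -> x <= eta / 2 ->
  np + y + c <= 47 / 10 * l + eta / 2 -> e <= v + 47 / 10 * l + eta.
Proof. by lra. Qed.

(** * Comparison of a scaled walk with the host *)

Section HostBound.
Context (R : realType) (d : measure_display) (T : measurableType d) (P : probability T R).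
Variables (b : nat -> T -> R) (n : nat) (s th lam : R).
Hypothesis bm : forall i, measurable_fun setT (b i).
Hypothesis bind : independent_RVs P b.
Hypothesis bid : forall i A, (i < n)%N -> measurable A -> P (b i @^-1` A) = P (b 0%N @^-1` A).
Hypothesis ib : P.-integrable setT (EFin \o b 0%N).
Hypothesis ib2 : P.-integrable setT (EFin \o (fun x => b 0%N x ^+ 2)).
Hypothesis Eb : Rintegral P setT (b 0%N) = 0.
Hypothesis Eb2 : Rintegral P setT (fun x => b 0%N x ^+ 2) = s.
Hypothesis lamE : Rintegral P setT (fun x => min32 (b 0%N x)) = lam.
Hypothesis n0 : (0 < n)%N.
Hypothesis s0 : 0 < s.
Hypothesis th0 : 0 < th.
Hypothesis th1 : th <= 10 / 47.
Hypothesis sth : s * n%:R * th ^+ 2 = 1.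
Hypothesis lamth : n%:R * lam <= th.

Definition followed_ind (h : R) (E : set T) (eps : seq R) : R :=
  (`[< followed b n s h (469 / 100) E eps >])%:R.

Lemma psum_map (h : R) k xs : psum k (map (fun x => x / h) xs) = psum k xs / h.
Proof. by rewrite /psum -map_take big_map mulr_suml. Qed.

(** On [G] no increment is cut, so partial sums differ from the rounded ones by at most
    [N * (w + |m|)], which is below 161/1000 and widens 9/2 to less than 469/100. Leaving [G] costs
    [N * pb]. The threshold [h0] does not depend on [E], so two comparisons can share one host. *)
Lemma host_bound (eta : R) : 0 < eta -> exists2 h0 : R, 0 < h0 & forall h M, 0 < h -> h < h0 ->
  n%:R * s + 2 <= M%:R * h ^+ 2 -> forall E, measurable E ->
  mass P E <= exl (coin R) M (followed_ind h E) [::] + 47 / 10 * (n%:R * lam) + eta.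
Proof.
have q1 : 0 < 523 / 500 :> R by lra.
move=> eta0; set N : R := n%:R; have N0 : 0 < N by rewrite ltr0n.
have N1 : 1 <= N by rewrite ler1n.
pose w := Num.min (s / 1000 / 1000) (Num.min (1 / 1000 / N) (eta / 100 / N)).
have k0 k : 0 < k.+1%:R :> R by rewrite ltr0n.
have w0 : 0 < w.
  rewrite /w !lt_min (divr_gt0 (divr_gt0 s0 (k0 _)) (k0 _)).
  by rewrite (divr_gt0 (divr_gt0 ltr01 (k0 _)) N0) (divr_gt0 (divr_gt0 eta0 (k0 _)) N0).
have ws : w <= s / 1000 / 1000 by rewrite /w ge_min lexx.
have Nw : N * w <= 1 / 1000.
  by rewrite mulrC -ler_pdivlMr // /w !ge_min lexx orbT.
have Nwe : N * w * 100 <= eta.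
  by rewrite -ler_pdivlMr // mulrC -ler_pdivlMr // /w !ge_min lexx !orbT.
set law := dlaw P b w; set m := drift P b w; set pb := mass P (bigset b 0).
have l0 : 0 <= lam by rewrite -lamE; apply: Rintegral_ge0 => x _; exact: min32_ge0.
have M2s := mom2_le bm w0 ib2 Eb2.
have del0 : 0 <= s - mom2 law by rewrite subr_ge0.
have [ss K4s dels sK [m150 Nm nc bud]] := @constants_ok R N th s lam w m (dp4 P b w) pb (mom4 law)
  (mom2 law) (s - mom2 law) eta N1 th0 th1 s0 sth l0 lamth (lam_ge bm ib2 Eb2 lamE) w0 ws Nw Nwe
  (drift_le bm w0 ib ib2 Eb lamE) (mom4_le bm w0 ib2 Eb2 lamE) (dp4_ge0 P b w)
  (dp4_le bm w0 ib2 lamE) (budget_le bm w0 ib2 lamE) erefl del0 (mom2_ge bm w0 ib2 Eb2 lamE)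
  (mom_cauchy P bm w0).
have [beta beta0 betaP] := positive_lower_bound (vals P b w).
(* The last entry makes the overshoot [kend], summed over at most [523 / 500 * N] nodes, at most
   [eta / 2]. *)
pose h0 := Num.min (1 / 400) (Num.min (beta / 4) (eta / 2 / ((20 + beta^-1) * (523 / 500 * N)))).
have cc0 : 0 < (20 + beta^-1) * (523 / 500 * N).
  have q2 : 0 < 20 + beta^-1 by apply: addr_gt0; [|rewrite invr_gt0].
  exact: mulr_gt0 q2 (mulr_gt0 q1 N0).
exists h0.
  rewrite /h0 !lt_min (divr_gt0 ltr01 (k0 _)) (divr_gt0 beta0 (k0 _)).
  by rewrite (divr_gt0 (divr_gt0 eta0 (k0 _)) cc0).
move=> h M hp hh0 Mn E Em.
have h1 : h <= 1 / 400 by apply: ltW; apply: lt_le_trans hh0 _; rewrite /h0 ge_min lexx.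
have h2 : h <= beta / 4.
  by apply: ltW; apply: lt_le_trans hh0 _; rewrite /h0 !ge_min lexx orbT.
have h3 : (20 * h + h / beta) * (523 / 500 * N) <= eta / 2.
  have -> : (20 * h + h / beta) * (523 / 500 * N) = h * ((20 + beta^-1) * (523 / 500 * N)) by ring.
  rewrite -ler_pdivlMr //.
  by apply: ltW; apply: lt_le_trans hh0 _; rewrite /h0 !ge_min lexx !orbT.
pose G := E `&` [set x | forall i, (i < n)%N -> `|b i x| <= 33 / 50].
have Gm : measurable G.
  apply: measurableI => //.
  have -> : [set x | forall i, (i < n)%N -> `|b i x| <= 33 / 50] = \bigcap_(i < n) ~` bigset b i.
    apply/seteqP; split => x /= H i iN; have := H i iN; rewrite /bigset /=.
      by rewrite leNgt => /negP.
    by rewrite leNgt => /negP.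
  by apply: bigcap_measurableType => i _; apply: measurableC; exact: bigset_measurable.
have EG : mass P E <= mass P G + N * pb.
  have := @mass_bigU_le _ _ _ P _ (iota 0 n) (E `\` G) (bigset b) (measurableD Em Gm)
    (bigset_measurable bm).
  have -> : \sum_(i <- iota 0 n) mass P (bigset b i) = N * pb.
    rewrite big_seq (eq_bigr (fun=> pb)); last first.
      move=> i; rewrite mem_iota /= => iN; rewrite /mass; congr fine.
      have := @bid i [set x | 33 / 50 < `|x|] iN; apply.
      have : measurable_fun setT (fun x : R => 33 / 50 < `|x|) by apply: measurable_fun_ltr.
      by move=> /(_ measurableT [set true]); rewrite setTI; apply.
    by rewrite -big_seq big_const_seq count_predT size_iota iter_addr_0 /N mulr_natl.
  move=> H; have {}H : mass P (E `\` G) <= N * pb.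
    apply: H => x [Ex nG]; apply: contrapT => nb; apply: nG; split => // i iN.
    rewrite leNgt; apply/negP => bi; apply: nb; exists i => //.
    by rewrite mem_iota.
  have -> : E = G `|` (E `\` G) by rewrite setDUK // => x [].
  by apply: le_trans (massU_le _ Gm (measurableD Em Gm)) _; rewrite lerD2l.
(* [I] marks the lists of rounded values attained on [G]. In [U], [take n] freezes the event after
   [n] increments, since the walk in the induction may run past [n]. *)
pose I ys : R := (`[< exists2 x, G x & ys = mkseq (fun i => rnd P b w (b i x)) n >])%:R.
pose U ys := exl law (n - size ys) I (take n ys).
pose F := followed_ind h E.
(* The coins are [1] and [-1] while the induction uses steps [h] and [- h], hence the division by
   [h]. *)
pose Val xs := exl (coin R) (M - size xs) F (map (fun x => x / h) xs).
have I0 ys : 0 <= I ys by rewrite /I ler0n.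
have I1 ys : I ys <= 1 by rewrite /I lern1; case: `[< _ >].
have F0 xs : 0 <= F xs by rewrite /F /followed_ind ler0n.
have p1 : meanf law (fun=> 1) = 1 by exact: dlaw1.
have p0 a : a \in law -> 0 <= a.1 by exact: dlaw_ge0.
have Ufin ys y : (n <= size ys)%N -> U (rcons ys y) = U ys.
  move=> ny; rewrite /U size_rcons.
  have -> : (n - (size ys).+1 = 0)%N by apply/eqP; rewrite subn_eq0 ltnW.
  have -> : (n - size ys = 0)%N by apply/eqP; rewrite subn_eq0.
  by rewrite -cats1 takel_cat.
have Urec ys : U ys = meanf law (fun y => U (rcons ys y)).
  have [ny|yn] := leqP n (size ys).
    rewrite /meanf; under eq_bigr => a _ do rewrite Ufin //.
    by rewrite -/(meanf law (fun=> U ys)) meanf_cst p1 mul1r.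
  rewrite /U -subnSK //= take_oversize ?(ltnW yn) //; apply: eq_bigr => a _.
  by rewrite size_rcons take_oversize // size_rcons.
have Vrec xs : (size xs < M)%N -> Val xs = (Val (rcons xs h) + Val (rcons xs (- h))) / 2.
  move=> xM; rewrite /Val !size_rcons !map_rcons -(subnSK xM) mulNr divff ?gt_eqF //.
  exact: meanf_coin.
have Vdone xs ys : (size xs <= M)%N -> (n <= size ys)%N -> N * s <= tm h xs ->
    tracks s h xs ys -> U ys <= Val xs.
  move=> xM ny ts cl; rewrite /U.
  have -> : (n - size ys = 0)%N by apply/eqP; rewrite subn_eq0.
  rewrite /= {1}/I; case: asboolP => [[x [Ex Gx] yx]|_]; last first.
    by apply: exl_ge0 => //; exact: coin_ge0.
  rewrite /Val (@exl_cst _ _ _ _ 1) //; first exact: coin1.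
  move=> ext _; rewrite /F /followed_ind; case: asboolP => // -[].
  exists x => // k i kn _ ins win.
  have ix : (i <= size xs)%N.
    have := le_trans ins ts; rewrite /tm ler_pM2r ?exprn_gt0 // ler_nat.
    by [].
  have -> : h * psum i (map (fun x0 => x0 / h) xs ++ ext) = psum i xs.
    rewrite /psum takel_cat ?size_map // -/(psum i _) psum_map.
    by rewrite mulrC divfK // gt_eqF.
  have c := cl k i (leq_trans kn ny) ix win.
  have dk : `|\sum_(j < k) b j x - psum k ys| <= N * (w + `|m|).
    have -> : psum k ys = \sum_(j < k) rnd P b w (b j x).
      by rewrite /psum -(take_takel ys kn) yx -/(psum k _) psum_mkseq.
    rewrite -sumrB; apply: le_trans (ler_norm_sum _ _ _) _.
    apply: (@le_trans _ _ (\sum_(j < k) (w + `|m|))).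
      apply: ler_sum => j _; rewrite /rnd opprB addrA addrAC -/m.
      apply: le_trans (ler_normD _ _) _; rewrite lerD2r.
      have [] := @disc_small _ w (b j x) w0; last by [].
      by apply: Gx; exact: leq_trans kn.
    rewrite sumr_const card_ord -[leLHS]mulr_natl; apply: ler_wpM2r.
      by rewrite addr_ge0 // ltW.
    by rewrite ler_nat.
  have d3 := ler_normD (\sum_(j < k) b j x - psum k ys) (psum k ys - psum i xs).
  rewrite subrKA in d3; apply: le_lt_trans d3 _.
  by rewrite mulrDr in dk; exact: (tolerance_sum dk c Nm Nw).
have nmax : n1c s n <= (Num.truncn (n1c s n)).+1%:R.
  have q : 0 <= n1c s n by rewrite /n1c !addr_ge0 // invr_ge0 ltW.
  by have /andP[_ /ltW] := truncn_itv q.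
have := @embedding_bound R law s h beta n M U Val p0 p1 (dlaw_id P bm w0) _ beta0 _ s0 ss K4s M2s
   dels sK hp h1 h2 _ _ Urec Ufin _ Vrec _ nmax Mn Vdone.
have lawb a : a \in law -> `|a.2| <= 2 / 3.
  move=> /mapP[v]; rewrite mem_undup => /mapP[u ul ->] -> /=.
  exact: (triangle_two_thirds (disc_values_le w0 ul) m150).
have lawm a : a \in law -> a.2 != 0 -> beta <= `|a.2|.
  by move=> /mapP[v vl ->] /=; exact: betaP.
have U0 ys : 0 <= U ys by apply: exl_ge0.
have U1 ys : U ys <= 1 by apply: exl_le1.
have V0 xs : 0 <= Val xs by apply: exl_ge0 => //; exact: coin_ge0.
move=> /(_ lawb lawm U0 U1 V0).
have LB : mass P G <= U [::].
  rewrite /U subn0 /=; apply: law_bound => //.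
  - exact: rnd_measurable.
  - exact: rnd_vals.
  - move=> x Gx; rewrite /I; case: asboolP => // -[]; by exists x.
rewrite {1}/Val subn0 /= -/F => emb.
have kE : kstep law s h beta * n1c s n <=
   (20 * h + h / beta) * (523 / 500 * N) + (25 / 4 * mom4 law + 18 * ((s - mom2 law) ^+ 2 / s)) * (523 / 500 * N).
  rewrite -mulrDl addrA; apply: ler_wpM2l; last exact: nc.
  have m40 : 0 <= mom4 law := le_trans (sqr_ge0 _) (mom_cauchy P bm w0).
  have hb0 := divr_ge0 (ltW hp) (ltW beta0).
  have ds0 := divr_ge0 (sqr_ge0 (s - mom2 law)) (ltW s0).
  rewrite /kstep /kend; apply: addr_ge0; last by rewrite mulr_ge0.
  apply: addr_ge0; last by rewrite mulr_ge0 // divr_ge0.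
  by apply: addr_ge0 => //; apply: mulr_ge0 => //; exact: ltW.
exact: (error_sum EG LB emb kE h3 bud).
Qed.

End HostBound.

(** * Moments of the normal law *)

Section NormalLaw.
Context (R : realType).
Local Notation mu := (@lebesgue_measure R).

(** The Radon-Nikodym derivative and the explicit density have the same integral over every
    measurable set, hence agree almost everywhere. *)
Lemma integral_normal_prob (m sigma : R) (f : R -> \bar R) : measurable_fun setT f ->
  (forall x, 0 <= f x)%E ->
  (\int[normal_prob m sigma]_x f x = \int[mu]_x (f x * (normal_pdf m sigma x)%:E))%E.
Proof.
move=> mf f0; have dom := @normal_prob_dominates R m sigma.
rewrite -(Radon_Nikodym_SigmaFinite.change_of_variables dom f0 measurableT mf).
have iRN := Radon_Nikodym_SigmaFinite.f_integrable dom.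
have mp : measurable_fun setT (EFin \o normal_pdf m sigma).
  by apply/measurable_EFinP; exact: measurable_normal_pdf.
have ae : ae_eq mu setT (Radon_Nikodym_SigmaFinite.f (normal_prob m sigma) mu)
    (EFin \o normal_pdf m sigma).
  apply: integral_ae_eq => // E _ mE.
  by rewrite -Radon_Nikodym_SigmaFinite.f_integral.
apply: ge0_ae_eq_integral => //.
- by apply: emeasurable_funM => //; exact: measurable_int iRN.
- by apply: emeasurable_funM.
- by move=> x _; rewrite mule_ge0 // Radon_Nikodym_SigmaFinite.f_ge0.
- by move=> x _; rewrite mule_ge0 // lee_fin normal_pdf_ge0.
- move: ae; apply: filterS => x H _; by rewrite H.
Qed.

Variables (d : measure_display) (T : measurableType d) (Q : probability T R).
Variables (X : T -> R) (sigma : R).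
Hypothesis mX : measurable_fun setT X.
Hypothesis lawX : forall A : set R, measurable A -> Q (X @^-1` A) = normal_prob 0 sigma A.
Hypothesis sg0 : 0 < sigma.

Lemma integral_normal_law (f : R -> \bar R) : measurable_fun setT f -> (forall x, 0 <= f x)%E ->
  (\int[Q]_w f (X w) = \int[mu]_x (f x * (normal_pdf 0 sigma x)%:E))%E.
Proof.
move=> mf f0; rewrite -integral_normal_prob //.
pose Y : {mfun T >-> measurableTypeR R} :=
  HB.pack_for {mfun T >-> measurableTypeR R} (X : T -> measurableTypeR R)
    (isMeasurableFun.Build _ _ _ (measurableTypeR R) X mX).
transitivity (\int[pushforward Q Y]_x f x)%E.
  by rewrite ge0_integral_pushforward.
by apply: eq_measure_integral => A mA _; exact: lawX.
Qed.

(** The exponential turns the density of standard deviation [sigma] into [r] times that of standard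
    deviation [r * sigma]. For [r < 1] the exponent is negative, so [r] can approach 1 from both
    sides. *)
Lemma normal_exp_sqr (r : R) : 0 < r ->
  (\int[Q]_w (expR ((1 - (r ^+ 2)^-1) / (2 * sigma ^+ 2) * X w ^+ 2))%:E = r%:E)%E.
Proof.
move=> r0; have s1 : sigma != 0 by rewrite gt_eqF.
have rs : r * sigma != 0 by rewrite gt_eqF // mulr_gt0.
pose c := (1 - (r ^+ 2)^-1) / (2 * sigma ^+ 2).
rewrite (@integral_normal_law (fun x => (expR (c * x ^+ 2))%:E)); last 2 first.
- by apply/measurable_EFinP; apply: measurableT_comp => //; apply: measurable_funM.
- by move=> x; rewrite lee_fin expR_ge0.
transitivity (\int[mu]_x (r%:E * (normal_pdf 0 (r * sigma) x)%:E))%E; last first.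
  rewrite integralZl //; last exact: integrable_normal_pdf.
  by rewrite integral_normal_pdf mule1.
apply: eq_integral => x _; rewrite -!EFinM; congr EFin.
rewrite !normal_pdfE // /normal_fun /= !subr0.
have -> : normal_peak sigma = r * normal_peak (r * sigma).
  have E : (r * sigma) ^+ 2 * pi *+ 2 = r ^+ 2 * (sigma ^+ 2 * pi *+ 2).
    by rewrite exprMn -mulrA mulrnAr.
  rewrite /normal_peak E (sqrtrM _ (sqr_ge0 r)) sqrtr_sqr gtr0_norm //.
  by rewrite invfM mulrA divff ?gt_eqF // mul1r.
rewrite mulrCA -!mulrA; congr (_ * (_ * _)); rewrite -expRD; congr expR.
have r1 : r != 0 by rewrite gt_eqF.
have -> : sigma ^+ 2 *+ 2 = 2 * sigma ^+ 2 by rewrite mulr_natl.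
have -> : (r * sigma) ^+ 2 *+ 2 = 2 * (r * sigma) ^+ 2 by rewrite mulr_natl.
by rewrite /c; field; rewrite ?r1 ?s1.
Qed.

Lemma normal_exp (t : R) : (\int[Q]_w (expR (t * X w))%:E = (expR (t ^+ 2 * sigma ^+ 2 / 2))%:E)%E.
Proof.
have s1 : sigma != 0 by rewrite gt_eqF.
rewrite (@integral_normal_law (fun x => (expR (t * x))%:E)); last 2 first.
- by apply/measurable_EFinP; apply: measurableT_comp => //; apply: measurable_funM.
- by move=> x; rewrite lee_fin expR_ge0.
pose e := expR (t ^+ 2 * sigma ^+ 2 / 2).
transitivity (\int[mu]_x (e%:E * (normal_pdf (t * sigma ^+ 2) sigma x)%:E))%E; last first.
  rewrite integralZl //; last exact: integrable_normal_pdf.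
  by rewrite integral_normal_pdf mule1.
apply: eq_integral => x _; rewrite -!EFinM; congr EFin.
rewrite !normal_pdfE // /normal_fun /e /= subr0.
rewrite mulrCA [RHS]mulrCA; congr (_ * _); rewrite -!expRD; congr expR.
have -> : sigma ^+ 2 *+ 2 = 2 * sigma ^+ 2 by rewrite mulr_natl.
by field; rewrite ?s1.
Qed.

Let k : R := 4 * sigma ^+ 2.
Let k0 : 0 < k. Proof. by rewrite /k mulr_gt0 // exprn_gt0. Qed.
Let ex w := expR (k^-1 * X w ^+ 2).

(** The case [r = Num.sqrt 2]: one explicit exponential moment that dominates the second and fourth
    powers. *)
Lemma exp_integral : (\int[Q]_w (ex w)%:E = (Num.sqrt 2)%:E)%E.
Proof.
have r0 : 0 < Num.sqrt 2 :> R by rewrite sqrtr_gt0.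
have cE : (1 - (Num.sqrt 2 ^+ 2)^-1) / (2 * sigma ^+ 2) = k^-1.
  by rewrite sqr_sqrtr // /k; field; rewrite gt_eqF.
by have := normal_exp_sqr r0; rewrite cE.
Qed.

Lemma ex_int : Q.-integrable setT (EFin \o ex).
Proof.
apply/integrableP; split.
  apply/measurable_EFinP; apply: measurableT_comp => //; apply: measurable_funM => //.
  exact: measurable_funX.
rewrite (eq_integral (fun w => (ex w)%:E)); last by move=> w _ /=; rewrite ger0_norm ?expR_ge0.
by rewrite exp_integral ltry.
Qed.

Lemma pow4_ex w : X w ^+ 4 <= 4 * k ^+ 2 * ex w.
Proof.
have u0 : 0 <= k^-1 * X w ^+ 2 / 2 by rewrite divr_ge0 // mulr_ge0 ?sqr_ge0 // invr_ge0 ltW.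
have h : k^-1 * X w ^+ 2 / 2 <= expR (k^-1 * X w ^+ 2 / 2).
  by apply: le_trans (expR_ge1Dx _); rewrite lerDr.
have := ler_pM u0 u0 h h; rewrite -expRD -splitr -/(ex w) => q.
have -> : X w ^+ 4 = 4 * k ^+ 2 * (k^-1 * X w ^+ 2 / 2 * (k^-1 * X w ^+ 2 / 2)).
  by field; rewrite gt_eqF.
by apply: ler_wpM2l => //; rewrite mulr_ge0 // sqr_ge0.
Qed.

Lemma sqr_ex w : X w ^+ 2 <= k * ex w.
Proof.
have h : k^-1 * X w ^+ 2 <= ex w by apply: le_trans (expR_ge1Dx _); rewrite lerDr.
by rewrite mulrC -ler_pdivrMr // mulrC.
Qed.

Lemma normal_sqr_int : Q.-integrable setT (EFin \o (fun w => X w ^+ 2)).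
Proof.
have i : Q.-integrable setT (EFin \o (fun w => k * ex w)) := integrableZl measurableT k ex_int.
apply: integrable_bounded i; first exact: measurable_funX.
by move=> w; rewrite ger0_norm ?sqr_ge0 // sqr_ex.
Qed.

Lemma normal_int : Q.-integrable setT (EFin \o X).
Proof.
have [i _] := @Rintegral_comb _ _ _ Q 1 1 0 0 _ _ _ _ (integrable_cst1 Q) normal_sqr_int
  (integrable_cst1 Q) (integrable_cst1 Q).
apply: integrable_bounded i => // w; have := sqr_ge0 (`|X w| - 1).
rewrite sqrrB real_normK ?num_real //; have := sqr_ge0 (X w); lra.
Qed.

Lemma normal_pow4 : Q.-integrable setT (EFin \o (fun w => X w ^+ 4)) /\
  Rintegral Q setT (fun w => X w ^+ 4) <= 128 * sigma ^+ 4.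
Proof.
have i : Q.-integrable setT (EFin \o (fun w => 4 * k ^+ 2 * ex w)) :=
  integrableZl measurableT (4 * k ^+ 2) ex_int.
have i4 : Q.-integrable setT (EFin \o (fun w => X w ^+ 4)).
  apply: integrable_bounded i; first exact: measurable_funX.
  by move=> w; rewrite ger0_norm ?pow4_ex // exprn_even_ge0.
split => //; have := le_Rintegral measurableT i4 i (fun w _ => pow4_ex w).
rewrite RintegralZl //; last exact: ex_int.
rewrite {2}/Rintegral exp_integral /= => /le_trans; apply.
have s2 : Num.sqrt 2 <= 2 :> R.
  by rewrite -[leRHS]ger0_norm // -sqrtr_sqr ler_sqrt // expr2; lra.
have -> : 128 * sigma ^+ 4 = 4 * k ^+ 2 * 2 by rewrite /k; ring.
by apply: ler_wpM2l => //; rewrite mulr_ge0 // sqr_ge0.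
Qed.

Lemma limit_zero (y c : R) : (forall t, 0 < t -> t <= 1 -> y <= c * t) -> y <= 0.
Proof.
move=> H; rewrite leNgt; apply/negP => y0.
have c0 : 0 < c by have := H 1 ltr01 (lexx _); rewrite mulr1 => /(lt_le_trans y0).
pose t := Num.min 1 (y / (2 * c)).
have t0 : 0 < t by rewrite lt_min ltr01 divr_gt0 // mulr_gt0.
have := H t t0; rewrite {1}/t ge_min lexx => /(_ isT).
have : c * t <= c * (y / (2 * c)) by rewrite ler_pM2l // /t ge_min lexx orbT.
have -> : c * (y / (2 * c)) = y / 2 by field; rewrite gt_eqF.
lra.
Qed.

Lemma ge_Rintegral_exp (f : T -> R) (g : T -> R) (c : R) : Q.-integrable setT (EFin \o f) ->
  measurable_fun setT g -> (forall w, f w <= g w) -> (forall w, 0 <= g w) ->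
  (\int[Q]_w (g w)%:E = c%:E)%E -> Rintegral Q setT f <= c.
Proof.
move=> fi mg fg g0 gc.
have gi : Q.-integrable setT (EFin \o g).
  apply/integrableP; split; first exact/measurable_EFinP.
  rewrite (eq_integral (fun w => (g w)%:E)) ?gc ?ltry //.
  by move=> w _ /=; rewrite ger0_norm.
have := le_Rintegral measurableT fi gi (fun w _ => fg w).
by rewrite {2}/Rintegral gc.
Qed.

(** From [1 + t * X <= expR (t * X)] the mean satisfies [t * E X <= t ^+ 2 * sigma ^+ 2] for small
    [t] of either sign; dividing by [t] and letting it tend to 0 gives both inequalities. *)
Lemma normal_mean : Rintegral Q setT X = 0.
Proof.
have key t : `|t| * sigma <= 1 -> t * Rintegral Q setT X <= t ^+ 2 * sigma ^+ 2.
  move=> t1; have i1 := integrable_cst1 Q.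
  have [i E] := @Rintegral_comb _ _ _ Q 1 t 0 0 _ _ _ _ i1 normal_int i1 i1.
  have := @ge_Rintegral_exp _ (fun w => expR (t * X w)) _ i _ _ _ (normal_exp t).
  rewrite E Rintegral_cst1 => H.
  have {}H : 1 * 1 + t * Rintegral Q setT X + 0 * 1 + 0 * 1 <= expR (t ^+ 2 * sigma ^+ 2 / 2).
    apply: H => [|w|w]; last exact: expR_ge0.
      by apply: measurableT_comp => //; apply: measurable_funM.
    by have := expR_ge1Dx (t * X w); lra.
  have u1 : t ^+ 2 * sigma ^+ 2 <= 1.
    rewrite -exprMn -real_normK ?num_real // normrM (gtr0_norm sg0).
    by apply: exprn_ile1 => //; rewrite mulr_ge0 // ltW.
  have u0 : 0 <= t ^+ 2 * sigma ^+ 2 by rewrite mulr_ge0 ?sqr_ge0.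
  have := expR_ge1Dx (- (t ^+ 2 * sigma ^+ 2 / 2)); rewrite expRN.
  move: (t ^+ 2 * _) u0 u1 H => u u0 u1 H q.
  have e0 := expR_gt0 (u / 2).
  have := ler_wpM2r (ltW e0) q; rewrite mulVf ?gt_eqF // => q2.
  by move: q2 H; move: (expR _) (Rintegral _ _ _) => x y; nra.
have sp : 0 < sigma^-1 by rewrite invr_gt0.
have tb t : 0 < t -> t <= 1 -> `|t / sigma| * sigma <= 1.
  by move=> t0 t1; rewrite ger0_norm ?divfK ?gt_eqF // ltW // divr_gt0.
apply/eqP; rewrite eq_le; apply/andP; split.
  apply: (@limit_zero _ sigma) => t t0 t1; have := key (t / sigma) (tb t t0 t1).
  have -> : (t / sigma) ^+ 2 * sigma ^+ 2 = t / sigma * (sigma * t) by field; rewrite gt_eqF.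
  by rewrite ler_pM2l // divr_gt0.
rewrite -oppr_le0; apply: (@limit_zero _ sigma) => t t0 t1.
have := key (- (t / sigma)); rewrite normrN => /(_ (tb t t0 t1)).
have -> : (- (t / sigma)) ^+ 2 * sigma ^+ 2 = t / sigma * (sigma * t) by field; rewrite gt_eqF.
by rewrite mulNr -mulrN ler_pM2l // divr_gt0.
Qed.

(* the exponential moments [normal_exp_sqr] squeeze the second moment, since [1 + u <= exp u] *)
Lemma normal_var : Rintegral Q setT (fun w => X w ^+ 2) = sigma ^+ 2.
Proof.
set M := Rintegral _ _ _; have s2 : 0 < sigma ^+ 2 by rewrite exprn_gt0.
have key r : 0 < r -> (r - 1) * ((r + 1) * M) <= (r - 1) * (2 * sigma ^+ 2 * r ^+ 2).
  move=> r0; have i1 := integrable_cst1 Q.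
  pose c := (1 - (r ^+ 2)^-1) / (2 * sigma ^+ 2).
  have [i E] := @Rintegral_comb _ _ _ Q 1 c 0 0 _ _ _ _ i1 normal_sqr_int i1 i1.
  have := @ge_Rintegral_exp _ (fun w => expR (c * X w ^+ 2)) _ i _ _ _ (normal_exp_sqr r0).
  rewrite E Rintegral_cst1 -/M => H.
  have {}H : 1 * 1 + c * M + 0 * 1 + 0 * 1 <= r.
    apply: H => [|w|w]; last exact: expR_ge0.
      by apply: measurableT_comp => //; apply: measurable_funM => //; exact: measurable_funX.
    by have := expR_ge1Dx (c * X w ^+ 2); lra.
  have cE : c * (2 * sigma ^+ 2 * r ^+ 2) = (r - 1) * (r + 1).
    by rewrite /c; field; rewrite !gt_eqF.
  have pos : 0 <= 2 * sigma ^+ 2 * r ^+ 2 by rewrite mulr_ge0 ?sqr_ge0 // mulr_ge0 ?sqr_ge0.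
  have h : c * M <= r - 1 by lra.
  have := ler_wpM2r pos h.
  have -> : c * M * (2 * sigma ^+ 2 * r ^+ 2) = c * (2 * sigma ^+ 2 * r ^+ 2) * M by ring.
  by rewrite cE -[(r - 1) * (r + 1) * M]mulrA.
have M0 : 0 <= M by apply: Rintegral_ge0 => w _; exact: sqr_ge0.
apply/eqP; rewrite eq_le; apply/andP; split.
  rewrite -subr_le0; apply: (@limit_zero _ (3 * sigma ^+ 2)) => t t0 t1.
  have r0 : 0 < 1 + t by rewrite addr_gt0.
  have := key _ r0; rewrite addrC addKr ler_pM2l // => q.
  have : t ^+ 2 * sigma ^+ 2 <= t * sigma ^+ 2.
    by rewrite expr2 ler_pM2r //; rewrite -[leRHS]mulr1 ler_pM2l.
  have := mulr_ge0 (ltW t0) M0.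
  by move: q; rewrite sqrrD expr1n mul1r; move: (t ^+ 2) (sigma ^+ 2) => a b; nra.
rewrite -subr_le0; apply: (@limit_zero _ (sigma ^+ 2)) => t t0 t1.
have r0 : 0 < 1 - t / 2 by lra.
have := key _ r0.
have -> : 1 - t / 2 - 1 = - (t / 2) by ring.
rewrite !mulNr lerN2 ler_pM2l ?divr_gt0 // => q.
have : 0 <= t ^+ 2 * sigma ^+ 2 by rewrite mulr_ge0 ?sqr_ge0.
have := mulr_ge0 (ltW t0) M0.
move: q; clearbody M; move: (sigma ^+ 2) => b.
have -> : (1 - t / 2 + 1) * M = 2 * M - t * M / 2 by field.
have -> : 2 * b * (1 - t / 2) ^+ 2 = 2 * b - 2 * b * t + t ^+ 2 * b / 2 by field.
by move: (t ^+ 2 * b) (t * M) => x y q y0 x0; lra.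
Qed.

End NormalLaw.

(** * Path space *)

Section PathSpace.
Context {R : realType}.

Lemma clamp_unit (x : R) : Num.max 0 (Num.min 1 x) \in unit_set R.
Proof.
by rewrite inE /unit_set /= in_itv /= le_max lexx /= ge_max ler01 ge_min lexx.
Qed.

(** Clamping makes [pt], and with it [grid], total: grid points are indexed by arbitrary pairs of
    naturals, and a grid continues as a constant beyond 1. *)
Definition pt (x : R) : unit_itv R := exist (fun y => y \in unit_set R) _ (clamp_unit x).

Lemma val_pt (x : R) : 0 <= x <= 1 -> set_val (pt x) = x.
Proof.
move=> /andP[x0 x1]; have -> : set_val (pt x) = Num.max 0 (Num.min 1 x) by [].
by rewrite (min_r x1) (max_r x0).
Qed.

Lemma unit_itv_itv (t : unit_itv R) : 0 <= set_val t <= 1.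
Proof. by have := set_valP t; rewrite /unit_set /= in_itv /=. Qed.

Lemma unit_itv_inj (s t : unit_itv R) : set_val s = set_val t -> s = t.
Proof. by move=> st; apply: val_inj. Qed.

Lemma C01_unif (f : C01 R) (e : R) : 0 < e -> exists2 N : nat, (0 < N)%N &
  forall s t : unit_itv R, `|set_val s - set_val t| < N%:R^-1 -> `|f s - f t| < e.
Proof.
move=> e0.
have gE (t : unit_itv R) : valL f (set_val t) = f t by exact: (congr1 (@^~ t) (valLK _ f)).
have cf : {within `[0, 1], continuous (valL f)}.
  exact/subspace_valL_continuousP/C01_continuous.
have /compact_near_coveringP cov := @segment_compact R 0 1.
pose Pr (N : nat) (x : R) := forall s t : unit_itv R, set_val s = x ->
  `|set_val s - set_val t| < N.+1%:R^-1 -> `|f s - f t| < e.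
have := cov nat \oo Pr _.
have e2 : 0 < e / 2 by rewrite divr_gt0.
case.
  move=> x x01; have /subspace_continuousP/(_ x x01)/cvgrPdist_lt/(_ _ e2) := cf.
  rewrite near_withinE => /nbhs_ballP[dl /= dl0 H].
  have dl2 : 0 < dl / 2 by rewrite divr_gt0.
  exists (ball x (dl / 2), [set N | N.+1%:R^-1 < dl / 2]) => /=.
    split; first exact: nbhsx_ballx.
    exact: near_infty_natSinv_lt (PosNum dl2).
  move=> [y N] [/= xy Nd] s t sy st.
  have hs : `|valL f x - f s| < e / 2.
    rewrite -gE; apply: H; last exact: unit_itv_itv.
    by rewrite sy; apply: le_ball xy; lra.
  have ht : `|valL f x - f t| < e / 2.
    rewrite -gE; apply: H; last exact: unit_itv_itv.
    rewrite /ball /= in xy *; rewrite sy in st.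
    have := ler_normD (x - y) (y - set_val t); rewrite subrKA => q.
    apply: le_lt_trans q _; rewrite [ltRHS]splitr; apply: ltrD; [exact: xy|exact: lt_trans st Nd].
  have := ler_normD (f s - valL f x) (valL f x - f t); rewrite subrKA (distrC (f s) (valL f x)) => q.
  by apply: le_lt_trans q _; rewrite [ltRHS]splitr; apply: ltrD.
move=> N _ /(_ N (leqnn N)) H; exists N.+1 => // s t st.
by apply: (H (set_val s) _ s t) => //; exact: unit_itv_itv.
Qed.

Definition grid (a c : nat) : unit_itv R := pt (a%:R / c%:R).

Lemma grid_close (t : unit_itv R) (N : nat) : (0 < N)%N ->
  exists2 a, (a <= N)%N & `|set_val t - set_val (grid a N)| < N%:R^-1 /\ set_val (grid a N) = a%:R / N%:R.
Proof.
move=> N0; have Np : 0 < N%:R :> R by rewrite ltr0n.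
have /andP[t0 t1] := unit_itv_itv t.
have q0 : 0 <= set_val t * N%:R by rewrite mulr_ge0 // ltW.
have /andP[h1 h2] := truncn_itv q0.
set a := Num.truncn _ in h1 h2.
have aN : (a <= N)%N.
  rewrite -(ler_nat R); apply: le_trans h1 _; rewrite -[leRHS]mul1r.
  by apply: ler_wpM2r; first exact: ltW.
have v : set_val (grid a N) = a%:R / N%:R.
  apply: val_pt; rewrite divr_ge0 //= ler_pdivrMr // mul1r ler_nat //.
exists a => //; split => //; rewrite v ger0_norm; last first.
  by rewrite subr_ge0 ler_pdivrMr.
rewrite ltrBlDr -(ltr_pM2r Np) mulrDl mulVf ?gt_eqF // divfK ?gt_eqF //.
by rewrite addrC natr1.
Qed.

Lemma C01_dist_lt (f g : C01 R) (r e : R) : (forall t, `|f t - g t| <= r) -> r < e -> `|f - g| < e.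
Proof. by move=> H; apply: le_lt_trans; apply: unif_norm_le => t; exact: H. Qed.

(** Only values at rational times are constrained, and the centres are rational: membership is a
    countable conjunction of coordinate events, and there are countably many tubes. *)
Definition tube (m : nat) (v : seq rat) (k : nat) : set (C01 R) :=
  [set f | forall i a c, (i <= m)%N -> `|set_val (grid a c) - i%:R / m%:R| <= m%:R^-1 ->
     `|f (grid a c) - ratr v`_i| <= k.+1%:R^-1].

Lemma tube_diam m v k (f g : C01 R) : (0 < m)%N -> tube m v k f -> tube m v k g ->
  forall t, `|f t - g t| <= 4 / k.+1%:R.
Proof.
move=> m0 Ef Eg t; have k0 : 0 < k.+1%:R^-1 :> R by rewrite invr_gt0 ltr0n.
have [N1 N10 F1] := C01_unif f k0; have [N2 N20 F2] := C01_unif g k0.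
pose N := (N1 * N2 * m)%N.
have N0 : (0 < N)%N by rewrite !muln_gt0 N10 N20.
have [a aN [ta va]] := grid_close t N0.
have le n : (0 < n)%N -> (n <= N)%N -> N%:R^-1 <= n%:R^-1 :> R.
  by move=> n0 nN; rewrite lef_pV2 ?posrE ?ltr0n // ler_nat.
have f1 : `|f t - f (grid a N)| < k.+1%:R^-1.
  by apply: F1; apply: lt_le_trans ta _; apply: le => //; rewrite /N -mulnA leq_pmulr // muln_gt0 N20.
have g1 : `|g t - g (grid a N)| < k.+1%:R^-1.
  by apply: F2; apply: lt_le_trans ta _; apply: le => //; rewrite /N mulnAC leq_pmull // muln_gt0 N10.
have [i im [ti vi]] := grid_close (grid a N) m0.
have close : `|set_val (grid a N) - i%:R / m%:R| <= m%:R^-1 by rewrite -vi; exact: ltW.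
have f2 := Ef i a N im close; have g2 := Eg i a N im close.
move: f1 g1 f2 g2; rewrite !ltr_norml !ler_norml.
set x := k.+1%:R^-1; move=> /andP[? ?] /andP[? ?] /andP[? ?] /andP[? ?].
by apply/andP; split; lra.
Qed.

Lemma tube_exists (f : C01 R) (k : nat) : exists m v, (0 < m)%N /\ tube m v k f.
Proof.
have k0 : 0 < k.+1%:R^-1 / 2 :> R by rewrite divr_gt0 // invr_gt0 ltr0n.
have [m m0 F] := C01_unif f k0.
have ratP i : exists q : rat, `|f (grid i m.*2) - ratr q| < k.+1%:R^-1 / 2.
  have ab : f (grid i m.*2) - k.+1%:R^-1 / 2 < f (grid i m.*2) + k.+1%:R^-1 / 2.
    by move: (f _) (_ / 2) k0 => y z z0; lra.
  have [q] := rat_in_itvoo ab.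
  by rewrite in_itv /= => /andP[q1 q2]; exists q; rewrite distrC ltr_distl q1 q2.
pose v := mkseq (fun i => projT1 (cid (ratP i))) m.*2.+1.
exists m.*2, v; split; first by rewrite double_gt0.
move=> i a c im ac; rewrite /v nth_mkseq //.
case: cid => q /= hq.
have m20 : 0 < m.*2%:R :> R by rewrite ltr0n double_gt0.
have vi : set_val (grid i m.*2) = i%:R / m.*2%:R.
  by apply: val_pt; rewrite divr_ge0 //= ler_pdivrMr // mul1r ler_nat.
have h : `|f (grid a c) - f (grid i m.*2)| < k.+1%:R^-1 / 2.
  apply: F; rewrite vi; apply: le_lt_trans ac _.
  have mm : m%:R < m.*2%:R :> R by rewrite ltr_nat -addnn -addn1 leq_add2l.
  by rewrite ltf_pV2 // posrE ltr0n.
have := ler_normD (f (grid a c) - f (grid i m.*2)) (f (grid i m.*2) - ratr q); rewrite subrKA.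
by move=> tri; apply: le_trans tri _; rewrite [leRHS]splitr; apply: lerD; exact: ltW.
Qed.

Section Measurability.
Context (d : measure_display) (T : measurableType d) (X : T -> C01 R).
Hypothesis mX : forall t, measurable_fun setT (fun w => X w t).

Lemma tube_measurable m v k : measurable (X @^-1` tube m v k).
Proof.
have -> : X @^-1` tube m v k = \bigcap_i \bigcap_a \bigcap_c
   [set w | (i <= m)%N -> `|set_val (grid a c) - i%:R / m%:R| <= m%:R^-1 ->
     `|X w (grid a c) - ratr v`_i| <= k.+1%:R^-1].
  by apply/seteqP; split => w /= H i; [move=> _ a _ c _|move=> a c]; apply: H.
apply: bigcap_measurableType => i _; apply: bigcap_measurableType => a _.
apply: bigcap_measurableType => c _.
have [im|im] := boolP (i <= m)%N; last first.
  by rewrite (_ : [set w | _] = setT) //; apply/seteqP; split.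
have [ac|ac] := boolP (`|set_val (grid a c) - i%:R / m%:R| <= m%:R^-1); last first.
  by rewrite (_ : [set w | _] = setT) //; apply/seteqP; split.
have : measurable_fun setT (fun w => `|X w (grid a c) - ratr v`_i| <= k.+1%:R^-1).
  apply: measurable_fun_ler => //; apply: measurableT_comp => //.
  by apply: measurable_funB.
move=> /(_ measurableT [set true]); rewrite setTI => mS.
rewrite (_ : [set w | _] = (fun w => `|X w (grid a c) - ratr v`_i| <= k.+1%:R^-1) @^-1` [set true]).
  exact: mS.
by apply/seteqP; split => w /= H; [apply: H|move=> _ _].
Qed.

(** Every point of [V] has a tube that contains it and, having small diameter, lies in [V]; so [V]
    is the union of the countably many tubes inside it. This is the separability of the path
    space. *)
Lemma open_preimage_measurable (V : set (C01 R)) : open V -> measurable (X @^-1` V).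
Proof.
move=> oV; pose F (q : nat * seq rat * nat) : set T :=
  if `[< (0 < q.1.1)%N /\ tube q.1.1 q.1.2 q.2 `<=` V >]
  then X @^-1` tube q.1.1 q.1.2 q.2 else set0.
have -> : X @^-1` V = \bigcup_q F q.
  apply/seteqP; split => [w Vw|w [[[m v] k] _]]; last first.
    by rewrite /F /=; case: asboolP => // -[_ tV] tw; exact: tV.
  have /nbhs_ballP[e /= e0 eV] : nbhs (X w) V by apply: open_nbhs_nbhs.
  have e4 : 0 < e / 4 by rewrite divr_gt0.
  have [k _ kP] := near_infty_natSinv_lt (PosNum e4).
  have {}kP : k.+1%:R^-1 < e / 4 by apply: (kP k) => /=.
  have [m [v [m0 tw]]] := tube_exists (X w) k.
  exists (m, v, k) => //; rewrite /F /=; case: asboolP => // -[]; split => // g tg.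
  apply: eV; rewrite -ball_normE /=; apply: (@C01_dist_lt _ _ (4 / k.+1%:R)).
    exact: tube_diam tw tg.
  by rewrite mulrC -ltr_pdivlMr.
apply: countable_bigcupT_measurable => // -[[m v] k]; rewrite /F; case: asboolP => // _.
exact: tube_measurable.
Qed.

Lemma borel_preimage_measurable (D : set (C01 R)) : C01_borel D -> measurable (X @^-1` D).
Proof.
suff : C01_borel (R := R) `<=` [set D | measurable (X @^-1` D)] by apply.
apply: smallest_sub; last by move=> V; exact: open_preimage_measurable.
split => [|A mA|F mF] /=.
- by rewrite preimage_set0.
- by rewrite setTD preimage_setC; exact: measurableC.
- by rewrite preimage_bigcup; exact: bigcupT_measurable.
Qed.

End Measurability.

Lemma enlargement_open (D : set (C01 R)) (e : R) : open (enlargement D e).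
Proof.
rewrite openE => x [y Dy xy]; apply/nbhs_ballP; exists (e - `|x - y|); first by rewrite /= subr_gt0.
move=> z; rewrite -ball_normE /= => xz; exists y => //.
have := ler_normD (z - x) (x - y); rewrite subrKA (distrC z x) => tri.
by apply: le_lt_trans tri _; rewrite -ltrBrDr.
Qed.

Lemma enlargement_borel (D : set (C01 R)) (e : R) : C01_borel (enlargement D e).
Proof. by apply: sub_sigma_algebra; exact: enlargement_open. Qed.

End PathSpace.

(** * Gluing along the host *)

Lemma exl_le_ext (R : realFieldType) (law : seq (R * R)) k F G pre :
  (forall a, a \in law -> 0 <= a.1) ->
  (forall ext, size ext = k -> all (mem [seq a.2 | a <- law]) ext -> F (pre ++ ext) <= G (pre ++ ext)) ->
  exl law k F pre <= exl law k G pre.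
Proof.
move=> p0; elim: k pre => [|k IH] pre H /=; first by have := H [::] erefl isT; rewrite cats0.
rewrite /meanf big_seq [leRHS]big_seq; apply: ler_sum => a al.
apply: ler_wpM2l; first exact: p0.
apply: IH => ext sz ae; rewrite cat_rcons; apply: H; first by rewrite /= sz.
by rewrite /= ae andbT; apply: map_f.
Qed.

Fixpoint paths (R : realType) (M : nat) : seq (seq R) :=
  if M is M'.+1 then [seq x :: s | x <- [:: 1; -1], s <- paths R M'] else [:: [::]].

Lemma mem_paths (R : realType) M (s : seq R) :
  size s = M -> all (mem [seq a.2 | a <- coin R]) s -> s \in paths R M.
Proof.
elim: M s => [|M IH] [|x s] //= [sM] /andP[xc sc].
by rewrite -[_ \in _]/(x :: s \in [seq x :: s | x <- [:: 1; -1], s <- paths R M]);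
  apply: allpairs_f => //; exact: IH.
Qed.

Definition follows (R : realType) (T : Type) (b : nat -> T -> R) (n : nat) (s h tol : R)
    (eps : seq R) (w : T) : Prop :=
  forall k i, (k <= n)%N -> (i <= size eps)%N -> i%:R * h ^+ 2 <= n%:R * s ->
    `|i%:R * h ^+ 2 - k%:R * s| <= 2 * s ->
    `|\sum_(j < k) b j w - h * psum i eps| < tol.

Lemma follows_measurable (R : realType) (d : measure_display) (T : measurableType d)
    (b : nat -> T -> R) (n : nat) (s h tol : R) (eps : seq R) :
  (forall i, measurable_fun setT (b i)) -> measurable [set w | follows b n s h tol eps w].
Proof.
move=> bm; have -> : [set w | follows b n s h tol eps w] = \bigcap_k \bigcap_i
   [set w | (k <= n)%N -> (i <= size eps)%N -> i%:R * h ^+ 2 <= n%:R * s ->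
    `|i%:R * h ^+ 2 - k%:R * s| <= 2 * s ->
    `|\sum_(j < k) b j w - h * psum i eps| < tol].
  by apply/seteqP; split => w /= H k; [move=> _ i _|move=> i]; apply: H.
apply: bigcap_measurableType => k _; apply: bigcap_measurableType => i _.
set S := [set w | _].
have [[c1 c2 c3 c4]|c] := pselect [/\ (k <= n)%N, (i <= size eps)%N, i%:R * h ^+ 2 <= n%:R * s &
    `|i%:R * h ^+ 2 - k%:R * s| <= 2 * s]; last first.
  rewrite (_ : S = setT) //; apply/seteqP; split => // w _ a1 a2 a3 a4.
  by exfalso; apply: c.
have mf : measurable_fun setT (fun w => `|\sum_(j < k) b j w - h * psum i eps| < tol).
  apply: measurable_fun_ltr => //; apply: measurableT_comp => //.
  by apply: measurable_funB => //; apply: measurable_sum.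
have := mf measurableT [set true]; rewrite setTI => mS.
rewrite (_ : S = (fun w => `|\sum_(j < k) b j w - h * psum i eps| < tol) @^-1` [set true]).
  exact: mS.
by apply/seteqP; split => w /= H; [exact: H|move=> _ _ _ _].
Qed.

Lemma exists_seq_measurable (d : measure_display) (T : measurableType d) (I : eqType) (L : seq I)
  (F : I -> set T) : (forall i, measurable (F i)) -> measurable [set w | exists2 i, i \in L & F i w].
Proof.
move=> mF; elim: L => [|i L IH].
  by rewrite (_ : [set w | _] = set0) //; apply/seteqP; split => // w [].
rewrite (_ : [set w | _] = F i `|` [set w | exists2 j, j \in L & F j w]); first exact: measurableU.
apply/seteqP; split => w /=.
  by move=> [j]; rewrite in_cons => /predU1P[->|jL] Fj; [left|right; exists j].
by move=> [Fi|[j jL Fj]]; [exists i => //; rewrite mem_head|exists j => //; rewrite in_cons jL orbT].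
Qed.

Section Coupling.
Context (R : realType) (d d' : measure_display) (T : measurableType d) (T' : measurableType d').
Variables (P : probability T R) (Q : probability T' R).
Variables (b : nat -> T -> R) (b' : nat -> T' -> R) (n n' : nat) (s s' th th' c1 c2 : R).
Hypothesis bm' : forall i, measurable_fun setT (b' i).
Hypothesis th0 : 0 < th.
Hypothesis th0' : 0 < th'.
Hypothesis HP : forall eta, 0 < eta -> exists2 h0 : R, 0 < h0 & forall h M, 0 < h -> h < h0 ->
  n%:R * s + 2 <= M%:R * h ^+ 2 -> forall E, measurable E ->
  mass P E <= exl (coin R) M (followed_ind b n s h E) [::] + c1 + eta.
Hypothesis HQ : forall eta, 0 < eta -> exists2 h0 : R, 0 < h0 & forall h M, 0 < h -> h < h0 ->
  n'%:R * s' + 2 <= M%:R * h ^+ 2 -> forall E, measurable E ->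
  mass Q E <= exl (coin R) M (followed_ind b' n' s' h E) [::] + c2 + eta.

(* Both sides are compared with the same host of physical step [H]. The second
   comparison is applied to the event that no host path close to the second
   process is close to [E]; the two sets of host paths are then disjoint. *)
Lemma coupling_bound (E : set T) (A O : set T') (H1 eta : R) : 0 < H1 -> 0 < eta ->
  measurable E -> measurable A -> measurable O ->
  (forall H M w w' eps, 0 < H -> H < H1 -> n%:R * s + 2 <= M%:R * (H / th) ^+ 2 -> size eps = M ->
    E w -> O w' -> follows b n s (H / th) (469 / 100) eps w ->
    follows b' n' s' (H / th') (469 / 100) eps w' -> A w') ->
  mass P E <= mass Q A + mass Q (~` O) + c1 + c2 + 2 * eta.
Proof.
move=> H10 eta0 mE mA mO hyp.
have [h1 h10 K1] := HP eta0; have [h2 h20 K2] := HQ eta0.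
pose H := Num.min (H1 / 2) (Num.min (h1 * th / 2) (h2 * th' / 2)).
have H0 : 0 < H by rewrite !lt_min !divr_gt0 // mulr_gt0.
have half (x : R) : 0 < x -> x / 2 < x by move=> x0; lra.
have HH1 : H < H1 by apply: le_lt_trans (half _ H10); rewrite /H ge_min lexx.
have Hh1 : H / th < h1.
  rewrite ltr_pdivrMr //; apply: le_lt_trans (half _ (mulr_gt0 h10 th0)).
  by rewrite /H !ge_min lexx orbT.
have Hh2 : H / th' < h2.
  rewrite ltr_pdivrMr //; apply: le_lt_trans (half _ (mulr_gt0 h20 th0')).
  by rewrite /H !ge_min lexx !orbT.
have q1 : 0 < (H / th) ^+ 2 by rewrite exprn_gt0 // divr_gt0.
have q2 : 0 < (H / th') ^+ 2 by rewrite exprn_gt0 // divr_gt0.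
(* One number of host steps, long enough for both clocks. *)
pose M := (Num.truncn (Num.max 0 ((n%:R * s + 2) / (H / th) ^+ 2))
  + Num.truncn (Num.max 0 ((n'%:R * s' + 2) / (H / th') ^+ 2))).+1.
have big (x y : R) (k : nat) : 0 < y -> (Num.truncn (Num.max (0 : R)%R (x / y)%R) <= k)%N -> x <= k.+1%:R * y.
  move=> y0 k1; rewrite -ler_pdivrMr //; apply: (@le_trans _ _ (Num.max 0 (x / y))).
    by rewrite le_max lexx orbT.
  have m0 : 0 <= Num.max 0 (x / y) by rewrite le_max lexx.
  have /andP[_ /ltW l] := truncn_itv m0; apply: le_trans l _.
  by rewrite ler_nat ltnS.
have M1 : n%:R * s + 2 <= M%:R * (H / th) ^+ 2 by apply: big => //; exact: leq_addr.
have M2 : n'%:R * s' + 2 <= M%:R * (H / th') ^+ 2 by apply: big => //; exact: leq_addl.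
pose C := [set w' | exists2 eps, eps \in paths R M &
   followed b n s (H / th) (469 / 100) E eps /\ follows b' n' s' (H / th') (469 / 100) eps w'].
have mC : measurable C.
  apply: (@exists_seq_measurable _ _ _ _ (fun eps => [set w' |
     followed b n s (H / th) (469 / 100) E eps /\ follows b' n' s' (H / th') (469 / 100) eps w'])).
  move=> eps; have [f|nf] := pselect (followed b n s (H / th) (469 / 100) E eps).
    rewrite (_ : [set w' | _] = [set w' | follows b' n' s' (H / th') (469 / 100) eps w']).
      exact: follows_measurable.
    by apply/seteqP; split => w' /=; [case|].
  by rewrite (_ : [set w' | _] = set0) //; apply/seteqP; split => // w' [].
have e1 := K1 _ M (divr_gt0 H0 th0) Hh1 M1 E mE.
have e2 := K2 _ M (divr_gt0 H0 th0') Hh2 M2 (~` C) (measurableC mC).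
set F1 := followed_ind _ _ _ _ _ in e1; set F2 := followed_ind _ _ _ _ _ in e2.
(* A host path counted in both sums would be followed by some outcome in [E] and by some outcome
   outside [C], which contradicts the definition of [C]. The two indicators are therefore never 1
   together. *)
have sum1 : exl (coin R) M F1 [::] + exl (coin R) M F2 [::] <= 1.
  rewrite -exlD -[leRHS](@exl_cst _ (coin R) M (fun=> 1) 1 [::] (coin1 R)) //.
  apply: exl_le_ext; first exact: coin_ge0.
  move=> eps sz ae; rewrite cat0s /F1 /F2 /followed_ind.
  case: asboolP => [f1|_]; case: asboolP => [[w' nC f2]|_]; rewrite ?addr0 ?add0r //.
  by exfalso; apply: nC; exists eps => //; exact: mem_paths.
have CC : mass Q C + mass Q (~` C) = 1.
  rewrite -(massT Q) -(setUv C) /mass measureU ?setICr // ?fineD ?fin_num_measure //.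
  - exact: measurableC.
  - exact: measurableC.
have CA : mass Q C <= mass Q A + mass Q (~` O).
  apply: le_trans (massU_le Q mA (measurableC mO)); apply: le_mass => //.
    by apply: measurableU => //; exact: measurableC.
  move=> w' [eps epsM [[w Ew fw] fw']].
  have [Ow|nO] := pselect (O w'); [left|by right].
  apply: (hyp H M w w' eps) => //.
  have szp k (x : seq R) : x \in paths R k -> size x = k.
    elim: k x => [|k IH] x; first by rewrite inE => /eqP->.
    by move=> /allpairsP[[y z] [_ zk ->]] /=; rewrite (IH _ zk).
  exact: szp.
lra.
Qed.

End Coupling.

Lemma independent_comp (R : realType) (d : measure_display) (T : measurableType d)
  (P : probability T R) (I : choiceType) (X : I -> T -> R) (g : I -> R -> R) :
  (forall i, measurable_fun setT (g i)) -> independent_RVs P X ->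
  independent_RVs P (fun i w => g i (X i w)).
Proof.
move=> mg ind J A mA; apply: (ind J (fun i => g i @^-1` A i)) => i.
by have := mg i measurableT _ (mA i); rewrite setTI.
Qed.

(** * Values of a broken line on its cells *)

Section BrokenLine.
Context (R : realType) (n : nat) (x : nat -> R) (f : C01 R).
Hypothesis n0 : (0 < n)%N.
Hypothesis bl : is_broken_line n x f.

Lemma grid_val (k m : nat) : (0 < m)%N -> (k <= m)%N -> set_val (grid k m : unit_itv R) = k%:R / m%:R.
Proof.
move=> m0 km; apply: val_pt; have mp : 0 < m%:R :> R by rewrite ltr0n.
by rewrite divr_ge0 //= ler_pdivrMr // mul1r ler_nat.
Qed.

Lemma broken_line_node k : (k <= n)%N -> f (grid k n) = (Num.sqrt n%:R)^-1 * \sum_(i < k) x i.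
Proof.
move=> kn; have [b0 b1 _] := bl; have [->|k0] := posnP k.
  by rewrite big_ord0 mulr0; apply: b0; rewrite grid_val // mul0r.
by apply: b1; rewrite ?k0 // grid_val.
Qed.

Lemma cell_exists (t : unit_itv R) : exists2 k, (k < n)%N & k%:R / n%:R <= set_val t <= k.+1%:R / n%:R.
Proof.
have np : 0 < n%:R :> R by rewrite ltr0n.
have /andP[t0 t1] := unit_itv_itv t.
have [tl|tg] := ltP (set_val t) 1; last first.
  exists n.-1; first by rewrite prednK.
  have -> : set_val t = 1 by apply/eqP; rewrite eq_le t1 tg.
  by rewrite prednK // divff ?gt_eqF // ler_pdivrMr // mul1r ler_nat leq_pred lexx.
have q0 : 0 <= set_val t * n%:R by rewrite mulr_ge0 // ltW.
have /andP[h1 h2] := truncn_itv q0; exists (Num.truncn (set_val t * n%:R)).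
  rewrite -(ltr_nat R); apply: le_lt_trans h1 _; rewrite -[ltRHS]mul1r.
  by rewrite ltr_pM2r.
by rewrite ler_pdivrMr // h1 ler_pdivlMr // ltW.
Qed.

Lemma broken_line_cell (t : unit_itv R) k : (k < n)%N ->
  k%:R / n%:R <= set_val t <= k.+1%:R / n%:R ->
  f t = f (grid k n) + (set_val t * n%:R - k%:R) * (f (grid k.+1 n) - f (grid k n)).
Proof.
move=> kn tk; have [_ _ /(_ k.+1)] := bl; rewrite kn => /(_ isT)[a [c H]].
have np : 0 < n%:R :> R by rewrite ltr0n.
have kk : k%:R / n%:R <= k.+1%:R / n%:R :> R.
  by apply: ler_wpM2r; [rewrite invr_ge0 ltW|rewrite ler_nat].
rewrite (H t tk) (H (grid k n)) ?(H (grid k.+1 n)) ?grid_val ?lexx ?kk ?(ltnW kn) //.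
by rewrite -natr1; field; rewrite gt_eqF.
Qed.

Lemma broken_line_close (t : unit_itv R) k (y r : R) : (k < n)%N ->
  k%:R / n%:R <= set_val t <= k.+1%:R / n%:R ->
  `|f (grid k n) - y| <= r -> `|f (grid k.+1 n) - y| <= r -> `|f t - y| <= r.
Proof.
move=> kn tk a1 a2; rewrite (broken_line_cell kn tk).
have np : 0 < n%:R :> R by rewrite ltr0n.
move: tk; rewrite ler_pdivrMr // ler_pdivlMr // -natr1 => /andP[t1 t2].
set u := _ * n%:R - k%:R; have u0 : 0 <= u by rewrite subr_ge0.
have u1 : 0 <= 1 - u by rewrite /u; move: t2; lra.
have -> : f (grid k n) + u * (f (grid k.+1 n) - f (grid k n)) - y
  = (1 - u) * (f (grid k n) - y) + u * (f (grid k.+1 n) - y) by ring.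
apply: le_trans (ler_normD _ _) _; rewrite !normrM (ger0_norm u0) (ger0_norm u1).
have := ler_wpM2l u0 a2; have := ler_wpM2l u1 a1; lra.
Qed.

End BrokenLine.

(** Undoes the scaling of space by [th] and of time by [th ^+ 2]. A host of scaled step [H / th] has
    physical step [H] whatever [th] is, so walks with different [th] can follow the same host. *)
Lemma follows_unscaled (R : realType) (T : Type) (b : nat -> T -> R) (n : nat) (s th H tol : R)
  (eps : seq R) (w : T) k i : (0 < n)%N -> 0 < th -> s * n%:R * th ^+ 2 = 1 ->
  follows b n s (H / th) tol eps w -> (k <= n)%N -> (i <= size eps)%N -> i%:R * H ^+ 2 <= 1 ->
  `|i%:R * H ^+ 2 - k%:R / n%:R| <= 2 / n%:R ->
  `|th * \sum_(j < k) b j w - H * psum i eps| < tol * th.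
Proof.
move=> n0 th0 sth F kn ie iH win.
have np : 0 < n%:R :> R by rewrite ltr0n.
have t2 : 0 < (th ^+ 2)^-1 by rewrite invr_gt0 exprn_gt0.
have sE : s = n%:R^-1 * (th ^+ 2)^-1.
  have nz : n%:R * th ^+ 2 != 0 by rewrite mulf_neq0 // gt_eqF // exprn_gt0.
  by apply: (mulIf nz); rewrite mulrA sth -invfM mulVf.
have eH : i%:R * (H / th) ^+ 2 = i%:R * H ^+ 2 * (th ^+ 2)^-1 by rewrite expr_div_n mulrA.
have nS : n%:R * s = (th ^+ 2)^-1 by rewrite sE mulrA divff ?gt_eqF // mul1r.
have dS : i%:R * (H / th) ^+ 2 - k%:R * s = (i%:R * H ^+ 2 - k%:R / n%:R) * (th ^+ 2)^-1.
  by rewrite eH sE; ring.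
have c1 : i%:R * (H / th) ^+ 2 <= n%:R * s by rewrite eH nS ler_piMl // ltW.
have c2 : `|i%:R * (H / th) ^+ 2 - k%:R * s| <= 2 * s.
  have S2 : 2 * s = 2 / n%:R * (th ^+ 2)^-1 by rewrite sE mulrA.
  by rewrite dS normrM (gtr0_norm t2) S2; exact: ler_wpM2r (ltW t2) _ _ win.
have q := F k i kn ie c1 c2.
have -> : th * \sum_(j < k) b j w - H * psum i eps = (\sum_(j < k) b j w - H / th * psum i eps) * th.
  by field; rewrite gt_eqF.
by rewrite normrM (gtr0_norm th0) ltr_pM2r.
Qed.

(** * The Wiener process as a walk on a fine grid *)

Section Wiener.
Context (R : realType) (d' : measure_display) (T' : measurableType d') (Q : probability T' R).
Variable (B : T' -> C01 R).
Hypothesis BW : standard_wiener Q B.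

Lemma wiener_measurable t : measurable_fun setT (fun w => B w t).
Proof. by have [] := BW. Qed.

(** By uniform continuity of each path the events [F N] increase to the whole space, so one of them
    has mass close to 1. They mention rational times only, for measurability; the factor 2 pays for
    the passage to arbitrary [t]. *)
Lemma oscillation_event (rho kap : R) : 0 < rho -> 0 < kap -> exists N : nat, exists O : set T',
  [/\ (0 < N)%N, measurable O, mass Q (~` O) <= kap & forall w, O w -> B w (grid 0 1) = 0 /\
   forall (t : unit_itv R) j m, `|set_val t - set_val (grid j m : unit_itv R)| < (N.*2)%:R^-1 ->
     `|B w t - B w (grid j m)| <= 2 * rho].
Proof.
move=> rho0 kap0.
pose F N : set T' := [set w | forall a c a' c' : nat,
   `|set_val (grid a c : unit_itv R) - set_val (grid a' c' : unit_itv R)| < N.+1%:R^-1 ->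
   `|B w (grid a c) - B w (grid a' c')| <= rho].
have mF N : measurable (F N).
  have -> : F N = \bigcap_a \bigcap_c \bigcap_a' \bigcap_c' [set w |
   `|set_val (grid a c : unit_itv R) - set_val (grid a' c' : unit_itv R)| < N.+1%:R^-1 ->
   `|B w (grid a c) - B w (grid a' c')| <= rho].
    by apply/seteqP; split => w /= H a; [move=> _ c _ a' _ c' _|move=> c a' c']; apply: H.
  apply: bigcap_measurableType => a _; apply: bigcap_measurableType => c _.
  apply: bigcap_measurableType => a' _; apply: bigcap_measurableType => c' _.
  have [g|g] := boolP (`|set_val (grid a c : unit_itv R) - set_val (grid a' c' : unit_itv R)| < N.+1%:R^-1);
    last by rewrite (_ : [set w | _] = setT) //; apply/seteqP; split.
  have mf : measurable_fun setT (fun w => `|B w (grid a c) - B w (grid a' c')| <= rho).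
    apply: measurable_fun_ler => //; apply: measurableT_comp => //.
    by apply: measurable_funB; exact: wiener_measurable.
  have := mf measurableT [set true]; rewrite setTI => mS.
  rewrite (_ : [set w | _] = (fun w => `|B w (grid a c) - B w (grid a' c')| <= rho) @^-1` [set true]).
    exact: mS.
  by apply/seteqP; split => w /= H; [exact: H|move=> _].
have FT : \bigcup_N F N = setT.
  apply/seteqP; split => // w _; have [N N0 HN] := C01_unif (B w) rho0.
  by exists N.-1 => // a c a' c'; rewrite prednK // => /HN /ltW.
have ndF : nondecreasing_seq F.
  move=> i j ij; apply/subsetPset => w Fw a c a' c' h; apply: Fw; apply: lt_le_trans h _.
  by rewrite lef_pV2 ?posrE ?ltr0n // ler_nat ltnS.
have mU : measurable (\bigcup_N F N) by rewrite FT.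
have := nondecreasing_cvg_mu mF mU ndF; rewrite FT => cv.
have cv1 : (fun N => mass Q (F N)) @ \oo --> (1 : R).
  apply: fine_cvg; rewrite -(probability_setT Q); exact: cv.
have /cvgrPdist_lt/(_ kap kap0)[N _ HN] := cv1.
have {}HN := HN N (leqnn N).
pose Z : set T' := [set w | B w (grid 0 1) = 0].
have mZ : measurable Z.
  have := @wiener_measurable (grid 0 1) measurableT [set 0] (measurable_set1 0).
  by rewrite setTI.
have Z0 : mass Q (~` Z) = 0.
  have [_ /(_ (grid 0 1))] := BW; rewrite grid_val // mul0r => /(_ erefl)[A [mA A0 sA]] _ _.
  apply/eqP; rewrite eq_le mass_ge0 andbT -[leRHS](_ : mass Q A = 0); last by rewrite /mass A0.
  by apply: le_mass => //; exact: measurableC.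
exists N.+1, (F N `&` Z); split => //.
- exact: measurableI.
- rewrite setCI; apply: le_trans (massU_le Q (measurableC (mF N)) (measurableC mZ)) _.
  rewrite Z0 addr0.
  have : mass Q (F N) + mass Q (~` F N) = 1.
    rewrite -(massT Q) -(setUv (F N)) /mass measureU ?setICr // ?fineD ?fin_num_measure //.
    + exact: measurableC.
    + exact: measurableC.
  by have := ler_norm (1 - mass Q (F N)); lra.
- move=> w [Fw Zw]; split => // t j m tj.
  have [K K0 HK] := C01_unif (B w) rho0.
  pose L := (K * N.+1.*2)%N.
  have L0 : (0 < L)%N by rewrite muln_gt0 K0 double_gt0.
  have [a _ [ta _]] := grid_close t L0.
  have LK : L%:R^-1 <= K%:R^-1 :> R.
    by rewrite lef_pV2 ?posrE ?ltr0n // ler_nat leq_pmulr // double_gt0.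
  have LN : L%:R^-1 <= N.+1.*2%:R^-1 :> R.
    by rewrite lef_pV2 ?posrE ?ltr0n ?double_gt0 // ler_nat leq_pmull.
  have d1 := HK _ _ (lt_le_trans ta LK).
  have d2 : `|B w (grid a L) - B w (grid j m)| <= rho.
    apply: Fw.
    have := ler_normD (set_val (grid a L) - set_val t) (set_val t - set_val (grid j m : unit_itv R)).
    rewrite subrKA (distrC (set_val (grid a L)) (set_val t)) => q; apply: le_lt_trans q _.
    have -> : N.+1%:R^-1 = N.+1.*2%:R^-1 + N.+1.*2%:R^-1 :> R.
      by rewrite -muln2 natrM; field; rewrite gt_eqF // ltr0n.
    by apply: ltrD => //; exact: lt_le_trans ta LN.
  have := ler_normD (B w t - B w (grid a L)) (B w (grid a L) - B w (grid j m)); rewrite subrKA.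
  lra.
Qed.

(** Past index [m] the clamped grid is constant and the increments vanish; this is why [host_bound]
    asks for equal laws only below its horizon. *)
Definition incr (m : nat) (th : R) (j : nat) (w : T') : R :=
  (B w (grid j.+1 m) - B w (grid j m)) / th.

Lemma incr_measurable m th i : measurable_fun setT (incr m th i).
Proof.
by apply: measurable_funM => //; apply: measurable_funB; exact: wiener_measurable.
Qed.

Lemma incr_sum m th k w : 0 < th -> th * \sum_(j < k) incr m th j w = B w (grid k m) - B w (grid 0 m).
Proof.
move=> th0; rewrite -mulr_suml mulrC divfK ?gt_eqF //.
by rewrite -(big_mkord xpredT (fun j => B w (grid j.+1 m) - B w (grid j m))) telescope_sumr.
Qed.

Lemma incr_law m j (A : set R) : (j < m)%N -> measurable A ->
  Q ((fun w => B w (grid j.+1 m) - B w (grid j m)) @^-1` A) = normal_prob 0 (Num.sqrt m%:R^-1) A.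
Proof.
move=> jm mA; have [_ _ /(_ (grid j m) (grid j.+1 m)) H _] := BW.
have m0 : (0 < m)%N by exact: leq_trans jm.
have mp : 0 < m%:R :> R by rewrite ltr0n.
have tl : set_val (grid j m : unit_itv R) < set_val (grid j.+1 m : unit_itv R).
  by rewrite (grid_val R m0 jm) (grid_val R m0 (ltnW jm)) ltr_pM2r ?invr_gt0 // ltr_nat.
have vE : set_val (grid j.+1 m : unit_itv R) - set_val (grid j m) = m%:R^-1.
  by rewrite (grid_val R m0 jm) (grid_val R m0 (ltnW jm)) -natr1; field; rewrite gt_eqF.
by apply: etrans (H tl A mA) _; rewrite vE.
Qed.

Lemma incr_indep m th : independent_RVs Q (incr m th).
Proof.
have [_ _ _ ind] := BW.
apply: (@independent_comp _ _ _ _ _ _ (fun _ x => x / th)).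
  by move=> i; apply: measurable_funM.
apply: ind => i; have -> : grid i m = pt (i%:R / m%:R) :> unit_itv R by [].
have h : i%:R / m%:R <= i.+1%:R / m%:R :> R.
  by apply: ler_wpM2r; [rewrite invr_ge0 ler0n|rewrite ler_nat].
have h2 : Num.min 1 (i%:R / m%:R) <= Num.min 1 (i.+1%:R / m%:R) :> R.
  by rewrite le_min !ge_min lexx /= h orbT.
have : Num.max 0 (Num.min 1 (i%:R / m%:R)) <= Num.max 0 (Num.min 1 (i.+1%:R / m%:R)) :> R.
  by rewrite ge_max !le_max lexx /= h2 orbT.
by [].
Qed.

Lemma min32_le (y dl : R) : 0 < dl -> min32 y <= dl / 2 * y ^+ 2 + (2 * dl)^-1 * y ^+ 4.
Proof.
move=> d0; apply: (@le_trans _ _ (`|y| ^+ 3)); first by rewrite /min32 ge_min lexx.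
have y4 : y ^+ 4 = `|y| ^+ 4 by rewrite -normrX ger0_norm // exprn_even_ge0.
rewrite y4 -(real_normK (num_real y)) -subr_ge0.
have -> : dl / 2 * `|y| ^+ 2 + (2 * dl)^-1 * `|y| ^+ 4 - `|y| ^+ 3
  = (2 * dl)^-1 * (`|y| * (dl - `|y|)) ^+ 2 by field; rewrite gt_eqF.
by rewrite mulr_ge0 ?sqr_ge0 // invr_ge0 mulr_ge0 // ltW.
Qed.

(** Grid increments have variance [1 / m] and fourth moment at most [128 / m ^+ 2]. By [min32_le]
    with [dl = tau * th ^+ 2], the truncated moment times [m] is at most
    [tau / 2 + 64 / (m * tau * th ^+ 6)], and the condition on [m] makes the second term at most
    [tau / 2]. *)
Lemma wiener_host_bound (th tau : R) (m : nat) : 0 < th -> th <= 10 / 47 -> 0 < tau -> tau <= th ->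
  (0 < m)%N -> 128 <= m%:R * (tau ^+ 2 * th ^+ 6) -> forall eta, 0 < eta ->
  exists2 h0 : R, 0 < h0 & forall h M, 0 < h -> h < h0 ->
  m%:R * (m%:R^-1 * (th ^+ 2)^-1) + 2 <= M%:R * h ^+ 2 -> forall E, measurable E ->
  mass Q E <= exl (coin R) M (followed_ind (incr m th) m (m%:R^-1 * (th ^+ 2)^-1) h E) [::]
   + 47 / 10 * tau + eta.
Proof.
move=> th0 th1 tau0 tau1 m0 mbig eta eta0.
have mp : 0 < m%:R :> R by rewrite ltr0n.
pose X w := B w (grid 1 m) - B w (grid 0 m); pose sg := Num.sqrt (m%:R^-1 : R).
have sg0 : 0 < sg by rewrite sqrtr_gt0 invr_gt0.
have sg2 : sg ^+ 2 = m%:R^-1 by rewrite sqr_sqrtr // invr_ge0 ltW.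
have mX : measurable_fun setT X by apply: measurable_funB; exact: wiener_measurable.
have lawX A : measurable A -> Q (X @^-1` A) = normal_prob 0 sg A by exact: incr_law.
have iX := normal_int mX lawX sg0; have iX2 := normal_sqr_int mX lawX sg0.
have [iX4 X4] := normal_pow4 mX lawX sg0.
have eX := normal_mean mX lawX sg0; have eX2 := normal_var mX lawX sg0.
have Z := integrable_cst1 Q.
have i0 : Q.-integrable setT (EFin \o incr m th 0).
  have [i _] := @Rintegral_comb _ _ _ Q th^-1 0 0 0 _ _ _ _ iX Z Z Z.
  apply: eq_integrable i => // w _ /=; congr EFin; rewrite /incr -/(X w); ring.
have e0 : Rintegral Q setT (incr m th 0) = 0.
  rewrite -[RHS](mul0r th^-1) -eX -RintegralZr //.
have sqE w : incr m th 0 w ^+ 2 = (th ^+ 2)^-1 * X w ^+ 2.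
  by rewrite /incr -/(X w) expr_div_n mulrC.
have i2 : Q.-integrable setT (EFin \o (fun w => incr m th 0 w ^+ 2)).
  rewrite (_ : (fun w => _) = (fun w => (th ^+ 2)^-1 * X w ^+ 2)); last exact/funext.
  exact: (integrableZl measurableT ((th ^+ 2)^-1) iX2).
have e2 : Rintegral Q setT (fun w => incr m th 0 w ^+ 2) = m%:R^-1 * (th ^+ 2)^-1.
  rewrite (_ : (fun w => _) = (fun w => (th ^+ 2)^-1 * X w ^+ 2)); last exact/funext.
  by rewrite RintegralZl // eX2 sg2 mulrC.
pose lam := Rintegral Q setT (fun w => min32 (incr m th 0 w)).
have lamb : m%:R * lam <= tau.
  pose dl := tau * th ^+ 2; have dl0 : 0 < dl by rewrite mulr_gt0 // exprn_gt0.
  have [ic Ec] := @Rintegral_comb _ _ _ Q (dl / 2 * (th ^+ 2)^-1) ((2 * dl)^-1 * (th ^+ 4)^-1) 0 0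
     _ _ _ _ iX2 iX4 Z Z.
  have im : Q.-integrable setT (EFin \o (fun w => min32 (incr m th 0 w))).
    apply: integrable_bounded i2.
      exact: measurableT_comp (@min32_measurable R) (incr_measurable m th 0).
    by move=> w; rewrite ger0_norm ?min32_ge0 // min32_le_sqr.
  have l1 : lam <= dl / 2 * (th ^+ 2)^-1 * sg ^+ 2 + (2 * dl)^-1 * (th ^+ 4)^-1 * (128 * sg ^+ 4).
    apply: (@le_trans _ _ (Rintegral Q setT (fun w => dl / 2 * (th ^+ 2)^-1 * X w ^+ 2
      + (2 * dl)^-1 * (th ^+ 4)^-1 * X w ^+ 4 + 0 * 1 + 0 * 1))).
      apply: le_Rintegral => // w _; apply: le_trans (min32_le _ dl0) _.
      have -> : incr m th 0 w = X w / th by [].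
      by rewrite le_eqVlt; apply/orP; left; apply/eqP; field; rewrite !gt_eqF.
    rewrite Ec eX2 !mul0r !addr0 lerD2l; apply: ler_wpM2l => //.
    by rewrite mulr_ge0 ?invr_ge0 ?exprn_ge0 ?mulr_ge0 // ltW.
  have := ler_wpM2l (ltW mp) l1.
  have -> : m%:R * (dl / 2 * (th ^+ 2)^-1 * sg ^+ 2 + (2 * dl)^-1 * (th ^+ 4)^-1 * (128 * sg ^+ 4))
    = tau / 2 + 128 / (2 * (m%:R * (tau * th ^+ 6))).
    have -> : sg ^+ 4 = m%:R^-1 * m%:R^-1 by rewrite -sg2 -expr2 -exprM.
    by rewrite sg2 /dl; field; rewrite !gt_eqF.
  suff : 128 / (2 * (m%:R * (tau * th ^+ 6))) <= tau / 2.
    by move: (128 / _) (m%:R * lam) => u v; lra.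
  have q0 : 0 < 2 * (m%:R * (tau * th ^+ 6)) by rewrite !mulr_gt0 // exprn_gt0.
  rewrite ler_pdivrMr //.
  by have -> : tau / 2 * (2 * (m%:R * (tau * th ^+ 6))) = m%:R * (tau ^+ 2 * th ^+ 6) by field.
have s0 : 0 < m%:R^-1 * (th ^+ 2)^-1 by rewrite mulr_gt0 // invr_gt0 // exprn_gt0.
have sth : m%:R^-1 * (th ^+ 2)^-1 * m%:R * th ^+ 2 = 1 by field; rewrite !gt_eqF.
have bid i A : (i < m)%N -> measurable A -> Q (incr m th i @^-1` A) = Q (incr m th 0 @^-1` A).
  move=> im mA; have mg : measurable ((fun x : R => x / th) @^-1` A).
    have mf : measurable_fun setT (fun x : R => x / th) by apply: measurable_funM.
    by have := mf measurableT _ mA; rewrite setTI.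
  by have := incr_law im mg; rewrite -(incr_law m0 mg).
have [h0 h00 H] := @host_bound R d' T' Q (incr m th) m _ th lam (incr_measurable m th)
  (incr_indep m th) bid i0 i2 e0 e2 erefl m0 s0 th0 th1 sth (le_trans lamb tau1) eta eta0.
exists h0 => // h M hp hh Mn E mE; apply: le_trans (H h M hp hh Mn E mE) _.
by rewrite lerD2r lerD2l; apply: ler_wpM2l.
Qed.

End Wiener.

(** With [rho <= th / 700], the contribution [(469 / 100 + 2) * rho] of the Wiener side stays below
    [th / 100], the gap between 469/100 and 47/10. *)
Lemma small_fraction (R : realFieldType) (th : R) : 0 < th ->
  exists2 rho : R, 0 < rho & 700 * rho <= th.
Proof. by move=> th0; exists (th / 700); lra. Qed.

Lemma tolerance_lt (R : realFieldType) (th rho : R) : 0 < rho -> 700 * rho <= th ->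
  469 / 100 * th + 469 / 100 * rho + 2 * rho < 47 / 10 * th.
Proof. by lra. Qed.

Lemma small_fraction_le (R : realFieldType) (th rho : R) : 0 < rho -> 700 * rho <= th ->
  th <= 10 / 47 -> rho <= 10 / 47.
Proof. by lra. Qed.

Lemma window_bounds (R : realFieldType) (t h y z x : R) : 0 < h -> z <= t -> t < z + h -> y <= t ->
  t <= y + x -> h <= x -> `|z - y| <= 2 * x /\ `|z - (y + x)| <= 2 * x.
Proof. by move=> *; split; rewrite ler_norml; apply/andP; split; lra. Qed.

Lemma gap_sum (R : realFieldType) (x y z l th tau : R) : z <= (th - l) / 8 -> tau <= (th - l) / 8 ->
  0 < th - l -> x <= y + z + 47 / 10 * l + 47 / 10 * tau + 2 * ((th - l) / 8) ->
  x <= y + 47 / 10 * th.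
Proof. by lra. Qed.

(** * The broken line against the Wiener process *)

Section WalkBound.
Context (R : realType) (d : measure_display) (T : measurableType d) (P : probability T R).
Variables (xi : nat -> T -> R) (n : nat) (S : T -> C01 R).
Hypothesis mxi : forall i, measurable_fun setT (xi i).
Hypothesis ind : independent_RVs P xi.
Hypothesis idd : forall i A, measurable A -> P (xi i @^-1` A) = P (xi 0%N @^-1` A).
Hypothesis ix : P.-integrable setT (EFin \o xi 0%N).
Hypothesis ix2 : P.-integrable setT (EFin \o (fun w => xi 0%N w ^+ 2)).
Hypothesis ex : Rintegral P setT (xi 0%N) = 0.
Hypothesis ex2 : Rintegral P setT (fun w => xi 0%N w ^+ 2) = 1.
Hypothesis n0 : (0 < n)%N.
Hypothesis SL : forall w, is_broken_line n (fun i => xi i w) (S w).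
Context (d' : measure_display) (T' : measurableType d') (Q : probability T' R) (B : T' -> C01 R).
Hypothesis BW : standard_wiener Q B.

Lemma walk_measurable t : measurable_fun setT (fun w => S w t).
Proof.
have [k kn tk] := cell_exists n0 t.
rewrite (_ : (fun w => S w t) = (fun w => S w (grid k n) +
  (set_val t * n%:R - k%:R) * (S w (grid k.+1 n) - S w (grid k n)))); last first.
  by apply/funext => w; exact: (broken_line_cell n0 (SL w)).
have mS j : (j <= n)%N -> measurable_fun setT (fun w => S w (grid j n)).
  move=> jn; rewrite (_ : (fun w => _) = (fun w => (Num.sqrt n%:R)^-1 * \sum_(i < j) xi i w)).
    by apply: measurable_funM => //; apply: measurable_sum.
  by apply/funext => w; exact: (broken_line_node n0 (SL w)).
apply: measurable_funD; first by apply: mS; exact: ltnW.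
by apply: measurable_funM => //; apply: measurable_funB; apply: mS => //; exact: ltnW.
Qed.

(** The strict hypothesis leaves a gap [gam] between [th] and [n * lam]; portions of [gam / 8] bound
    the exceptional oscillation event, the parameter [tau] of the Wiener comparison and each [eta]
    of the gluing. *)
Lemma walk_bound (th : R) (D : set (C01 R)) : 0 < th -> th <= 10 / 47 -> C01_borel D ->
  n%:R * Rintegral P setT (fun w => min32 (xi 0%N w / (Num.sqrt n%:R * th))) < th ->
  mass P (S @^-1` D) <= mass Q (B @^-1` enlargement D (47 / 10 * th)) + 47 / 10 * th.
Proof.
move=> th0 th1 bD; set lam := Rintegral _ _ _ => lamth.
have np : 0 < n%:R :> R by rewrite ltr0n.
have sp : 0 < Num.sqrt n%:R :> R by rewrite sqrtr_gt0.
have st0 : 0 < Num.sqrt n%:R * th by rewrite mulr_gt0.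
pose b i w := xi i w / (Num.sqrt n%:R * th).
pose s : R := n%:R^-1 * (th ^+ 2)^-1.
have s0 : 0 < s by rewrite mulr_gt0 // invr_gt0 // exprn_gt0.
have sth : s * n%:R * th ^+ 2 = 1 by rewrite /s; field; rewrite !gt_eqF.
have sq2 : Num.sqrt n%:R ^+ 2 = n%:R :> R by rewrite sqr_sqrtr // ltW.
have mb i : measurable_fun setT (b i) by apply: measurable_funM.
have indb : independent_RVs P b.
  by apply: (@independent_comp _ _ _ _ _ _ (fun _ x => x / (Num.sqrt n%:R * th))) => // i;
    apply: measurable_funM.
have idb i A : (i < n)%N -> measurable A -> P (b i @^-1` A) = P (b 0%N @^-1` A).
  move=> _ mA; have mg : measurable ((fun x : R => x / (Num.sqrt n%:R * th)) @^-1` A).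
    have mf : measurable_fun setT (fun x : R => x / (Num.sqrt n%:R * th)) by apply: measurable_funM.
    by have := mf measurableT _ mA; rewrite setTI.
  exact: (idd i mg).
have Z := integrable_cst1 P.
have ib : P.-integrable setT (EFin \o b 0%N).
  have [i _] := @Rintegral_comb _ _ _ P (Num.sqrt n%:R * th)^-1 0 0 0 _ _ _ _ ix Z Z Z.
  apply: eq_integrable i => // w _ /=; congr EFin; rewrite /b; ring.
have eb : Rintegral P setT (b 0%N) = 0.
  by rewrite -[RHS](mul0r (Num.sqrt n%:R * th)^-1) -ex -RintegralZr.
have sqE w : b 0%N w ^+ 2 = s * xi 0%N w ^+ 2.
  by rewrite /b expr_div_n exprMn sq2 /s invfM mulrC.
have ib2 : P.-integrable setT (EFin \o (fun w => b 0%N w ^+ 2)).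
  rewrite (_ : (fun w => _) = (fun w => s * xi 0%N w ^+ 2)); last exact/funext.
  exact: (integrableZl measurableT s ix2).
have eb2 : Rintegral P setT (fun w => b 0%N w ^+ 2) = s.
  rewrite (_ : (fun w => _) = (fun w => s * xi 0%N w ^+ 2)); last exact/funext.
  by rewrite RintegralZl // ex2 mulr1.
have HP := @host_bound R d T P b n s th lam mb indb idb ib ib2 eb eb2 erefl n0 s0 th0 th1 sth
  (ltW lamth).
pose gam := th - n%:R * lam; have gam0 : 0 < gam by rewrite subr_gt0.
have [th' th0' th'E] := small_fraction th0.
have th1' := small_fraction_le th0' th'E th1.
have g8 : 0 < gam / 8 by rewrite divr_gt0.
have [N [W [N0 mO QO OO]]] := oscillation_event BW th0' g8.
pose tau := Num.min th' (gam / 8).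
have tau0 : 0 < tau by rewrite lt_min th0' g8.
have tau1 : tau <= th' by rewrite /tau ge_min lexx.
have tau2 : tau <= gam / 8 by rewrite /tau ge_min lexx orbT.
have c0 : 0 < tau ^+ 2 * th' ^+ 6 by rewrite mulr_gt0 // exprn_gt0.
pose m := ((Num.truncn (128 / (tau ^+ 2 * th' ^+ 6))).+1 + N.*2)%N.
have m0 : (0 < m)%N by rewrite /m addSn.
have mp : 0 < m%:R :> R by rewrite ltr0n.
have mbig : 128 <= m%:R * (tau ^+ 2 * th' ^+ 6).
  rewrite -ler_pdivrMr //.
  have q : 0 <= 128 / (tau ^+ 2 * th' ^+ 6) := divr_ge0 (ler0n R 128) (ltW c0).
  have /andP[_ /ltW l] := truncn_itv q; apply: le_trans l _.
  by rewrite ler_nat leq_addr.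
have HQ := wiener_host_bound BW th0' th1' tau0 tau1 m0 mbig.
have sth' : m%:R^-1 * (th' ^+ 2)^-1 * m%:R * th' ^+ 2 = 1 by field; rewrite !gt_eqF.
(* A physical step below [H1] makes one host step last less than a cell of either grid, so the host
   time just before [t] falls into the windows of both ends of the walk's cell. *)
pose H1 : R := (n%:R * m%:R)^-1; have H10 : 0 < H1 by rewrite invr_gt0 mulr_gt0.
have n1 : 1 <= n%:R :> R by rewrite ler1n.
have m1 : 1 <= m%:R :> R by rewrite ler1n.
have H1n : H1 <= n%:R^-1.
  by rewrite lef_pV2 ?posrE ?mulr_gt0 // -[leLHS]mulr1 ler_pM2l.
have H1m : H1 <= m%:R^-1.
  by rewrite lef_pV2 ?posrE ?mulr_gt0 // -[leLHS]mul1r ler_pM2r.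
have H11 : H1 <= 1 by apply: le_trans H1n _; rewrite invf_le1.
have mE : measurable (S @^-1` D) by exact: (borel_preimage_measurable walk_measurable bD).
have mA : measurable (B @^-1` enlargement D (47 / 10 * th)).
  exact: (borel_preimage_measurable (wiener_measurable BW) (enlargement_borel _ _)).
have cb := @coupling_bound R d d' T T' P Q b (incr B m th') n m s (m%:R^-1 * (th' ^+ 2)^-1) th th'
  (47 / 10 * (n%:R * lam)) (47 / 10 * tau) (incr_measurable BW m th') th0 th0' HP HQ
  (S @^-1` D) (B @^-1` enlargement D (47 / 10 * th)) W H1 (gam / 8) H10 g8 mE mA mO.
refine (gap_sum QO tau2 gam0 (cb _)) => {cb}.
  move=> H M w w' eps H0 HH1 HM sz Dw Ow F F'.
  have [B0 osc] := OO _ Ow.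
  have H2 : H ^+ 2 <= H1.
    rewrite expr2; apply: (@le_trans _ _ (H1 * 1)); last by rewrite mulr1.
    by apply: ler_pM; rewrite ?(ltW H0) ?(ltW HH1) // (le_trans (ltW HH1)).
  have Hp : 0 < H ^+ 2 by rewrite exprn_gt0.
  exists (S w) => //; apply: (@C01_dist_lt _ _ _ (469 / 100 * th + 469 / 100 * th' + 2 * th')).
    move=> t; rewrite distrC; have [k kn tk] := cell_exists n0 t.
    have [j jm tj] := cell_exists m0 t.
    have /andP[t0 t1] := unit_itv_itv t.
    have q0 : 0 <= set_val t / H ^+ 2 by rewrite divr_ge0 // ltW.
    have /andP[i1 i2] := truncn_itv q0; set i := Num.truncn _ in i1 i2.
    have {}i1 : i%:R * H ^+ 2 <= set_val t by rewrite -ler_pdivlMr.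
    have {}i2 : set_val t < i%:R * H ^+ 2 + H ^+ 2.
      by move: i2; rewrite -natr1 ltr_pdivrMr // mulrDl mul1r.
    have iH : i%:R * H ^+ 2 <= 1 by exact: le_trans t1.
    have ie : (i <= size eps)%N.
      rewrite sz -(ler_nat R) -(ler_pM2r Hp); apply: le_trans iH _.
      have : n%:R * s <= M%:R * (H / th) ^+ 2 by apply: le_trans HM; rewrite lerDl.
      have -> : n%:R * s = (th ^+ 2)^-1 by rewrite /s mulrA divff ?gt_eqF // mul1r.
      rewrite expr_div_n mulrA => h; rewrite -(ler_pM2r (_ : 0 < (th ^+ 2)^-1)).
        by rewrite mul1r.
      by rewrite invr_gt0 exprn_gt0.
    have jE : set_val (grid j m : unit_itv R) = j%:R / m%:R by apply: grid_val => //; exact: ltnW.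
    have win (a N' : nat) (x : R) : x = N'%:R^-1 -> H ^+ 2 <= x -> a%:R / N'%:R <= set_val t <= a.+1%:R / N'%:R ->
        `|i%:R * H ^+ 2 - a%:R / N'%:R| <= 2 / N'%:R /\ `|i%:R * H ^+ 2 - a.+1%:R / N'%:R| <= 2 / N'%:R.
      move=> xE Hx.
      have aE : a.+1%:R / N'%:R = a%:R * x + x by rewrite xE -[a.+1%:R]natr1 mulrDl mul1r.
      rewrite aE -xE => /andP[u1 u2].
      by have [] := window_bounds Hp i1 i2 u1 u2 Hx.
    have [wk wk1] := win k n _ erefl (le_trans H2 H1n) tk.
    have [wj _] := win j m _ erefl (le_trans H2 H1m) tj.
    have node a : (a <= n)%N -> `|i%:R * H ^+ 2 - a%:R / n%:R| <= 2 / n%:R ->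
        `|S w (grid a n) - B w' t| <= 469 / 100 * th + 469 / 100 * th' + 2 * th'.
      move=> an wa.
      have f1 := follows_unscaled n0 th0 sth F an ie iH wa.
      have f2 := follows_unscaled m0 th0' sth' F' (ltnW jm) ie iH wj.
      rewrite incr_sum // in f2.
      have e1 : th * \sum_(l < a) b l w = S w (grid a n).
        rewrite (broken_line_node n0 (SL w)) // -mulr_suml.
        by move: (\sum_(l < a) _) => y; field; rewrite !gt_eqF.
      have e0 : grid 0 m = grid 0 1 :> unit_itv R.
        by apply: unit_itv_inj; rewrite !grid_val // !mul0r.
      rewrite e1 in f1; rewrite e0 B0 subr0 in f2.
      have f3 : `|B w' t - B w' (grid j m)| <= 2 * th'.
        apply: osc; rewrite jE.
        move: tj => /andP[u1 u2]; rewrite ger0_norm ?subr_ge0 //.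
        apply: (@le_lt_trans _ _ m%:R^-1).
          by move: u2; rewrite -natr1 mulrDl mul1r lerBlDr addrC.
        rewrite ltf_pV2 ?posrE ?ltr0n ?double_gt0 // ltr_nat /m addSn ltnS leq_addl //.
      rewrite (distrC (B w' t)) in f3; rewrite (distrC (B w' (grid j m))) in f2.
      have d1 := ler_normD (S w (grid a n) - H * psum i eps) (H * psum i eps - B w' (grid j m)).
      rewrite subrKA in d1.
      have d2 := ler_normD (S w (grid a n) - B w' (grid j m)) (B w' (grid j m) - B w' t).
      rewrite subrKA in d2.
      apply: le_trans d2 _; apply: lerD => //; apply: le_trans d1 _; apply: lerD; exact: ltW.
    apply: (broken_line_close n0 (SL w) kn tk); first exact: node (ltnW kn) wk.
    exact: node kn wk1.
  exact: tolerance_lt.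
Qed.

End WalkBound.

(** Two comparisons of exponents: [min32 y <= |y| ^ p] for [p] between 2 and 3, and [th ^ p * n ^
    ((p - 2) / 2) <= sqrt n * th ^ 2], as [th <= 1] and [(p - 2) / 2 <= 1 / 2]. The first serves the
    power, the second the quadratic entry of the minimum. *)
Lemma min32_pow (R : realType) (x th p : R) (n : nat) : (0 < n)%N -> 0 < th -> th <= 1 ->
  2 <= p -> p <= 3 ->
  n%:R * min32 (x / (Num.sqrt n%:R * th))
  <= (th `^ p * n%:R `^ ((p - 2) / 2))^-1 * Num.min (`|x| `^ p) (Num.sqrt n%:R * x ^+ 2).
Proof.
move=> n0 th0 th1 p2 p3; set N : R := n%:R.
have N0 : 0 < N by rewrite ltr0n.
have N1 : 1 <= N by rewrite ler1n.
have s0 : 0 < Num.sqrt N by rewrite sqrtr_gt0.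
have q0 : 0 < th `^ p by rewrite powR_gt0.
have v0 : 0 < N `^ ((p - 2) / 2) by rewrite powR_gt0.
have st0 : 0 < Num.sqrt N * th by rewrite mulr_gt0.
set y := x / (Num.sqrt N * th).
have c0 : 0 < th `^ p * N `^ ((p - 2) / 2) by rewrite mulr_gt0.
have sq2 : Num.sqrt N ^+ 2 = N by rewrite sqr_sqrtr // ltW.
have xy : `|x| = `|y| * (Num.sqrt N * th) by rewrite /y normrM normfV (gtr0_norm st0) divfK ?gt_eqF.
have y2 : y ^+ 2 = `|y| ^+ 2 by rewrite real_normK ?num_real.
have b1 : min32 y <= `|y| `^ p.
  have [y0|y0] := eqVneq `|y| 0.
    by apply: le_trans (min32_le_sqr y) _; rewrite y2 y0 expr0n /= powR_ge0.
  have yp : 0 < `|y| by rewrite lt_neqAle eq_sym y0 normr_ge0.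
  have [y1|y1] := leP `|y| 1.
    apply: (@le_trans _ _ (`|y| ^+ 3)); first by rewrite /min32 ge_min lexx.
    by rewrite -powR_mulrn //; apply: ger_powR => //; rewrite yp.
  apply: le_trans (min32_le_sqr y) _; rewrite y2 -powR_mulrn //.
  by apply: ler_powR => //; exact: ltW.
have sp : Num.sqrt N `^ p = N * N `^ ((p - 2) / 2).
  rewrite -powR12_sqrt ?(ltW N0) // -powRrM -{2}(powRr1 (ltW N0)) -powRD.
    by congr (_ `^ _); field.
  by rewrite (gt_eqF N0) implybT.
have e1 : `|x| `^ p = N * `|y| `^ p * (th `^ p * N `^ ((p - 2) / 2)).
  rewrite xy powRM ?(ltW st0) // powRM ?(ltW s0) ?(ltW th0) // sp; ring.
have e2 : Num.sqrt N * x ^+ 2 = N * y ^+ 2 * (Num.sqrt N * th ^+ 2).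
  have -> : x ^+ 2 = y ^+ 2 * (Num.sqrt N ^+ 2 * th ^+ 2).
    by rewrite -(real_normK (num_real x)) xy y2; ring.
  by rewrite sq2; ring.
have b2 : th `^ p * N `^ ((p - 2) / 2) <= Num.sqrt N * th ^+ 2.
  rewrite mulrC; apply: ler_pM; rewrite ?powR_ge0 //.
    by rewrite -powR12_sqrt ?(ltW N0) //; apply: ler_powR => //; move: p3; clear; lra.
  by rewrite -powR_mulrn ?(ltW th0) //; apply: ger_powR => //; rewrite th0.
rewrite mulrC [leRHS]mulrC ler_pdivlMr // le_min; apply/andP; split.
  rewrite e1 (mulrC _ N); apply: ler_wpM2r; first exact: ltW.
  by apply: ler_wpM2l => //; exact: ltW.
rewrite e2 (mulrC _ N); apply: ler_pM => //.
- by rewrite mulr_ge0 ?min32_ge0 // ltW.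
- exact: ltW.
- by apply: ler_wpM2l; [exact: ltW|exact: min32_le_sqr].
Qed.

(** Raising the hypothesis to the power [p + 1] clears the roots, since [(p - 2) / (2 * p + 2) * (p
    + 1) = (p - 2) / 2]. *)
Lemma threshold_pow (R : realType) (th p L : R) (n : nat) : (0 < n)%N -> 0 < th -> 2 <= p -> 0 <= L ->
  L `^ (1 / (p + 1)) / n%:R `^ ((p - 2) / (2 * p + 2)) < th ->
  (th `^ p * n%:R `^ ((p - 2) / 2))^-1 * L < th.
Proof.
move=> n0 th0 p2 L0; set N : R := n%:R; have N0 : 0 < N by rewrite ltr0n.
have p10 : 0 < p + 1 by move: p2; clear; lra.
have p1n : p + 1 != 0 by rewrite gt_eqF.
have v0 : 0 < N `^ ((p - 2) / (2 * p + 2)) by rewrite powR_gt0.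
rewrite ltr_pdivrMr // => h.
have := gt0_ltr_powR p10 _ _ h; rewrite !nnegrE powR_ge0 => /(_ isT).
rewrite mulr_ge0 ?(ltW th0) ?(ltW v0) // => /(_ isT).
rewrite -powRrM div1r mulVf // powRr1 // powRM ?(ltW th0) ?(ltW v0) // -powRrM.
have -> : (p - 2) / (2 * p + 2) * (p + 1) = (p - 2) / 2.
  have -> : 2 * p + 2 = 2 * (p + 1) by ring.
  by field.
have -> : th `^ (p + 1) = th * th `^ p.
  rewrite addrC powRD ?powRr1 ?(ltW th0) //.
  by rewrite (gt_eqF th0) implybT.
move=> q; rewrite mulrC ltr_pdivrMr ?mulr_gt0 ?powR_gt0 //.
by rewrite mulrA.
Qed.

Lemma prokhorov_le (R : realType) (d d' : measure_display)
    (T : measurableType d) (T' : measurableType d') (P : probability T R) (Q : probability T' R)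
    (S : T -> C01 R) (B : T' -> C01 R) (e : R) : 0 < e ->
  (forall t, measurable_fun setT (fun w => S w t)) ->
  (forall t, measurable_fun setT (fun w => B w t)) ->
  (forall D, C01_borel D -> mass P (S @^-1` D) <= mass Q (B @^-1` enlargement D e) + e) ->
  prokhorov P Q S B <= e.
Proof.
move=> e0 mS mB H; apply: ge_inf; first by exists 0 => x [/ltW].
split => //; apply: ge_ereal_sup => _ [D bD <-].
rewrite -(massE P (borel_preimage_measurable mS bD)).
rewrite -(massE Q (borel_preimage_measurable mB (enlargement_borel D e))).
by rewrite -EFinB lee_fin lerBlDl; exact: H.
Qed.

Theorem mainTheorem4 (R : realType)
  (d : measure_display) (T : measurableType d) (P : probability T R)
  (X : nat -> {RV P >-> R}) (mu sigma : R)
  (X_indep : independent_RVs P (fun i => X i : T -> R))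
  (X_ident : identically_distributed P (fun i => X i : T -> R))
  (X_mean : ('E_P[X 0%N] = mu%:E)%E)
  (sigma_gt0 : 0 < sigma)
  (X_var : ('V_P[X 0%N] = (sigma ^+ 2)%:E)%E)
  (xi : nat -> T -> R)
  (xiE : forall i w, xi i w = (X i w - mu) / sigma)
  (n : nat) (n_ge1 : (1 <= n)%N)
  (S : T -> C01 R)
  (S_line : forall w, is_broken_line n (fun i => xi i w) (S w))
  (d' : measure_display) (T' : measurableType d') (Q : probability T' R)
  (B : T' -> C01 R) (B_wiener : standard_wiener Q B)
  (p : R) (p_ge2 : 2 <= p) (p_le3 : p <= 3) :
  ((prokhorov P Q S B)%:E <=
     (47 / 10)%:E *
       ('E_P[fun w => Num.min (`|xi 0%N w| `^ p)%R (Num.sqrt n%:R * xi 0%N w ^+ 2)%R]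
          `^ (1 / (p + 1)))
     / (n%:R `^ ((p - 2) / (2 * p + 2)))%:E)%E
  /\
  ((47 / 10)%:E *
       ('E_P[fun w => Num.min (`|xi 0%N w| `^ p)%R (Num.sqrt n%:R * xi 0%N w ^+ 2)%R]
          `^ (1 / (p + 1)))
     / (n%:R `^ ((p - 2) / (2 * p + 2)))%:E <=
   (47 / 10)%:E * ('E_P[fun w => (`|xi 0%N w| `^ p)%R] `^ (1 / (p + 1)))
     / (n%:R `^ ((p - 2) / (2 * p + 2)))%:E)%E.
Proof.
have xif i : xi i = (fun w => (X i w - mu) / sigma) by apply/funext => w; exact: xiE.
have mg : measurable_fun setT (fun x : R => (x - mu) / sigma).
  by apply: measurable_funM => //; apply: measurable_funB.
have mX i : measurable_fun setT (X i) by [].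
have mxi i : measurable_fun setT (xi i).
  by rewrite xif; apply: measurable_funM => //; apply: measurable_funB.
have ind : independent_RVs P xi.
  rewrite (_ : xi = (fun i w => (X i w - mu) / sigma)); last by apply/funext => i; exact: xif.
  exact: (@independent_comp _ _ _ _ _ _ (fun _ x => (x - mu) / sigma)).
have idd i A : measurable A -> P (xi i @^-1` A) = P (xi 0%N @^-1` A).
  move=> mA; rewrite !xif; apply: (X_ident i 0%N ((fun x : R => (x - mu) / sigma) @^-1` A)).
  by have := mg measurableT _ mA; rewrite setTI.
have vE : (\int[P]_w ((X 0%N w - mu) ^+ 2)%:E = (sigma ^+ 2)%:E)%E.
  move: X_var; rewrite /variance covariance.unlock X_mean expectation.unlock /= => <-.
  by apply: eq_integral => w _; rewrite expr2.
have ic2 : P.-integrable setT (EFin \o (fun w => (X 0%N w - mu) ^+ 2)).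
  apply/integrableP; split.
    by apply/measurable_EFinP; apply: measurable_funX; apply: measurable_funB.
  rewrite (eq_integral (fun w => ((X 0%N w - mu) ^+ 2)%:E)) ?vE ?ltry //.
  by move=> w _ /=; rewrite ger0_norm // sqr_ge0.
have sg : sigma != 0 by rewrite gt_eqF.
have sqE w : xi 0%N w ^+ 2 = (sigma ^+ 2)^-1 * (X 0%N w - mu) ^+ 2.
  by rewrite xiE expr_div_n mulrC.
have ix2 : P.-integrable setT (EFin \o (fun w => xi 0%N w ^+ 2)).
  rewrite (_ : (fun w => _) = (fun w => (sigma ^+ 2)^-1 * (X 0%N w - mu) ^+ 2)); last exact/funext.
  exact: (integrableZl measurableT (sigma ^+ 2)^-1 ic2).
have ex2 : Rintegral P setT (fun w => xi 0%N w ^+ 2) = 1.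
  rewrite (_ : (fun w => _) = (fun w => (sigma ^+ 2)^-1 * (X 0%N w - mu) ^+ 2)); last exact/funext.
  by rewrite RintegralZl // /Rintegral vE /= mulVf // expf_neq0.
have Z := integrable_cst1 P.
have ix : P.-integrable setT (EFin \o xi 0%N).
  have [i _] := @Rintegral_comb _ _ _ P 1 1 0 0 _ _ _ _ Z ix2 Z Z.
  apply: integrable_bounded i => // w; have := sqr_ge0 (`|xi 0%N w| - 1).
  rewrite sqrrB real_normK ?num_real //; have := sqr_ge0 (xi 0%N w); clear; lra.
have ex : Rintegral P setT (xi 0%N) = 0.
  have [i E] := @Rintegral_comb _ _ _ P sigma mu 0 0 _ _ _ _ ix Z Z Z.
  have XE : (fun w => sigma * xi 0%N w + mu * 1 + 0 * 1 + 0 * 1) = X 0%N :> (T -> R).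
    by apply/funext => w; rewrite xiE; field.
  rewrite XE Rintegral_cst1 in E.
  have : Rintegral P setT (X 0%N) = mu.
    by move: X_mean; rewrite expectation.unlock /Rintegral => ->.
  rewrite E => q; have : sigma * Rintegral P setT (xi 0%N) = 0 by move: q; clear; lra.
  by move=> /eqP; rewrite mulf_eq0 (negbTE sg) /= => /eqP.
have mS := walk_measurable mxi n_ge1 S_line.
have mB := wiener_measurable B_wiener.
have mpow : measurable_fun setT (fun w => `|xi 0%N w| `^ p).
  apply: (measurableT_comp (measurable_powR p)); exact: measurableT_comp.
have mmin : measurable_fun setT (fun w => Num.min (`|xi 0%N w| `^ p) (Num.sqrt n%:R * xi 0%N w ^+ 2)).
  by apply: measurable_minr => //; apply: measurable_funM => //; apply: measurable_funX.
have min0 w : 0 <= Num.min (`|xi 0%N w| `^ p) (Num.sqrt n%:R * xi 0%N w ^+ 2).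
  by rewrite le_min powR_ge0 mulr_ge0 ?sqr_ge0 // sqrtr_ge0.
have np : 0 < n%:R :> R by rewrite ltr0n.
have p10 : 0 <= 1 / (p + 1) by rewrite divr_ge0 //; move: p_ge2; clear; lra.
have v0 : 0 < n%:R `^ ((p - 2) / (2 * p + 2)) by rewrite powR_gt0.
have vinv : (((n%:R `^ ((p - 2) / (2 * p + 2)))%:E)^-1 = ((n%:R `^ ((p - 2) / (2 * p + 2)))^-1)%:E)%E.
  by rewrite inver gt_eqF.
(* The second inequality stays in the extended reals, where monotonicity also covers an infinite
   moment of order [p]. *)
split; last first.
  rewrite vinv; apply: lee_wpmul2r; first by rewrite lee_fin invr_ge0 ltW.
  apply: lee_wpmul2l; first by rewrite lee_fin divr_ge0.
  have E0 (f : T -> R) : (forall w, 0 <= f w) -> ('E_P[f] \in `[0, +oo])%E.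
    move=> f0; rewrite in_itv /= leey andbT expectation.unlock.
    by apply: integral_ge0 => w _; rewrite lee_fin.
  apply: gt0_ler_poweR => //; [exact: E0|by apply: E0 => w; exact: powR_ge0|].
  rewrite expectation.unlock; apply: ge0_le_integral => //.
  - by move=> w _; rewrite lee_fin.
  - exact/measurable_EFinP.
  - exact/measurable_EFinP.
  - by move=> w _; rewrite lee_fin ge_min lexx.
pose g w := Num.min (`|xi 0%N w| `^ p) (Num.sqrt n%:R * xi 0%N w ^+ 2).
pose L := Rintegral P setT g.
have ig : P.-integrable setT (EFin \o g).
  have i := integrableZl measurableT (Num.sqrt n%:R) ix2.
  apply: (@integrable_bounded _ _ _ _ _ (fun w => Num.sqrt n%:R * xi 0%N w ^+ 2)) => // w.
  by rewrite ger0_norm ?min0 // /g ge_min lexx orbT.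
have L0 : 0 <= L by apply: Rintegral_ge0 => w _; exact: min0.
have EL : ('E_P[g] = L%:E)%E.
  by rewrite expectation.unlock /L /Rintegral fineK // integrable_fin_num.
rewrite -/g EL vinv poweR_EFin -!EFinM lee_fin -mulrA.
set r := L `^ _ / _.
have r0 : 0 <= r by rewrite divr_ge0 ?powR_ge0.
(* [walk_bound] needs a strict inequality for [th], which [r] itself would not give; an arbitrarily
   small [e] supplies it. *)
apply/ler_addgt0Pr => e e0.
have e1 : 0 < 47 / 10 * r + e by apply: ltr_wpDl => //; rewrite mulr_ge0 // divr_ge0.
apply: prokhorov_le => // D bD.
(* A bound of at least 1 holds trivially for a probability; otherwise [th <= 10 / 47], the range in
   which the constants were verified. *)
have [big|small] := leP 1 (47 / 10 * r + e).
  apply: (@le_trans _ _ 1); first by apply: mass_le; exact: (borel_preimage_measurable mS bD).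
  by apply: le_trans big _; rewrite lerDr mass_ge0.
pose th := 10 / 47 * (47 / 10 * r + e).
have thE : 47 / 10 * r + e = 47 / 10 * th by rewrite /th; clear; lra.
have th0 : 0 < th by move: e1; rewrite thE; clear; lra.
have th1 : th <= 10 / 47 by move: small; rewrite thE; clear; lra.
have rth : r < th by move: e0; rewrite /th; clear; lra.
rewrite thE; apply: (walk_bound mxi ind idd ix ix2 ex ex2 n_ge1 S_line B_wiener) => //.
apply: le_lt_trans (threshold_pow n_ge1 th0 p_ge2 L0 rth).
set c := (th `^ p * _)^-1.
have mmn : measurable_fun setT (fun w => min32 (xi 0%N w / (Num.sqrt n%:R * th))).
  by apply: (measurableT_comp (@min32_measurable R)); apply: measurable_funM.
have im : P.-integrable setT (EFin \o (fun w => min32 (xi 0%N w / (Num.sqrt n%:R * th)))).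
  have i := integrableZl measurableT (((Num.sqrt n%:R * th) ^+ 2)^-1) ix2.
  apply: (@integrable_bounded _ _ _ _ _ (fun w => ((Num.sqrt n%:R * th) ^+ 2)^-1 * xi 0%N w ^+ 2)) => //.
  move=> w; rewrite ger0_norm ?min32_ge0 //; apply: le_trans (min32_le_sqr _) _.
  by rewrite expr_div_n mulrC.
rewrite -!RintegralZl //; apply: le_Rintegral => //.
- exact: (integrableZl measurableT n%:R im).
- exact: (integrableZl measurableT c ig).
- move=> w _; apply: min32_pow => //; apply: le_trans th1 _; clear; lra.
Qed.
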